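(* Let $k\geq 4$ be an integer and let $\mathcal H$ be a $\{2,3\}$-uniform linear hypergraph on $n$ vertices that contains no Berge path of length $k$ as a subhypergraph. Then the number of edges of the $2$-shadow $\partial\mathcal H$ is at most $\frac{k-1}{2}n$.
   Context: A hypergraph $\mathcal H$ is a family of subsets (hyperedges) of a finite vertex set $V(\mathcal H)$. For a set of integers $R$, $\mathcal H$ is $R$-uniform if the size of every hyperedge belongs to $R$; thus a $\{2,3\}$-uniform hypergraph has all hyperedges of size $2$ or $3$. It is linear if any two distinct hyperedges share at most one vertex. The $2$-shadow $\partial\mathcal H$ is the graph on vertex set $V(\mathcal H)$ whose edge set is $\{\{u,v\}: u\neq v,\ \{u,v\}\subseteq h \text{ for some } h\in E(\mathcal H)\}$. A Berge path of length $k$ in $\mathcal H$ is an alternating sequence $v_1,h_1,v_2,h_2,\dots,h_k,v_{k+1}$ of pairwise distinct vertices $v_1,\dots,v_{k+1}$ and pairwise distinct hyperedges $h_1,\dots,h_k$ of $\mathcal H$ such that $\{v_i,v_{i+1}\}\subseteq h_i$ for all $i\in\{1,\dots,k\}$. *)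

(* Defs.v *)
From mathcomp Require Import all_boot.
Set Implicit Arguments. Unset Strict Implicit. Unset Printing Implicit Defensive.

(* A hypergraph on the finite vertex type T is a set E of hyperedges (subsets of T).
   The vertex set V(H) is the whole type T, so n = #|T|. *)

Definition uniform23 (T : finType) (E : {set {set T}}) : Prop :=
  forall h, h \in E -> (#|h| == 2) || (#|h| == 3).

Definition linear_hg (T : finType) (E : {set {set T}}) : Prop :=
  forall h1 h2, h1 \in E -> h2 \in E -> h1 != h2 -> #|h1 :&: h2| <= 1.

Definition shadow2 (T : finType) (E : {set {set T}}) : {set {set T}} :=
  [set e : {set T} | (#|e| == 2) && [exists h in E, e \subset h]].

Definition berge_path (T : finType) (E : {set {set T}}) (k : nat)
  (v : nat -> T) (h : nat -> {set T}) : Prop :=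
  {in [pred i | i <= k] &, injective v} /\
  {in [pred i | i < k] &, injective h} /\
  (forall i, i < k -> [/\ h i \in E, v i \in h i & v i.+1 \in h i]).

Definition has_berge_path (T : finType) (E : {set {set T}}) (k : nat) : Prop :=
  exists v h, berge_path E k v h.

(* Main.v *)
Require Import Defs.
From mathcomp Require Import all_boot zify.
Set Implicit Arguments. Unset Strict Implicit. Unset Printing Implicit Defensive.

(* In a minimal counterexample every set S of vertices meets more than
   (k-1)|S|/2 shadow edges; hence all degrees are at least k/2, adjacent vertices
   have degree sum greater than k, and so on. Let l < k be the length of a longest
   Berge path. Joining the two ends of a longest path through a pair of crossing
   chords produces a Berge cycle of length at least l-1: a chord may belong to a
   hyperedge of the path itself, and each such hyperedge costs one vertex of the
   cycle.

   A cycle of length L > l cannot exist, since by connectivity it would extend to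
   a path longer than l. If L = l-1 or L = l, the vertices outside the cycle are
   pairwise non-adjacent. For such a cycle, count the shadow edges: an outside
   vertex w lying on b_w of the hyperedges of the cycle has at most (L + 3 b_w)/2
   neighbours, and the first vertices of these b_w hyperedges are pairwise
   non-adjacent up to few exceptions. As sum (b_w - 1)^2 >= 0, there are at most
   (L+1)n/2 edges. Only L = l = k-1 remains, where paths longer than l are
   excluded as well and give the bound Ln/2. *)

(* [lia] is slow in the presence of many boolean membership hypotheses. *)
Ltac nlia :=
  repeat match goal with
  | H : is_true (_ <= _) |- _ => revert H
  | H : is_true ((_ <= _) && (_ <= _)) |- _ => revert H
  | H : @eq nat _ _ |- _ => revert H
  | H : is_true (@eq_op Datatypes_nat__canonical__eqtype_Equality _ _) |- _ => revert H
  | H : is_true (~~ @eq_op Datatypes_nat__canonical__eqtype_Equality _ _) |- _ => revert H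
  end; clear; intros; lia.

(** The third vertex of a hyperedge is the constant obstacle. At the start [v 0] of a longest path
    it spoils the usual pigeonhole for crossing chords: [v 0] may have one neighbour off the path,
    in [h 0]. That neighbour is an equally good start, and the two starts together see at least
    (k-1)/2 indices of the path. Without crossing chords both ends must meet this bound exactly, so
    l = k-1 and both starts have degree at most (k+1)/2. Rerouting makes [v 1] a start as well, and
    these three vertices form a triangle too sparse for minimality. Non-adjacency outside a cycle of
    length l-1 is equally tight. Two adjacent outside vertices could replace an arc of one or two
    hyperedges, giving a cycle of length l+1 or l; this limits their degree sum to l+2, and only
    density at a triangle or at a 4-cycle refutes the equality case. Minimality ranges over vertex
    subsets, the hyperedges being cut down to their traces. A triple may leave a pair, which is why
    both sizes are carried through the whole argument. *)

Section Hypergraph.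
Variables (T : finType) (E : {set {set T}}).

Definition adj (x y : T) : bool :=
  (x != y) && [exists h in E, (x \in h) && (y \in h)].

Definition deg (x : T) : nat := \sum_(y : T) adj x y.

Lemma adjP x y :
  reflect (x != y /\ exists h, [/\ h \in E, x \in h & y \in h]) (adj x y).
Proof.
apply: (iffP andP) => [[xy /existsP[h /and3P[? ? ?]]]|[xy [h [? ? ?]]]].
  by split=> //; exists h.
by split=> //; apply/existsP; exists h; apply/and3P.
Qed.

Lemma adj_sym x y : adj x y = adj y x.
Proof.
rewrite /adj eq_sym; congr andb; apply: eq_existsb => h.
by rewrite [(x \in h) && _]andbC.
Qed.

Lemma adj_irr x : adj x x = false.
Proof. by rewrite /adj eqxx. Qed.

Lemma adj_edge h x y : h \in E -> x \in h -> y \in h -> x != y -> adj x y.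
Proof. by move=> hE xh yh xy; apply/adjP; split=> //; exists h. Qed.

Lemma linear_eq (lin : linear_hg E) h g x y :
  h \in E -> g \in E -> x != y -> x \in h -> y \in h -> x \in g -> y \in g ->
  h = g.
Proof.
move=> hE gE xy xh yh xg yg; apply/eqP; apply: contraT => hg.
have := lin _ _ hE gE hg; rewrite leqNgt => /negP[].
apply/card_gt1P; exists x, y; split=> //; by rewrite inE ?xh ?yh.
Qed.

Lemma uniform_le3 (uni : uniform23 E) h : h \in E -> #|h| <= 3.
Proof. by move=> /uni /orP[] /eqP->. Qed.

Lemma uniform_ge2 (uni : uniform23 E) h : h \in E -> 2 <= #|h|.
Proof. by move=> /uni /orP[] /eqP->. Qed.

Lemma uniform_mem3 (uni : uniform23 E) h a b c x :
  h \in E -> uniq [:: a; b; c] -> a \in h -> b \in h -> c \in h -> x \in h ->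
  x \in [:: a; b; c].
Proof.
move=> hE un ah bh ch xh; apply: contraT => nx.
have u4 : uniq [:: x; a; b; c] by rewrite cons_uniq nx un.
have := uniform_le3 uni hE; suff : 4 <= #|h| by lia.
have <- : #|[:: x; a; b; c]| = 4 by apply/card_uniqP.
apply: subset_leq_card; apply/subsetP => y.
by rewrite !inE => /or4P[] /eqP->.
Qed.

Lemma uniform_no4 (uni : uniform23 E) h a b c d :
  h \in E -> uniq [:: a; b; c; d] ->
  a \in h -> b \in h -> c \in h -> d \in h -> False.
Proof.
move=> hE; rewrite cons_uniq => /andP[nin un] ah bh ch dh.
by move: nin; rewrite (uniform_mem3 uni hE un).
Qed.

(** * Berge paths as segments of the incidence graph *)

Local Notation node := (T + {set T})%type.

(* Berge paths and cycles of E are the paths and cycles of this bipartite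
   incidence graph. *)
Definition inc (a b : node) : bool :=
  match a, b with
  | inl x, inr h | inr h, inl x => (h \in E) && (x \in h)
  | _, _ => false
  end.

Lemma inc_sym : symmetric inc.
Proof. by case=> [x|h] [y|g]. Qed.

(** The list contains both end nodes: [uniq] then states distinctness of vertices and of hyperedges
    at once, and gluing two segments costs exactly one incidence. *)
Definition seg (a : node) (s : seq node) (b : node) : bool :=
  if s is c :: s' then [&& c == a, path inc a s' & last a s' == b] else false.

Lemma seg1 a : seg a [:: a] a.
Proof. by rewrite /= !eqxx. Qed.

Lemma seg_cat a s b a' s' b' :
  seg a s b -> inc b a' -> seg a' s' b' -> seg a (s ++ s') b'.
Proof.
case: s => // c s /and3P[/eqP-> ps /eqP lb] i.
case: s' => // c' s' /and3P[/eqP-> ps' /eqP lb'].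
by rewrite /= eqxx cat_path ps /= lb i ps' last_cat /= lb' eqxx.
Qed.

Lemma seg_cons a a' s b : inc a a' -> seg a' s b -> seg a (a :: s) b.
Proof. by move=> i sg; apply: (seg_cat (seg1 a) i sg). Qed.

Lemma seg_rev a s b : seg a s b -> seg b (rev s) a.
Proof.
elim: s a => // c s IH a /and3P[/eqP-> ps /eqP lb].
case: s ps lb IH => [|d s] /= ps lb IH.
  by rewrite -lb !eqxx.
case/andP: ps => i ps; rewrite rev_cons -cats1.
apply: (seg_cat (b := d)); last exact: seg1; last by rewrite inc_sym.
by apply: IH; rewrite !eqxx ps lb eqxx.
Qed.

Lemma seg_parity x s b z0 i : seg (inl x) s b -> i < size s ->
  if odd i then exists g, nth z0 s i = inr g else exists z, nth z0 s i = inl z.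
Proof.
case: s => // c s /and3P[/eqP-> ps _].
elim: i => [|i IH] /= li; first by exists x.
have {IH} := IH (ltnW li); have := pathP z0 ps i li.
case: (odd i) => /= ic [z e]; move: ic; rewrite e.
  by case: (nth z0 s i) => [y|g] //= _; exists y.
by case: (nth z0 s i) => [y|g] //= _; exists g.
Qed.

Lemma seg_even x s b z0 i : seg (inl x) s b -> i < size s -> ~~ odd i ->
  exists z, nth z0 s i = inl z.
Proof. by move=> sg li; move: (seg_parity z0 sg li); case: odd. Qed.

Lemma seg_odd x s b z0 i : seg (inl x) s b -> i < size s -> odd i ->
  exists g, nth z0 s i = inr g.
Proof. by move=> sg li; move: (seg_parity z0 sg li); case: odd. Qed.

Lemma seg_inc a s b z0 i : seg a s b -> i.+1 < size s ->
  inc (nth z0 s i) (nth z0 s i.+1).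
Proof.
case: s => // c s /and3P[/eqP-> ps _] li.
exact: (pathP z0 ps i li).
Qed.

Definition vtx (x : T) (a : node) : T := if a is inl z then z else x.
Definition hed (a : node) : {set T} := if a is inr g then g else set0.

(** Vertices occupy the even positions and hyperedges the odd ones. Only the first [2 * m + 1] nodes
    are read, so a longer segment, or one ending in a hyperedge, serves as well. *)
Lemma seg_berge x s b m : seg (inl x) s b -> uniq s -> m.*2 < size s ->
  has_berge_path E m.
Proof.
move=> sg un lm.
pose v i := vtx x (nth (inl x) s i.*2); pose h i := hed (nth (inl x) s i.*2.+1).
have vE i : i <= m -> nth (inl x) s i.*2 = inl (v i).
  move=> im; have [||z e] := @seg_even _ _ _ (inl x) i.*2 sg; rewrite ?odd_double //; first lia.
  by rewrite /v e.
have hE i : i < m -> nth (inl x) s i.*2.+1 = inr (h i).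
  move=> im; have oi : odd i.*2.+1 by rewrite /= odd_double.
  have li : i.*2.+1 < size s by lia.
  have [z e] := seg_odd (inl x) sg li oi.
  by rewrite /h e.
exists v, h; split; [|split].
- move=> i j; rewrite !inE => im jm e.
  have /eqP : nth (inl x) s i.*2 = nth (inl x) s j.*2 by rewrite !vE // e.
  have li : i.*2 < size s by lia.
  have lj : j.*2 < size s by lia.
  by rewrite nth_uniq // => /eqP; lia.
- move=> i j; rewrite !inE => im jm e.
  have /eqP : nth (inl x) s i.*2.+1 = nth (inl x) s j.*2.+1 by rewrite !hE // e.
  have li : i.*2.+1 < size s by lia.
  have lj : j.*2.+1 < size s by lia.
  by rewrite nth_uniq // => /eqP; lia.
move=> i im.
have := @seg_inc _ _ _ (inl x) i.*2 sg; rewrite vE ?hE //; last lia.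
have := @seg_inc _ _ _ (inl x) i.*2.+1 sg; rewrite -doubleS vE ?hE // => i2 i1.
by have /andP[-> ->] := i2 ltac:(lia); have /andP[_ ->] := i1 ltac:(lia).
Qed.

Section Walk.
Variables (u : nat -> T) (c : nat -> {set T}).

Fixpoint walk (i n : nat) : seq node :=
  if n is m.+1 then inl (u i) :: inr (c i) :: walk i.+1 m else [:: inl (u i)].

Lemma size_walk i n : size (walk i n) = n.*2.+1.
Proof. by elim: n i => //= n IH i; rewrite IH. Qed.

Lemma walk_seg i n :
  (forall j, i <= j < i + n -> [/\ c j \in E, u j \in c j & u j.+1 \in c j]) ->
  seg (inl (u i)) (walk i n) (inl (u (i + n))).
Proof.
elim: n i => [|n IH] i H; first by rewrite addn0 seg1.
have [cE ui uj] := H i ltac:(lia).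
apply: (@seg_cons _ (inr (c i))); first by rewrite /= cE.
apply: (@seg_cons _ (inl (u i.+1))); first by rewrite /= cE.
by rewrite addnS -addSn; apply: IH => j jj; apply: H; lia.
Qed.

Lemma walk_vtx i n x :
  reflect (exists2 j, i <= j <= i + n & x = u j) (inl x \in walk i n).
Proof.
apply: (iffP idP).
  elim: n i => [|n IH] i /=; rewrite !inE.
    by move=> /eqP[->]; exists i => //; lia.
  by case/orP=> [/eqP[->]|/IH[j jj ->]]; [exists i|exists j] => //; lia.
case=> j + ->; elim: n i => [|n IH] i jj /=; rewrite !inE.
  by have -> : j = i by lia.
have [->|ne] := eqVneq j i; first by rewrite eqxx.
by rewrite IH ?orbT //; lia.
Qed.

Lemma walk_hed i n g :
  reflect (exists2 j, i <= j < i + n & g = c j) (inr g \in walk i n).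
Proof.
apply: (iffP idP).
  elim: n i => [|n IH] i /=; rewrite !inE //.
  by case/or3P=> [/eqP//|/eqP[->]|/IH[j jj ->]]; [exists i|exists j] => //; lia.
case=> j + ->; elim: n i => [|n IH] i jj /=; rewrite !inE; first by lia.
have [->|ne] := eqVneq j i; first by rewrite eqxx orbT.
by rewrite IH ?orbT //; lia.
Qed.

Lemma walk_uniq i n :
  {in [pred j | i <= j <= i + n] &, injective u} ->
  {in [pred j | i <= j < i + n] &, injective c} -> uniq (walk i n).
Proof.
elim: n i => [|n IH] i iu ic //=; rewrite inE negb_or /=; apply/and3P; split.
- apply/walk_vtx => -[j jj e].
  by have := iu i j; rewrite !inE => /(_ ltac:(lia) ltac:(lia) e); lia.
- apply/walk_hed => -[j jj e].
  by have := ic i j; rewrite !inE => /(_ ltac:(lia) ltac:(lia) e); lia.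
- by apply: IH => j j'; rewrite !inE => jj jj'; [apply: iu|apply: ic]; rewrite inE; lia.
Qed.

Lemma walk_cat i n m :
  walk i (n + m).+1 = walk i n ++ inr (c (i + n)) :: walk (i + n).+1 m.
Proof.
elim: n i => [|n IH] i; first by rewrite addn0.
by rewrite addSn [walk i n.+1]/= -addSnnS cat_cons cat_cons -IH.
Qed.

End Walk.

(** * Berge cycles, their arcs and insertions into them *)

Record bcycle (L : nat) (u : nat -> T) (c : nat -> {set T}) : Prop := BCycle {
  bc_pos : 0 < L;
  bc_uper : forall i, u (i + L) = u i;
  bc_cper : forall i, c (i + L) = c i;
  bc_uinj : {in [pred i | i < L] &, injective u};
  bc_cinj : {in [pred i | i < L] &, injective c};
  bc_edge : forall i, c i \in E;
  bc_memL : forall i, u i \in c i;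
  bc_memR : forall i, u i.+1 \in c i }.

Definition cvtx (L : nat) (u : nat -> T) : {set T} := [set u (val i) | i : 'I_L].
Definition ched (L : nat) (c : nat -> {set T}) : {set {set T}} :=
  [set c (val i) | i : 'I_L].

Lemma periodic_mod (A : Type) (f : nat -> A) L i :
  (forall j, f (j + L) = f j) -> f (i %% L) = f i.
Proof.
move=> per; rewrite {2}(divn_eq i L) addnC; elim: (i %/ L) => [|q IH].
  by rewrite mul0n addn0.
by rewrite mulSnr addnA per.
Qed.

(** Rotating a sum around the cycle: a count over consecutive pairs of indices becomes twice a count
    over single indices. *)
Lemma sum_shift n (F : nat -> nat) : F n = F 0 ->
  \sum_(i < n) F i.+1 = \sum_(i < n) F i.
Proof.
case: n => [|n] e; first by rewrite !big_ord0.
by rewrite big_ord_recr /= e addnC [in RHS]big_ord_recl.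
Qed.

Section Cycle.
Variables (L : nat) (u : nat -> T) (c : nat -> {set T}).
Hypothesis C : bcycle L u c.

Lemma cyc_umod i : u (i %% L) = u i.
Proof. exact: periodic_mod (bc_uper C). Qed.

Lemma cyc_cmod i : c (i %% L) = c i.
Proof. exact: periodic_mod (bc_cper C). Qed.

Lemma cyc_ueq i j : u i = u j -> i = j %[mod L].
Proof.
rewrite -(cyc_umod i) -(cyc_umod j); apply: (bc_uinj C);
by rewrite inE ltn_mod (bc_pos C).
Qed.

Lemma cyc_ceq i j : c i = c j -> i = j %[mod L].
Proof.
rewrite -(cyc_cmod i) -(cyc_cmod j); apply: (bc_cinj C);
by rewrite inE ltn_mod (bc_pos C).
Qed.

(** Cycles are periodic functions on [nat], so an arc passing the origin is an ordinary interval;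
    injectivity on every window of [L] indices then replaces modular arithmetic. *)
Lemma mod_window a i j : a <= i < a + L -> a <= j < a + L ->
  i = j %[mod L] -> i = j.
Proof.
wlog ij : i j / i <= j => [W|] ai aj e.
  by case: (leqP i j) => ?; [|symmetry]; apply: W => //; lia.
have /eqP := esym e; rewrite eqn_mod_dvd // => /dvdnP[[|q]]; rewrite ?mul0n ?mulSn; lia.
Qed.

Lemma cyc_uwin a : {in [pred i | a <= i < a + L] &, injective u}.
Proof. by move=> i j; rewrite !inE => ai aj /cyc_ueq; apply: mod_window ai aj. Qed.

Lemma cyc_cwin a : {in [pred i | a <= i < a + L] &, injective c}.
Proof. by move=> i j; rewrite !inE => ai aj /cyc_ceq; apply: mod_window ai aj. Qed.

Lemma cvtxP x : reflect (exists i, x = u i) (x \in cvtx L u).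
Proof.
apply: (iffP imsetP) => [[i _ ->]|[i ->]]; first by exists i.
have li : i %% L < L by rewrite ltn_mod (bc_pos C).
by exists (Ordinal li); rewrite //= cyc_umod.
Qed.

Lemma chedP g : reflect (exists i, g = c i) (g \in ched L c).
Proof.
apply: (iffP imsetP) => [[i _ ->]|[i ->]]; first by exists i.
have li : i %% L < L by rewrite ltn_mod (bc_pos C).
by exists (Ordinal li); rewrite //= cyc_cmod.
Qed.

Lemma cvtx_u i : u i \in cvtx L u.
Proof. by apply/cvtxP; exists i. Qed.

Lemma ched_c i : c i \in ched L c.
Proof. by apply/chedP; exists i. Qed.

Lemma off_ne y i : y \notin cvtx L u -> y != u i.
Proof. by apply: contraNneq => ->; apply: cvtx_u. Qed.

Lemma cvtx_index x a : x \in cvtx L u -> exists2 i, a <= i < a + L & x = u i.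
Proof.
case/cvtxP=> i ->; have p := bc_pos C.
(* [q] is the residue of [i - a], written without truncated subtraction. *)
pose q := (i + (L - a %% L)) %% L; have lq : q < L by rewrite ltn_mod.
exists (a + q); first lia.
rewrite -(cyc_umod (a + q)) -(cyc_umod i); congr u.
rewrite /q modnDmr -(modnDml a).
have la : a %% L < L by rewrite ltn_mod.
have -> : a %% L + (i + (L - a %% L)) = i + L by lia.
by rewrite modnDr.
Qed.

Lemma cyc_inc i : [/\ c i \in E, u i \in c i & u i.+1 \in c i].
Proof. by split; [apply: bc_edge C i|apply: bc_memL C i|apply: bc_memR C i]. Qed.

Lemma cyc_walk_seg i n : seg (inl (u i)) (walk u c i n) (inl (u (i + n))).
Proof. by apply: walk_seg => j _; apply: cyc_inc. Qed.

Lemma cyc_walk_uniq i n : n < L -> uniq (walk u c i n).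
Proof.
move=> nL; apply: walk_uniq => j j'; rewrite !inE => ij ij'.
  by apply: (cyc_uwin (a := i)); rewrite inE; lia.
by apply: (cyc_cwin (a := i)); rewrite inE; lia.
Qed.

Lemma cyc_shift a : bcycle L (fun i => u (a + i)) (fun i => c (a + i)).
Proof.
split=> [|i|i|i j|i j|i|i|i]; rewrite ?inE ?addnA ?addnS.
- exact: bc_pos C.
- exact: bc_uper C _.
- exact: bc_cper C _.
- move=> il jl e; suff : a + i = a + j by lia.
  by apply: (cyc_uwin (a := a)) e; rewrite inE; lia.
- move=> il jl e; suff : a + i = a + j by lia.
  by apply: (cyc_cwin (a := a)) e; rewrite inE; lia.
- exact: bc_edge C _.
- exact: bc_memL C _.
- exact: bc_memR C _.
Qed.

Lemma cyc_une i n : 0 < n < L -> u i != u (i + n).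
Proof.
move=> nL; apply/eqP => e; suff : i = i + n by lia.
by apply: (cyc_uwin (a := i)) e; rewrite inE; lia.
Qed.

Lemma cyc_cne i n : 0 < n < L -> c i != c (i + n).
Proof.
move=> nL; apply/eqP => e; suff : i = i + n by lia.
by apply: (cyc_cwin (a := i)) e; rewrite inE; lia.
Qed.

Lemma card_cvtx : #|cvtx L u| = L.
Proof.
rewrite card_imset ?card_ord // => i j e; apply: val_inj.
by apply: (bc_uinj C) e; rewrite inE ltn_ord.
Qed.

Lemma sum_cvtx (F : T -> nat) : \sum_(x in cvtx L u) F x = \sum_(i < L) F (u i).
Proof.
rewrite big_imset //= => i j _ _ e; apply: val_inj.
by apply: (bc_uinj C) e; rewrite inE ltn_ord.
Qed.

(* [g] does not lie on the arc of the cycle from [u (i + n)] to [u (i + L)]. *)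
Definition free i n g := forall j, i + n <= j < i + L -> c j != g.

Lemma free_off i n g : g \notin ched L c -> free i n g.
Proof. by move=> off j _; apply: contraNneq off => <-; apply: ched_c. Qed.

Lemma free_on i n m : m < n -> free i n (c (i + m)).
Proof.
move=> mn j jj; apply/eqP => e; suff : j = i + m by lia.
by apply: (cyc_cwin (a := i)) e; rewrite inE; lia.
Qed.

Lemma free_mem i n g :
  n <= L -> free i n g -> inr g \notin walk u c (i + n) (L - n).
Proof.
move=> nL fr; apply/walk_hed => -[j jj e].
by have := fr j; rewrite e eqxx => /(_ ltac:(lia)).
Qed.

Lemma off_mem i n y : y \notin cvtx L u -> inl y \notin walk u c i n.
Proof. by apply: contra => /walk_vtx[j _ ->]; apply: cvtx_u. Qed.

End Cycle.

(** The vertex and hyperedge sets are returned with the cycle because an exchange argument must know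
    which vertices lie outside the new cycle. *)
Lemma seg_bcycle x s b N : seg (inl x) s b -> inc b (inl x) -> uniq s ->
  size s = N.*2 -> 0 < N ->
  exists u c, [/\ bcycle N u c, forall z, (z \in cvtx N u) = (inl z \in s)
                & forall g, (g \in ched N c) = (inr g \in s)].
Proof.
move=> sg ib un sz N0.
pose v i := vtx x (nth (inl x) s i.*2); pose h i := hed (nth (inl x) s i.*2.+1).
have vE i : i < N -> nth (inl x) s i.*2 = inl (v i).
  move=> im; have ei : ~~ odd i.*2 by rewrite odd_double.
  have li : i.*2 < size s by lia.
  by have [z e] := seg_even (inl x) sg li ei; rewrite /v e.
have hE i : i < N -> nth (inl x) s i.*2.+1 = inr (h i).
  move=> im; have ei : odd i.*2.+1 by rewrite /= odd_double.
  have li : i.*2.+1 < size s by lia.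
  by have [z e] := seg_odd (inl x) sg li ei; rewrite /h e.
have vin i j : i < N -> j < N -> v i = v j -> i = j.
  move=> im jm e.
  have /eqP : nth (inl x) s i.*2 = nth (inl x) s j.*2 by rewrite !vE // e.
  have li : i.*2 < size s by lia.
  have lj : j.*2 < size s by lia.
  by rewrite nth_uniq // => /eqP; lia.
have hin i j : i < N -> j < N -> h i = h j -> i = j.
  move=> im jm e.
  have /eqP : nth (inl x) s i.*2.+1 = nth (inl x) s j.*2.+1 by rewrite !hE // e.
  have li : i.*2.+1 < size s by lia.
  have lj : j.*2.+1 < size s by lia.
  by rewrite nth_uniq // => /eqP; lia.
have ml i : i < N -> h i \in E /\ v i \in h i.
  move=> im; have := @seg_inc _ _ _ (inl x) i.*2 sg; rewrite vE ?hE // => i1.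
  by have /andP[-> ->] := i1 ltac:(lia).
have mr i : i.+1 < N -> v i.+1 \in h i.
  move=> im; have := @seg_inc _ _ _ (inl x) i.*2.+1 sg; rewrite -doubleS vE ?hE //; last lia.
  by move=> i1; have /andP[_ ->] := i1 ltac:(lia).
have v0 : v 0 = x.
  by rewrite /v; move: sg; clear; case: s => // a t /and3P[/eqP-> _ _].
have bE : b = inr (h N.-1).
  rewrite -hE; last lia.
  have -> : N.-1.*2.+1 = (size s).-1 by lia.
  by move: sg; clear; case: s => // a t /and3P[/eqP-> _ /eqP <-]; rewrite nth_last.
have mlast : v 0 \in h N.-1 by move: ib; rewrite bE v0 => /andP[].
have lm i : i %% N < N by rewrite ltn_mod.
exists (fun i => v (i %% N)), (fun i => h (i %% N)); split.
- split=> //.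
  + by move=> i; rewrite modnDr.
  + by move=> i; rewrite modnDr.
  + by move=> i j; rewrite !inE => iN jN; rewrite !modn_small //; apply: vin.
  + by move=> i j; rewrite !inE => iN jN; rewrite !modn_small //; apply: hin.
  + by move=> i; have [] := ml _ (lm i).
  + by move=> i; have [] := ml _ (lm i).
  + move=> i; rewrite -addn1 -modnDml addn1.
    case: (ltnP (i %% N).+1 N) => [lt|ge]; first by rewrite modn_small // mr.
    have e : i %% N = N.-1 by have := lm i; lia.
    by rewrite e prednK // modnn.
- move=> z; apply/imsetP/idP => [[i _ ->]|].
    have li : i.*2 < size s by have := ltn_ord i; lia.
    by rewrite /= modn_small // -vE // mem_nth.
  move=> zs; set j := index (inl z) s; have lj : j < size s by rewrite index_mem.
  have nj : nth (inl x) s j = inl z by rewrite nth_index.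
  case oj: (odd j); first by have [g] := seg_odd (inl x) sg lj oj; rewrite nj.
  have jE : j = j./2.*2 by rewrite -[LHS]odd_double_half oj.
  have jN : j./2 < N by lia.
  exists (Ordinal jN) => //=; rewrite modn_small //.
  by have := vE _ jN; rewrite -jE nj => -[].
- move=> z; apply/imsetP/idP => [[i _ ->]|].
    have li : i.*2.+1 < size s by have := ltn_ord i; lia.
    by rewrite /= modn_small // -hE // mem_nth.
  move=> zs; set j := index (inr z) s; have lj : j < size s by rewrite index_mem.
  have nj : nth (inl x) s j = inr z by rewrite nth_index.
  case oj: (odd j); last by have [g] := seg_even (inl x) sg lj (negbT oj); rewrite nj.
  have jE : j = j./2.*2.+1 by rewrite -[LHS]odd_double_half oj.
  have jN : j./2 < N by lia.
  exists (Ordinal jN) => //=; rewrite modn_small //.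
  by have := hE _ jN; rewrite -jE nj => -[].
Qed.

Definition has_bcycle N := exists u c, bcycle N u c.

Lemma seg_has_bcycle x s b N : seg (inl x) s b -> inc b (inl x) -> uniq s ->
  size s = N.*2 -> 0 < N -> has_bcycle N.
Proof.
move=> sg ib un sz N0; have [u [c [C _ _]]] := seg_bcycle sg ib un sz N0.
by exists u, c.
Qed.

Section Insert.
Variables (L : nat) (u : nat -> T) (c : nat -> {set T}).
Hypothesis C : bcycle L u c.

(** The arc of [n] hyperedges starting at [u i] is replaced by the detour through [g], [y], [g'];
    for [n = 1] the cycle grows by one. *)
Lemma cyc_insert1 i n g y g' : 0 < n <= L -> y \notin cvtx L u ->
  g \in E -> g' \in E -> g != g' -> free L c i n g -> free L c i n g' ->
  u i \in g -> y \in g -> y \in g' -> u (i + n) \in g' ->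
  has_bcycle (L - n).+2.
Proof.
move=> nL yC gE g'E gg' fg fg' uig yg yg' ug'.
have sg1 := cyc_walk_seg C (i + n) (L - n).
have e : u (i + n + (L - n)) = u i by rewrite -(bc_uper C i); congr u; nlia.
have sg2 : seg (inr g) [:: inr g; inl y; inr g'] (inr g').
  by rewrite /= gE yg g'E yg' !eqxx.
apply: (seg_has_bcycle (seg_cat sg1 _ sg2)) => //=.
- by rewrite e gE uig.
- by rewrite g'E ug'.
- rewrite cat_uniq (cyc_walk_uniq C) /=; last nlia.
  rewrite !negb_or /= !free_mem //; try nlia.
  by rewrite (off_mem C) //= !andbT; apply: contra gg' => /eqP[->].
- by rewrite size_cat size_walk /=; nlia.
Qed.

Lemma cyc_insert2 i n g y h z g' : 0 < n <= L ->
  y \notin cvtx L u -> z \notin cvtx L u -> y != z ->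
  g \in E -> h \in E -> g' \in E -> uniq [:: g; h; g'] ->
  free L c i n g -> free L c i n h -> free L c i n g' ->
  u i \in g -> y \in g -> y \in h -> z \in h -> z \in g' -> u (i + n) \in g' ->
  exists u' c', [/\ bcycle (L - n + 3) u' c',
    forall x, (x \in cvtx (L - n + 3) u') =
      [|| inl x \in walk u c (i + n) (L - n), x == y | x == z] &
    forall f, (f \in ched (L - n + 3) c') =
      (inr f \in walk u c (i + n) (L - n)) || (f \in [:: g; h; g'])].
Proof.
move=> nL yC zC yz gE hE g'E un fg fh fg' uig yg yh zh zg' ug'.
have sg1 := cyc_walk_seg C (i + n) (L - n).
have e : u (i + n + (L - n)) = u i by rewrite -(bc_uper C i); congr u; nlia.
have sg2 : seg (inr g) [:: inr g; inl y; inr h; inl z; inr g'] (inr g').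
  by rewrite /= gE yg hE yh zh g'E zg' !eqxx.
have i1 : inc (inl (u (i + n + (L - n)))) (inr g) by rewrite /= e gE uig.
have i2 : inc (inr g') (inl (u (i + n))) by rewrite /= g'E ug'.
have un' : uniq (walk u c (i + n) (L - n) ++ [:: inr g; inl y; inr h; inl z; inr g']).
  rewrite cat_uniq (cyc_walk_uniq C) /=; last nlia.
  rewrite !negb_or /= !free_mem //; try nlia.
  rewrite !(off_mem C) //=; move: un; rewrite /= !inE !negb_or.
  case/and3P=> /andP[gh gg'] hg' _; rewrite !andbT.
  by apply/and3P; split; [apply/andP; split|exact: yz|exact: hg'] => //.
have [|u' [c' [C' Uv Ch]]] := seg_bcycle (seg_cat sg1 i1 sg2) i2 un' (N := L - n + 3) _ ltac:(nlia).
  by rewrite size_cat size_walk /=; nlia.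
exists u', c'; split=> // x; last by rewrite Ch mem_cat !inE.
rewrite Uv mem_cat !inE; congr orb.
exact: (congr1 (orb (x == y)) (orbF (x == z))).
Qed.

End Insert.

(** * Minimal counterexamples: degrees and maximal cycle length *)

Definition arcs (S : {set T}) : nat := \sum_(x in S) \sum_(y in S) adj x y.

(* A counterexample to the theorem on as few vertices as possible, [l] being the
   length of its longest Berge paths. *)
Record critical (k l : nat) (V : {set T}) : Prop := Critical {
  cr_k4 : 4 <= k;
  cr_lk : l < k;
  cr_long : ~ has_berge_path E l.+1;
  cr_uni : uniform23 E;
  cr_lin : linear_hg E;
  cr_sub : forall h, h \in E -> h \subset V;
  cr_card : k < #|V|;
  cr_dense : forall S : {set T}, S \subset V -> S != set0 ->
    (k - 1) * #|S| + arcs S < 2 * \sum_(x in S) deg x;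
  cr_conn : forall S : {set T}, S \subset V -> S != set0 -> S != V ->
    exists x y, [/\ x \in S, y \in V :\: S & adj x y] }.

Section Critical.
Variables (k l : nat) (V : {set T}).
Hypothesis cr : critical k l V.

Let k4 := cr_k4 cr.
Let lk := cr_lk cr.
Let uni := cr_uni cr.
Let lin := cr_lin cr.

Lemma edge_V h x : h \in E -> x \in h -> x \in V.
Proof. by move=> hE; apply: subsetP (cr_sub cr hE) x. Qed.

Lemma adj_V x y : adj x y -> x \in V.
Proof. by case/adjP=> _ [h [hE xh _]]; apply: edge_V hE xh. Qed.

(** Twice the degree sum minus the ordered adjacent pairs inside a set is twice the number of shadow
    edges meeting it. The list form lets the inequality be computed at a vertex, an edge, a triangle
    and a 4-cycle. *)
Lemma dense_seq s : uniq s -> {subset s <= V} -> 0 < size s ->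
  (k - 1) * size s + \sum_(x <- s) \sum_(y <- s) adj x y < 2 * \sum_(x <- s) deg x.
Proof.
move=> us sV s0; pose S := [set x in s].
have SE : S =i s by move=> x; rewrite inE.
have sumS F : \sum_(x <- s) F x = \sum_(x in S) F x :> nat.
  by rewrite (big_uniq _ us); apply: eq_bigl => x; rewrite SE.
rewrite sumS; under eq_bigr do rewrite sumS.
have <- : #|S| = size s by rewrite (eq_card SE); apply/card_uniqP.
rewrite [X in 2 * X]sumS; apply: (cr_dense cr).
  by apply/subsetP => x; rewrite SE => /sV.
by apply/set0Pn; case: s s0 @S SE {us sV sumS} => // a s _ S SE; exists a; rewrite SE mem_head.
Qed.

Lemma deg_low x : x \in V -> k <= 2 * deg x.
Proof.
move=> xV; have := @dense_seq [:: x] isT _ isT; rewrite !big_seq1 adj_irr /=.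
move=> H; have := H _; rewrite muln1 addn0 => H'.
by have := H' ltac:(by move=> y; rewrite inE => /eqP->); lia.
Qed.

Lemma deg_edge x y : adj x y -> k < deg x + deg y.
Proof.
move=> xy; have xne : x != y by case/adjP: xy.
have := @dense_seq [:: x; y]; rewrite /= !inE xne !big_cons !big_nil !adj_irr.
rewrite (adj_sym y x) xy /= => H; have := H isT _ isT; rewrite !addn0 => H'.
have := H' ltac:(by move=> z; rewrite !inE => /orP[] /eqP->;
  [apply: adj_V xy|rewrite adj_sym in xy; apply: adj_V xy]); nlia.
Qed.

Lemma deg_triangle x y z : adj x y -> adj y z -> adj x z ->
  3 * (k - 1) + 6 < 2 * (deg x + deg y + deg z).
Proof.
move=> xy yz xz; have xny : x != y by case/adjP: xy.
have xnz : x != z by case/adjP: xz.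
have ynz : y != z by case/adjP: yz.
have := @dense_seq [:: x; y; z]; rewrite /= !inE negb_or xny xnz ynz.
rewrite !big_cons !big_nil !adj_irr.
rewrite (adj_sym y x) (adj_sym z x) (adj_sym z y) xy yz xz /= => H.
have sV : {subset [:: x; y; z] <= V}.
  move=> t; rewrite !inE => /or3P[] /eqP->; first exact: adj_V xy.
    exact: adj_V yz.
  by apply: (@adj_V _ x); rewrite adj_sym.
by have := H isT sV isT; nlia.
Qed.

(** The constant 8 counts the four sides twice; a diagonal would only strengthen the bound. *)
Lemma deg_square x y z t : uniq [:: x; y; z; t] ->
  adj x y -> adj y z -> adj z t -> adj t x ->
  4 * (k - 1) + 8 < 2 * (deg x + deg y + deg z + deg t).
Proof.
move=> un xy yz zt tx.
have sV : {subset [:: x; y; z; t] <= V}.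
  by move=> a; rewrite !inE => /or4P[] /eqP->; [apply: adj_V xy|apply: adj_V yz|apply: adj_V zt|apply: adj_V tx].
have := dense_seq un sV isT; rewrite !big_cons !big_nil.
rewrite (adj_sym y x) (adj_sym z y) (adj_sym t z) (adj_sym x t) xy yz zt tx /=.
nlia.
Qed.

(** A path of length [l] has [2 * l + 1] nodes; one further hyperedge may trail without a new
    vertex. *)
Lemma long_seg x s b : seg (inl x) s b -> uniq s -> size s <= l.*2.+2.
Proof.
move=> sg un; rewrite leqNgt; apply/negP => lt.
by apply: (cr_long cr); apply: (seg_berge sg un).
Qed.

Section Tail.
Variables (L : nat) (u : nat -> T) (c : nat -> {set T}).
Hypothesis C : bcycle L u c.

Lemma cyc_V i : u i \in V.
Proof. exact: edge_V (bc_edge C i) (bc_memL C i). Qed.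

Lemma tail_seg a t w g i : seg (inl a) t (inl w) -> uniq t ->
  (forall x, inl x \in t -> x \notin cvtx L u) ->
  (forall h, inr h \in t -> (h \notin ched L c) && (h != g)) ->
  g \in E -> w \in g -> u i \in g -> size t + L.*2 <= l.*2.+2.
Proof.
move=> sg un vt ht gE wg ug; have L0 := bc_pos C.
have gt : inr g \notin t by apply/negP => /ht; rewrite eqxx andbF.
suff [j [uj gj]] : exists j, u j \in g /\ inr g \notin walk u c j L.-1.
  have sgC := cyc_walk_seg C j L.-1.
  have sg' : seg (inl a) (t ++ inr g :: walk u c j L.-1) (inl (u (j + L.-1))).
    apply: (seg_cat sg (a' := inr g)); first by rewrite /= gE.
    by apply: seg_cons sgC; rewrite /= gE.
  have := long_seg sg' _; rewrite size_cat /= size_walk.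
  suff -> : uniq (t ++ inr g :: walk u c j L.-1) by move=> /(_ isT); nlia.
  rewrite cat_uniq un /= gj (cyc_walk_uniq C) ?andbT; last nlia.
  rewrite negb_or gt /=; apply/hasPn => -[x|h] xw; apply/negP => xt.
    have /walk_vtx[j' _ e] := xw.
    by have := vt _ xt; rewrite e (cvtx_u C).
  have /walk_hed[j' _ e] := xw.
  by have := ht _ xt; rewrite e (ched_c C).
case gC: (g \in ched L c); last first.
  exists i; split=> //; apply/walk_hed => -[j _ e].
  by move: gC; rewrite e (ched_c C).
have /(chedP C)[j e] := gC.
exists j.+1; split; first by rewrite e (bc_memR C).
apply/walk_hed => -[j' jj]; rewrite e => /(cyc_cwin C (a := j)).
by rewrite !inE => /(_ ltac:(nlia) ltac:(nlia)); nlia.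
Qed.

Lemma tail0 w g i : w \notin cvtx L u -> g \in E -> w \in g -> u i \in g -> L <= l.
Proof.
move=> wC gE wg ug.
have := @tail_seg w [:: inl w] w g i (seg1 _) isT _ _ gE wg ug; rewrite /= => H.
suff : 1 + L.*2 <= l.*2.+2 by nlia.
by apply: H => [x|h]; rewrite inE // => /eqP[->].
Qed.

(** A cycle hyperedge already contains two cycle vertices, so it has room for at most one outside
    vertex. *)
Lemma off_edge h y z : 1 < L -> y \notin cvtx L u -> z \notin cvtx L u -> y != z ->
  h \in E -> y \in h -> z \in h -> h \notin ched L c.
Proof.
move=> L1 yC zC yz hE yh zh; apply/negP => /(chedP C)[i e].
apply: (@uniform_no4 uni h y z (u i) (u i.+1)) => //;
  rewrite ?e ?(bc_memL C) ?(bc_memR C) //.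
rewrite /= !inE !negb_or yz -[i.+1]addn1 (cyc_une C) ?L1 //= andbT.
by rewrite !(off_ne C).
Qed.

Lemma tail1 y h z g i : 1 < L ->
  y \notin cvtx L u -> z \notin cvtx L u -> y != z ->
  h \in E -> y \in h -> z \in h -> g \in E -> z \in g -> u i \in g -> g != h ->
  L < l.
Proof.
move=> L1 yC zC yz hE yh zh gE zg ug gh.
have sg : seg (inl y) [:: inl y; inr h; inl z] (inl z).
  by rewrite /= hE yh zh !eqxx.
have hC := off_edge L1 yC zC yz hE yh zh.
have := @tail_seg y _ z g i sg _ _ _ gE zg ug => /= H.
suff : 3 + L.*2 <= l.*2.+2 by nlia.
apply: H => [|x|f].
- by rewrite !inE /= !andbT.
- by rewrite !inE => /or3P[/eqP[->]||/eqP[->]].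
- by rewrite !inE => /or3P[|/eqP[->]|] //; rewrite hC eq_sym.
Qed.

Lemma tail2 x h1 y h2 z g i : 1 < L ->
  x \notin cvtx L u -> y \notin cvtx L u -> z \notin cvtx L u -> uniq [:: x; y; z] ->
  h1 \in E -> x \in h1 -> y \in h1 -> h2 \in E -> y \in h2 -> z \in h2 ->
  g \in E -> z \in g -> u i \in g -> uniq [:: h1; h2; g] ->
  L.+1 < l.
Proof.
move=> L1 xC yC zC; rewrite /= !inE !negb_or => /and3P[/andP[xy xz] yz _].
move=> h1E xh1 yh1 h2E yh2 zh2 gE zg ug /and3P[/andP[h12 h1g] h2g _].
have sg : seg (inl x) [:: inl x; inr h1; inl y; inr h2; inl z] (inl z).
  by rewrite /= h1E xh1 yh1 h2E yh2 zh2 !eqxx.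
have h1C := off_edge L1 xC yC xy h1E xh1 yh1.
have h2C := off_edge L1 yC zC yz h2E yh2 zh2.
have := @tail_seg x _ z g i sg _ _ _ gE zg ug => /= H.
suff : 5 + L.*2 <= l.*2.+2 by nlia.
apply: H => [|t|f].
- rewrite !inE !negb_or /= !andbT; apply/and3P; split=> //; exact/andP.
- by rewrite !inE => /or4P[/eqP[->]||/eqP[->]|/orP[|/eqP[->]]].
- by rewrite !inE => /or4P[|/eqP[->]||/orP[/eqP[->]|]] //; rewrite ?h1C ?h2C.
Qed.

(** The cycle minus one hyperedge is a path, so [L <= l + 1 <= k < #|V|]; some vertex is therefore
    outside, and connectivity attaches one to the cycle. *)
Lemma cyc_le : L <= l.
Proof.
have L0 := bc_pos C.
have Ll : L <= l.+1.
  have := long_seg (cyc_walk_seg C 0 L.-1) _; rewrite size_walk.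
  by rewrite (cyc_walk_uniq C) => [/(_ isT)|]; nlia.
have kV := cr_card cr.
have sub : cvtx L u \subset V by apply/subsetP => x /(cvtxP C)[i ->]; apply: cyc_V.
have n0 : cvtx L u != set0 by apply/set0Pn; exists (u 0); apply: (cvtx_u C).
have nV : cvtx L u != V by apply/eqP => e; move: kV; rewrite -e (card_cvtx C); nlia.
have [x [y [/(cvtxP C)[i ->]]]] := cr_conn cr sub n0 nV.
rewrite inE => /andP[yC yV] /adjP[_ [h [hE uh yh]]].
exact: tail0 yC hE yh uh.
Qed.

Lemma cyc_ge3 : 1 < L -> 2 < L.
Proof.
move=> L1; rewrite ltn_neqAle L1 andbT eq_sym; apply/eqP => e.
have ne : u 0 != u 1 by apply: (@cyc_une _ _ _ C 0 1).
have := @linear_eq lin (c 0) (c 1) (u 0) (u 1) (bc_edge C _) (bc_edge C _) ne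
  (bc_memL C 0) (bc_memR C 0) _ (bc_memL C 1).
have := bc_memR C 1; rewrite -[X in u X]add0n -e (bc_uper C) => -> /(_ isT) /eqP.
by rewrite (negbTE (@cyc_cne _ _ _ C 0 1 _)).
Qed.

End Tail.
End Critical.
End Hypergraph.
(** * Neighbours of a vertex outside a cycle *)

Section Around.
Variables (T : finType) (E : {set {set T}}) (k l : nat) (V : {set T}).
Hypothesis cr : critical E k l V.
Variables (L : nat) (u : nat -> T) (c : nat -> {set T}).
Hypotheses (C : bcycle E L u c) (L1 : 1 < L).

Let uni := cr_uni cr.
Let lin := cr_lin cr.
Let prv i := i + L.-1.

(** Adjacency through a hyperedge other than [h]. In use, [h] is either the hyperedge joining two
    outside vertices or [set0], which is not in [E] and excludes nothing. *)
Definition nbr (h : {set T}) (y x : T) : bool :=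
  (x != y) && [exists g in E, [&& g != h, y \in g & x \in g]].
Definition offn (h : {set T}) (y : T) (i : nat) : bool :=
  [exists g in E, [&& g != h, g \notin ched L c, y \in g & u i \in g]].

Lemma offnP h y i : reflect (exists g, [/\ g \in E, g != h, g \notin ched L c,
  y \in g & u i \in g]) (offn h y i).
Proof.
apply: (iffP existsP) => -[g].
  by case/and5P=> *; exists g.
by case=> *; exists g; apply/and5P.
Qed.

Lemma nbrP h y x : reflect (x != y /\ exists g, [/\ g \in E, g != h, y \in g & x \in g])
  (nbr h y x).
Proof.
apply: (iffP andP) => [[xy /existsP[g /and4P[*]]]|[xy [g [*]]]]; split=> //.
  by exists g.
by apply/existsP; exists g; apply/and4P.
Qed.

Lemma prvS i : u (prv i).+1 = u i.
Proof. by rewrite -(bc_uper C i); congr u; rewrite /prv; nlia. Qed.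

Lemma mem_prv i : u i \in c (prv i).
Proof. by rewrite -{1}prvS; apply: bc_memR C _. Qed.

Lemma c_of_u i j : u i = u j -> c i = c j.
Proof. by move/(cyc_ueq C) => e; rewrite -(cyc_cmod C i) e (cyc_cmod C). Qed.

Lemma c_prv_of_u i j : u i = u j.+1 -> c (prv i) = c j.
Proof.
move/(cyc_ueq C) => e; rewrite -(cyc_cmod C) /prv -modnDml e modnDml.
have -> : j.+1 + L.-1 = j + L by nlia.
by rewrite modnDr (cyc_cmod C).
Qed.

Lemma u_neS i : u i != u i.+1.
Proof. by rewrite -addn1; apply: (cyc_une C i). Qed.

Lemma c_neS i : c i != c i.+1.
Proof. by rewrite -addn1; apply: (cyc_cne C i). Qed.

Lemma offn_per h y i : offn h y (i + L) = offn h y i.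
Proof. by rewrite /offn (bc_uper C). Qed.

Lemma off_on h y i j : y \notin cvtx L u -> offn h y i -> u i \in c j -> y \notin c j.
Proof.
move=> yC /offnP[g [gE _ gC yg ug]] uc; apply: contra gC => yc.
rewrite (@linear_eq _ _ lin g (c j) y (u i)) //; first exact: (ched_c C).
  exact: bc_edge C _.
exact: (off_ne C).
Qed.

Lemma off_onL h y i : y \notin cvtx L u -> offn h y i -> y \notin c i.
Proof. by move=> yC o; apply: off_on o _ => //; apply: bc_memL C i. Qed.

Lemma off_onR h y i : y \notin cvtx L u -> offn h y i.+1 -> y \notin c i.
Proof. by move=> yC o; apply: off_on o _ => //; apply: bc_memR C i. Qed.

Lemma on_onS y i : y \notin cvtx L u -> y \in c i -> y \notin c i.+1.
Proof.
move=> yC yc; apply: contraNN (c_neS i) => yc'; apply/eqP.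
apply: (@linear_eq _ _ lin _ _ y (u i.+1)) => //;
  rewrite ?(bc_edge C) ?(bc_memL C) ?(bc_memR C) //.
exact: (off_ne C).
Qed.

Lemma on_own y z i : y \notin cvtx L u -> z \notin cvtx L u ->
  y \in c i -> z \in c i -> y = z.
Proof.
move=> yC zC yc zc; apply/eqP; apply: contraT => yz.
have := off_edge cr C L1 yC zC yz (bc_edge C i) yc zc.
by rewrite (ched_c C).
Qed.

(** A cycle hyperedge through [y] consists of [y] and two consecutive cycle vertices, so [u i.+1]
    can be reached only off the cycle, through [c i.+1], or through [c i]. Linearity makes the three
    ways exclusive, so the right-hand side is a sum. *)
Lemma nbr_split h y i : y \notin cvtx L u -> h \notin ched L c ->
  nbr h y (u i.+1) = offn h y i.+1 + (y \in c i.+1) + (y \in c i) :> nat.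
Proof.
move=> yC hC; have unY : u i.+1 != y by rewrite eq_sym (off_ne C).
have ch j : c j != h by apply: contraNneq hC => <-; apply: (ched_c C).
case o: (offn h y i.+1).
  rewrite (negbTE (off_onL yC o)) (negbTE (off_onR yC o)).
  case/offnP: o => g [gE gh gC yg ug].
  by have -> : nbr h y (u i.+1) by apply/nbrP; split=> //; exists g.
case on: (y \in c i).
  rewrite (negbTE (on_onS yC on)).
  have -> // : nbr h y (u i.+1); apply/nbrP; split=> //; exists (c i).
  by split=> //; [apply: bc_edge C i|apply: bc_memR C i].
case on': (y \in c i.+1).
  have -> // : nbr h y (u i.+1); apply/nbrP; split=> //; exists (c i.+1).
  by split=> //; [apply: bc_edge C _|apply: bc_memL C _].
have -> // : nbr h y (u i.+1) = false.
apply/nbrP => -[_ [g [gE gh yg ug]]].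
case gC: (g \in ched L c).
  case/(chedP C): gC => j e; rewrite e in yg ug.
  have ej := bc_edge C j.
  have := @uniform_mem3 _ _ uni (c j) (u j) (u j.+1) y (u i.+1) ej.
  rewrite /= !inE negb_or u_neS !(eq_sym _ y) !(off_ne C) // => /(_ isT).
  rewrite (bc_memL C) (bc_memR C) yg ug => /(_ isT isT isT isT) /or3P[] /eqP ee.
  - by move: on'; rewrite (c_of_u ee) yg.
  - have := c_prv_of_u ee; have := c_prv_of_u (erefl (u i.+1)) => -> e1.
    by move: on; rewrite e1 yg.
  - by move: unY; rewrite ee eqxx.
suff : offn h y i.+1 by rewrite o.
by apply/offnP; exists g; split=> //; apply: negbT.
Qed.

Lemma sum_nbr h y : y \notin cvtx L u -> h \notin ched L c ->
  \sum_(i < L) nbr h y (u i) = \sum_(i < L) offn h y i + 2 * \sum_(i < L) (y \in c i).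
Proof.
move=> yC hC.
have per (F : nat -> nat) : (forall i, F (i + L) = F i) ->
    \sum_(i < L) F i.+1 = \sum_(i < L) F i by move=> p; apply: sum_shift; rewrite -[L in F L]add0n p.
rewrite -(per (fun i => nbr h y (u i) : nat)); last by move=> i; rewrite (bc_uper C).
under eq_bigr do rewrite nbr_split //.
rewrite !big_split /= (per (fun i => offn h y i : nat)); last by move=> i; rewrite offn_per.
rewrite (per (fun i => (y \in c i) : nat)); last by move=> i; rewrite (bc_cper C).
by rewrite mul2n -addnn addnA.
Qed.

Lemma deg_split h y : y \notin cvtx L u -> (h \in E) || (h == set0) ->
  (forall g, g \in E -> g != h -> y \in g -> g :\ y \subset cvtx L u) ->
  deg E y = \sum_(i < L) nbr h y (u i) + (y \in h) * #|h|.-1.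
Proof.
move=> yC hE att; rewrite /deg -(sum_cvtx C (fun x => nbr h y x : nat)).
have -> : (y \in h) * #|h|.-1 = \sum_x [&& y \in h, x \in h & x != y].
  case yh: (y \in h); last by rewrite big1.
  rewrite (cardsD1 y h) yh mul1n /= -sum1_card big_mkcond /=.
  by apply: eq_bigr => x _; rewrite !inE andbC; case: (_ && _).
rewrite [X in X + _](big_mkcond) -big_split /=; apply: eq_bigr => x _.
have -> : (if x \in cvtx L u then nbr h y x : nat else 0) = nbr h y x.
  case: ifP => // xC; case n: (nbr h y x) => //.
  case/nbrP: n => xy [g [gE gh yg xg]].
  have /subsetP/(_ x) := att g gE gh yg.
  by rewrite !inE xy xg xC => /(_ isT).
case n: (nbr h y x).
  case/nbrP: n => xy [g [gE gh yg xg]].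
  rewrite (adj_edge gE yg xg); last by rewrite eq_sym.
  have -> // : [&& y \in h, x \in h & x != y] = false.
  apply/and3P => -[yh xh _]; move: gh; case/orP: hE => [hE|/eqP e]; last by move: yh; rewrite e inE.
  by rewrite (@linear_eq _ _ lin g h x y) ?eqxx.
rewrite add0n; congr nat_of_bool; apply/adjP/and3P => [[yx [g [gE yg xg]]]|[yh xh xy]].
  have [<-|gh] := eqVneq g h; first by split=> //; rewrite eq_sym.
  by move/negP: n; case; apply/nbrP; rewrite eq_sym; split=> //; exists g.
case/orP: hE => [hE|/eqP e]; last by move: yh; rewrite e inE.
by rewrite eq_sym; split=> //; exists h.
Qed.

(** Otherwise [y] could be inserted between [u i] and [u i.+1]; the two hyperedges differ, since a
    common one would be [c i] by linearity. *)
Lemma off_offS h y i : ~ has_bcycle E L.+1 -> y \notin cvtx L u ->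
  offn h y i -> offn h y i.+1 -> False.
Proof.
move=> nc yC /offnP[g [gE _ gC yg ug]] /offnP[g' [g'E _ g'C yg' ug']].
have gg' : g != g'.
  apply/eqP => e; move: gC; rewrite (@linear_eq _ _ lin g (c i) (u i) (u i.+1)) //;
    rewrite ?(ched_c C) ?(bc_edge C) ?(bc_memL C) ?(bc_memR C) ?e ?u_neS //.
apply: nc; have -> : L.+1 = (L - 1).+2 by nlia.
apply: (cyc_insert1 C (i := i) (n := 1) _ yC gE g'E gg') => //; try exact: (free_off C).
- by nlia.
- by rewrite addn1.
Qed.

(* The cycle cut at [c i] and [c j] and reconnected by the chord [f]: it is closed
   by a vertex lying in both of [c i] and [c j], and extended by two vertices lying
   one in each. *)
Lemma chord_seg i j w f : i < j < i + L -> w \notin cvtx L u -> w \in c i ->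
  f \in E -> f \notin ched L c -> u i \in f -> u j \in f ->
  exists s, [/\ seg E (inl w) s (inr (c j)), uniq s, size s = L.+1.*2,
    forall z, inl z \in s -> z = w \/ z \in cvtx L u & u j \in c j].
Proof.
move=> ij wC wc fE fC uif ujf.
pose W1 := walk u c i.+1 (j - i.+1); pose W2 := walk u c j.+1 (i + L - j.+1).
have s1 : seg E (inl (u i.+1)) W1 (inl (u j)).
  have := cyc_walk_seg C i.+1 (j - i.+1).
  by have -> : i.+1 + (j - i.+1) = j by nlia.
have s2 : seg E (inl (u j.+1)) W2 (inl (u i)).
  have := cyc_walk_seg C j.+1 (i + L - j.+1).
  have -> : j.+1 + (i + L - j.+1) = i + L by nlia.
  by rewrite (bc_uper C).
have WE : walk u c i.+1 L.-1 = W1 ++ inr (c j) :: W2.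
  have -> : L.-1 = ((j - i.+1) + (i + L - j.+1)).+1 by nlia.
  by rewrite walk_cat; have -> : i.+1 + (j - i.+1) = j by nlia.
pose s := inl w :: inr (c i) :: W1 ++ inr f :: rev W2 ++ [:: inr (c j)].
exists s; split; last exact: bc_memL C j.
- apply: (@seg_cons _ _ _ (inr (c i))); first by rewrite /= (bc_edge C) wc.
  apply: (@seg_cons _ _ _ (inl (u i.+1))); first by rewrite /= (bc_edge C) (bc_memR C).
  apply: (seg_cat s1 (a' := inr f)); first by rewrite /= fE ujf.
  apply: (@seg_cons _ _ _ (inl (u i))); first by rewrite /= fE uif.
  apply: (seg_cat (seg_rev s2)); last exact: seg1.
  by rewrite /= (bc_edge C) (bc_memR C).
- have pe : perm_eq s (inl w :: inr f :: inr (c i) :: walk u c i.+1 L.-1).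
    by rewrite WE; apply/permP => a; rewrite /s /= !count_cat /= !count_cat count_rev /=; nlia.
  rewrite (perm_uniq pe) /= (cyc_walk_uniq C) ?andbT; last by nlia.
  rewrite !inE !negb_or /= (off_mem C) //=; apply/andP; split.
    apply/andP; split; first by apply: contraNneq fC => -[->]; apply: (ched_c C).
    by apply/walk_hed => -[m _ e]; move: fC; rewrite e (ched_c C).
  apply/walk_hed => -[m jm /(cyc_cwin C (a := i))].
  by rewrite !inE => /(_ ltac:(nlia) ltac:(nlia)); nlia.
- by rewrite /s /= size_cat /= size_cat size_rev !size_walk /=; nlia.
move=> z; rewrite /s !inE /= mem_cat inE /= mem_cat mem_rev inE /= orbF.
case/or3P => [/eqP[->]|/walk_vtx[m _ ->]|/walk_vtx[m _ ->]]; [by left|right|right]; exact: (cvtx_u C).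
Qed.

(** The rerouted segment of [chord_seg] runs through all cycle vertices and [w]; since [w] lies on
    [c j] too, it closes up to a cycle of length [L + 1]. *)
Lemma same_owner i j w f : ~ has_bcycle E L.+1 -> i < j < i + L ->
  w \notin cvtx L u -> w \in c i -> w \in c j ->
  f \in E -> f \notin ched L c -> u i \in f -> u j \in f -> False.
Proof.
move=> nc ij wC wi wj fE fC fi fj.
have [s [sg us sz _ _]] := chord_seg ij wC wi fE fC fi fj.
by apply: nc; apply: (seg_has_bcycle sg _ us sz) => //; rewrite /= (bc_edge C) wj.
Qed.

(** Here the segment of [chord_seg] does not close, but it extends to [w'] and becomes a path on
    [L + 2] vertices. *)
Lemma diff_owner i j w w' f : i < j < i + L ->
  w \notin cvtx L u -> w' \notin cvtx L u -> w != w' -> w \in c i -> w' \in c j ->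
  f \in E -> f \notin ched L c -> u i \in f -> u j \in f -> L < l.
Proof.
move=> ij wC w'C ww' wi wj fE fC fi fj.
have [s [sg us sz vs _]] := chord_seg ij wC wi fE fC fi fj.
have sg' : seg E (inl w) (s ++ [:: inl w']) (inl w').
  by apply: (seg_cat sg _ (seg1 _ _)); rewrite /= (bc_edge C) wj.
have := long_seg cr sg' _; rewrite size_cat sz /=.
suff -> : uniq (s ++ [:: inl w']) by move=> /(_ isT); nlia.
rewrite cat_uniq us /= orbF andbT; apply/negP => /vs[e|].
  by move: ww'; rewrite e eqxx.
by rewrite (negbTE w'C).
Qed.

End Around.
Lemma sum_bool_le1 (I : finType) (A b : pred I) :
  (forall i j, A i -> A j -> b i -> b j -> i = j) -> \sum_(i | A i) b i <= 1.
Proof.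
move=> H; have -> : \sum_(i | A i) b i = #|[pred i | A i && b i]|.
  rewrite -sum1_card [RHS]big_mkcond [LHS]big_mkcond; apply: eq_bigr => i _.
  by rewrite !inE; case: (A i); case: (b i).
apply/card_le1_eqP => i j; rewrite !inE => /andP[Ai bi] /andP[Aj bj].
exact: H.
Qed.

(** * Counting around a cycle *)

Section Count.
Variables (T : finType) (E : {set {set T}}) (k l : nat) (V : {set T}).
Hypothesis cr : critical E k l V.

Lemma dense_V : (k - 1) * #|V| < \sum_(x in V) deg E x.
Proof.
have V0 : V != set0 by have := cr_card cr; rewrite -card_gt0; lia.
have := cr_dense cr (subxx V) V0.
suff -> : arcs E V = \sum_(x in V) deg E x by nlia.
apply: eq_bigr => x _; rewrite [LHS]big_mkcond; apply: eq_bigr => y _.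
by case: ifP => // yV; case a: (adj E x y) => //; move: a; rewrite adj_sym => /(adj_V cr); rewrite yV.
Qed.

Variables (L : nat) (u : nat -> T) (c : nat -> {set T}).
Hypotheses (C : bcycle E L u c) (L1 : 1 < L).

Let uni := cr_uni cr.
Let lin := cr_lin cr.
Let prv i := i + L.-1.
Let W := V :\: cvtx L u.
Let own i := \sum_(w in W) (w \in c i).
Let inner := \sum_(i < L) \sum_(j < L) adj E (u i) (u j).

Lemma outW w : w \in W -> w \notin cvtx L u.
Proof. by rewrite inE => /andP[]. Qed.

Lemma set0_notin : set0 \notin E.
Proof. by apply/negP => /(uniform_ge2 uni); rewrite cards0. Qed.

Lemma set0_notched : set0 \notin ched L c.
Proof. by apply: contra set0_notin => /(chedP C)[i ->]; apply: bc_edge C i. Qed.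

Lemma nbr0 y x : nbr E set0 y x = adj E y x.
Proof.
apply/nbrP/adjP => -[xy [g H]]; rewrite eq_sym; split=> //.
  by case: H => *; exists g.
case: H => gE yg xg; exists g; split=> //.
by apply: contraNneq set0_notin => <-.
Qed.

Lemma own_le1 i : own i <= 1.
Proof.
apply: sum_bool_le1 => w w' /outW wC /outW w'C; exact: (on_own cr C L1 wC w'C).
Qed.

Lemma ownP i : reflect (exists2 w, w \in W & w \in c i) (0 < own i).
Proof.
rewrite lt0n; apply: (iffP idP) => [|[w wW wc]].
  rewrite sum_nat_eq0 negb_forall => /existsP[w]; rewrite negb_imply => /andP[wW].
  by case wc: (w \in c i) => // _; exists w.
by rewrite /own (bigD1 w wW) /= wc.
Qed.

Lemma sum_own : \sum_(w in W) \sum_(i < L) (w \in c i) = \sum_(i < L) own i.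
Proof. by rewrite exchange_big. Qed.

(** With no edges between outside vertices, every remaining edge has exactly one outside end and is
    counted twice in the degree sum. *)
Lemma total_deg :
  (forall w g, w \in W -> g \in E -> w \in g -> g :\ w \subset cvtx L u) ->
  \sum_(x in V) deg E x = inner + 2 * \sum_(w in W)
    (\sum_(i < L) offn E L u c set0 w i + 2 * \sum_(i < L) (w \in c i)).
Proof.
move=> att.
have sub : cvtx L u \subset V by apply/subsetP => x /(cvtxP C)[i ->]; apply: (cyc_V cr C).
have sumV (F : T -> nat) : \sum_(x in V) F x = \sum_(i < L) F (u i) + \sum_(w in W) F w.
  rewrite (big_setID (cvtx L u)) /=; congr addn.
  by rewrite (setIidPr sub) (sum_cvtx C).
have dW w : w \in W -> deg E w = \sum_(i < L) adj E w (u i).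
  move=> wW; rewrite (deg_split cr C (h := set0) (outW wW)) ?eqxx ?orbT //.
    by rewrite inE addn0; apply: eq_bigr => i _; rewrite nbr0.
  by move=> g gE _ wg; apply: att.
have dW' w : w \in W -> deg E w =
    \sum_(i < L) offn E L u c set0 w i + 2 * \sum_(i < L) (w \in c i).
  move=> wW; rewrite (dW _ wW) -(sum_nbr cr C L1) ?set0_notched ?outW //.
  by apply: eq_bigr => i _; rewrite nbr0.
have du x : deg E x = \sum_(i < L) adj E x (u i) + \sum_(w in W) adj E x w.
  rewrite -(sumV (fun y => adj E x y : nat)) [RHS]big_mkcond; apply: eq_bigr => y _.
  by case: ifP => // yV; case a: (adj E x y) => //; move: a; rewrite adj_sym => /(adj_V cr); rewrite yV.
have e1 : \sum_(i < L) deg E (u i) = inner + \sum_(w in W) \sum_(i < L) adj E (u i) w.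
  rewrite [X in _ + X]exchange_big /inner -big_split /=; apply: eq_bigr => i _; exact: du.
rewrite sumV e1 -addnA; congr addn.
rewrite mul2n -addnn; congr addn; apply: eq_bigr => w wW; last exact: dW'.
by rewrite -dW' // dW //; apply: eq_bigr => i _; rewrite adj_sym.
Qed.

(** [X] marks pairs of indices expected to be non-adjacent. A pair that is adjacent after all must
    be explained by the hyperedge entering one of its two vertices; it is charged to that index, and
    [R] bounds the charges. *)
Lemma inner_bound (X : nat -> nat -> bool) (R : nat -> nat) :
  (forall i j, X i j = X j i) -> (forall i j, X i j -> i != j) ->
  (forall i j, i < L -> j < L -> X i j -> adj E (u i) (u j) ->
     (u j \in c (prv i)) || (u i \in c (prv j))) ->
  (forall i, i < L -> \sum_(j < L) (X i j && (u j \in c (prv i))) <= R i) ->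
  inner + \sum_(i < L) \sum_(j < L) X i j <= L * L.-1 + 2 * \sum_(i < L) R i.
Proof.
move=> Xs Xn Xp XR.
pose Y i j := X i j && (u j \in c (prv i)).
have sumne : \sum_(i < L) \sum_(j < L) (i != j) = L * L.-1.
  rewrite (eq_bigr (fun=> L.-1)) ?sum_nat_const ?card_ord // => i _.
  rewrite (bigD1 i) //= eqxx add0n (eq_bigr (fun=> 1)) => [|j]; last by rewrite eq_sym => ->.
  by rewrite sum1_card (cardC1 i) card_ord.
apply: (@leq_trans (\sum_(i < L) \sum_(j < L) ((i != j) + Y i j + Y j i))).
  rewrite -big_split /=; apply: leq_sum => i _; rewrite -big_split /=; apply: leq_sum => j _.
  have an : adj E (u i) (u j) -> i != j.
    by move=> a; apply/eqP => e; move: a; rewrite e adj_irr.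
  case x: (X i j).
    have ne := Xn _ _ x; have -> : i != j by [].
    case a: (adj E (u i) (u j)) => //; rewrite /Y (Xs j i) x /=.
    by have := Xp i j (ltn_ord i) (ltn_ord j) x a; case: (u j \in _); case: (u i \in _).
  by case a: (adj E (u i) (u j)); rewrite ?(an a).
under eq_bigr do rewrite !big_split /=.
rewrite !big_split /= sumne [X in _ + X]exchange_big /= -addnA addnn -mul2n.
by rewrite leq_add2l leq_mul2l /=; apply: leq_sum => i _; apply: XR.
Qed.

(* If [c m] joins [u i] and [u j], the third vertex of [c m] is not outside the
   cycle, so [m] is neither [i] nor [j], unless [u i] and [u j] are consecutive. *)
Lemma chord_prev i j w w' : w \in W -> w' \in W -> w \in c i -> w' \in c j ->
  adj E (u i) (u j) ->
  (forall f, f \in E -> f \notin ched L c -> u i \in f -> u j \in f -> False) ->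
  (u j \in c (prv i)) || (u i \in c (prv j)).
Proof.
move=> /outW wC /outW w'C wi wj /adjP[ij [f [fE fi fj]]] nof.
case fC: (f \in ched L c); last by case: (nof f) => //; exact: negbT.
case/(chedP C): fC => m e; rewrite {}e in fE fi fj.
have third i1 j1 x : u i1 != u j1 -> x \notin cvtx L u -> x \in c j1 ->
    u i1 \in c m -> u j1 \in c m -> u i1 != u m -> u i1 != u m.+1 -> u i1 \in c (prv j1).
  move=> ij1 xC xj i1m j1m nm nm1.
  have := @uniform_mem3 _ _ uni (c m) (u m) (u m.+1) (u i1) (u j1) fE.
  rewrite /= !inE negb_or (u_neS C L1) !(eq_sym _ (u i1)) nm nm1 => /(_ isT).
  rewrite (bc_memL C) (bc_memR C) i1m j1m => /(_ isT isT isT isT) /or3P[] /eqP ee.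
  - case: (@uniform_no4 _ _ uni (c m) x (u m) (u m.+1) (u i1) fE) => //.
    + by rewrite /= !inE !negb_or !(off_ne C _ xC) (u_neS C L1) !(eq_sym _ (u i1)) nm nm1.
    + by rewrite -(c_of_u C ee).
    + exact: bc_memL C m.
    + exact: bc_memR C m.
  - by rewrite /prv (c_prv_of_u C L1 ee).
  - by move: ij1; rewrite ee eqxx.
case i0: (u i == u m); last case i1: (u i == u m.+1).
- have [j1|j1] := eqVneq (u j) (u m.+1).
    by rewrite /prv (c_prv_of_u C L1 j1) fi orbT.
  have j0 : u j != u m by rewrite -(eqP i0) eq_sym.
  by rewrite (third j i w) // eq_sym.
- have := c_prv_of_u C L1 (eqP i1); rewrite -/(prv i) => ->.
  by rewrite fj.
- by rewrite (third i j w') ?i0 ?i1 ?orbT.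
Qed.

(** For each [i], at most one of these holds: [w] reaches [u i] off the cycle, it reaches [u i.+1]
    off the cycle, it lies on [c i]. Summing over [i] counts every off-cycle contact twice. *)
Lemma off_count_le w : ~ has_bcycle E L.+1 -> w \in W ->
  2 * \sum_(i < L) offn E L u c set0 w i + \sum_(i < L) (w \in c i) <= L.
Proof.
move=> nc /outW wC; set a := fun i => offn E L u c set0 w i : nat.
have per : \sum_(i < L) a i.+1 = \sum_(i < L) a i.
  by apply: sum_shift; rewrite /a -[L in offn _ _ _ _ _ _ L]add0n (offn_per C).
rewrite mul2n -addnn -{1}per -!big_split /= -[X in _ <= X](card_ord L) -sum1_card.
apply: leq_sum => i _; rewrite /a.
case o: (offn _ _ _ _ _ _ i.+1).
  rewrite (negbTE (off_onR cr C wC o)).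
  by case o': (offn _ _ _ _ _ _ i) => //; case: (off_offS cr C L1 nc wC o' o).
case o': (offn _ _ _ _ _ _ i); first by rewrite (negbTE (off_onL cr C wC o')).
by case: (w \in c i).
Qed.

(** Let [s] be the sum of the [b w]. Then [inner] is at most L(L-1) + 2(L-s) - |X|, the outside
    contributes at most |W|L + 3s, and |X| is at least the sum of the squares of the [b w], minus
    [s]. What exceeds L(L+1) + |W|L is 2s minus the sum of squares, hence at most |W|. *)
Lemma count_indep : ~ has_bcycle E L.+1 ->
  (forall w g, w \in W -> g \in E -> w \in g -> g :\ w \subset cvtx L u) ->
  \sum_(x in V) deg E x <= L.+1 * #|V|.
Proof.
move=> nc att; rewrite (total_deg att).
pose b w := \sum_(i < L) (w \in c i); pose a w := \sum_(i < L) offn E L u c set0 w i.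
pose s := \sum_(i < L) own i.
(* Pairs of distinct indices whose hyperedges share an outside vertex; by [same_owner] no hyperedge
   off the cycle joins their first vertices. *)
pose X i j := (i %% L != j %% L) && [exists w in W, (w \in c i) && (w \in c j)].
(* An exception at [i] needs the third vertex of the preceding hyperedge to be a cycle vertex, hence
   not an outside one. *)
pose R i := 1 - own (prv i).
have sumR : \sum_(i < L) R i + s = L.
  have ownper i : own (i + L) = own i by rewrite /own (bc_cper C).
  have -> : s = \sum_(i < L) own (prv i).
    have e n : \sum_(i < L) own (i + n) = s.
      elim: n => [|n IH]; first by apply: eq_bigr => i _; rewrite addn0.
      rewrite -IH -(@sum_shift L (fun i => own (i + n))); last by rewrite addnC ownper.
      by apply: eq_bigr => i _; rewrite addSnnS.
    by rewrite e.
  rewrite -big_split /= -[X in _ = X](card_ord L) -sum1_card; apply: eq_bigr => i _.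
  by rewrite /R; have := own_le1 (prv i); nlia.
have XE : forall i j, X i j -> exists w, [/\ w \in W, w \in c i & w \in c j].
  by move=> i j /andP[_ /existsP[w /and3P[*]]]; exists w.
have noff i j : i < L -> j < L -> X i j -> forall f, f \in E -> f \notin ched L c ->
    u i \in f -> u j \in f -> False.
  move=> iL jL x f fE fC fi fj; have [w [wW wi wj]] := XE _ _ x.
  have : i != j by case/andP: x => x _; apply: contraNneq x => ->.
  case: (ltngtP i j) => // ij _.
    by apply: (same_owner C L1 nc _ (outW wW) wi wj fE fC fi fj); nlia.
  by apply: (same_owner C L1 nc _ (outW wW) wj wi fE fC fj fi); nlia.
have ib : inner + \sum_(i < L) \sum_(j < L) X i j <= L * L.-1 + 2 * \sum_(i < L) R i.
  apply: inner_bound.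
  - move=> i j; rewrite /X eq_sym; congr andb; apply: eq_existsb => w.
    by rewrite [(w \in c i) && _]andbC.
  - by move=> i j /andP[x _]; apply: contraNneq x => ->.
  - move=> i j iL jL x aij; have [w [wW wi wj]] := XE _ _ x.
    by apply: (chord_prev wW wW wi wj aij); apply: noff.
  move=> i iL.
  have uni_ne j : X i j -> u j != u (prv i) /\ u j != u (prv i).+1.
    move=> x; have [w [wW wi wj]] := XE _ _ x; split.
      apply/eqP => e; have e' := c_of_u C e; rewrite e' in wj.
      have := on_onS cr C L1 (outW wW) wj.
      have -> : c (prv i).+1 = c i by rewrite -(bc_cper C i); congr c; rewrite /prv; nlia.
      by rewrite wi.
    rewrite (prvS C L1); apply/eqP => /(cyc_ueq C) e; by case/andP: x; rewrite e eqxx.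
  have [o|/ownP[w wW wp]] := posnP (own (prv i)).
    rewrite /R o subn0; apply: (@sum_bool_le1 _ _ (fun j : 'I_L => X i j && (u j \in c (prv i)))).
    move=> j j' _ _ /andP[xj cj] /andP[xj' cj']; apply: val_inj.
    have [n1 n2] := uni_ne _ xj; have [n1' n2'] := uni_ne _ xj'.
    have pe := bc_edge C (prv i).
    have := @uniform_mem3 _ _ uni (c (prv i)) (u (prv i)) (u (prv i).+1) (u j) (u j') pe.
    rewrite /= !inE negb_or (u_neS C L1) !(eq_sym _ (u j)) n1 n2 => /(_ isT).
    rewrite (bc_memL C) (bc_memR C) cj cj' (negbTE n1') (negbTE n2') => /(_ isT isT isT isT) /= /eqP e.
    by apply: (bc_uinj C); rewrite ?inE ?ltn_ord.
  rewrite big1 // => j _; apply/eqP; rewrite eqb0; apply/andP => -[xj cj].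
  have [n1 n2] := uni_ne _ xj.
  case: (@uniform_no4 _ _ uni (c (prv i)) w (u (prv i)) (u (prv i).+1) (u j)) => //.
  - exact: bc_edge C _.
  - by rewrite /= !inE !negb_or !(off_ne C _ (outW wW)) (u_neS C L1) !(eq_sym _ (u j)) n1 n2.
  - exact: bc_memL C _.
  - exact: bc_memR C _.
have sq : \sum_(w in W) b w * b w <= \sum_(i < L) \sum_(j < L) X i j + s.
  have -> : \sum_(w in W) b w * b w =
      \sum_(i < L) \sum_(j < L) \sum_(w in W) (w \in c i) * (w \in c j).
    under [RHS]eq_bigr do rewrite exchange_big /=.
    rewrite exchange_big /=; apply: eq_bigr => w _.
    by rewrite /b big_distrl /=; apply: eq_bigr => i _; rewrite big_distrr.
  have -> : s = \sum_(i < L) \sum_(j < L) (i == j) * own i.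
    apply: eq_bigr => i _; rewrite (bigD1 i) //= eqxx mul1n big1 ?addn0 // => j.
    by rewrite eq_sym => /negbTE->.
  rewrite -big_split /=; apply: leq_sum => i _; rewrite -big_split /=; apply: leq_sum => j _.
  have [->|ne] := eqVneq i j.
    rewrite mul1n; apply: leq_trans (leq_addl _ _); apply: leq_sum => w _.
    by case: (w \in c j).
  rewrite mul0n addn0.
  have -> : \sum_(w in W) (w \in c i) * (w \in c j) = \sum_(w in W) ((w \in c i) && (w \in c j)).
    by apply: eq_bigr => w _; rewrite mulnb.
  case x: (X i j).
    apply: (@sum_bool_le1 _ (mem W) (fun w => (w \in c i) && (w \in c j))).
    move=> w w' /outW wC /outW w'C /andP[wi _] /andP[wi' _].
    exact: (on_own cr C L1 wC w'C wi wi').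
  rewrite big1 // => w wW; apply/eqP; rewrite eqb0; apply/negP => wij; move: x.
  rewrite /X !modn_small // ne /= => /existsP[]; exists w.
  by rewrite wW.
have sE : s = \sum_(w in W) b w by rewrite /s -sum_own.
have dW : 2 * \sum_(w in W) (a w + 2 * b w) <= #|W| * L + 3 * s.
  rewrite sE -sum_nat_const !big_distrr -big_split /=; apply: leq_sum => w wW.
  by have := off_count_le nc wW; rewrite -/(a w) -/(b w); nlia.
have sb : 2 * s <= \sum_(w in W) b w * b w + #|W|.
  rewrite sE -sum1_card big_distrr -big_split /=; apply: leq_sum => w wW.
  by case: (b w) => [|[|n]] //; rewrite !mulSn !mulnS; nlia.
have cV : #|V| = L + #|W|.
  have sub : cvtx L u \subset V by apply/subsetP => x /(cvtxP C)[i ->]; apply: (cyc_V cr C).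
  by rewrite -(cardsID (cvtx L u) V) (setIidPr sub) (card_cvtx C).
rewrite cV; have := bc_pos C; rewrite -/a -/b.
have -> : L.+1 * (L + #|W|) = L * L.-1 + 2 * L + #|W| * L + #|W|.
  have := bc_pos C; move: #|W| => m; clear; case: L => // n _ /=; nia.
move: ib sumR sq dW sb; rewrite -/inner.
set A := \sum_(i < L) \sum_(j < L) X i j; set B := \sum_(w in W) b w * b w.
set D := 2 * \sum_(w in W) _; set F := L * L.-1; set G := #|W| * L; set RR := \sum_(i < L) R i.
lia.
Qed.

End Count.

(** * Vertices outside a cycle: attachment to it and independence *)

Section Outside.
Variables (T : finType) (E : {set {set T}}) (k l : nat) (V : {set T}).
Hypothesis cr : critical E k l V.

Let uni := cr_uni cr.
Let lin := cr_lin cr.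

Lemma deg_one_edge z h : h \in E -> z \in h ->
  (forall g, g \in E -> z \in g -> g = h) -> deg E z <= 2.
Proof.
move=> hE zh only; have := uniform_le3 uni hE; rewrite (cardsD1 z) zh add1n ltnS.
apply: leq_trans; rewrite -sum1_card [X in _ <= X]big_mkcond; apply: leq_sum => x _.
case a: (adj E z x) => //; case/adjP: a => zx [g [gE zg xg]].
by rewrite !inE eq_sym zx -(only g gE zg) xg.
Qed.

Lemma other_edge z h : h \in E -> z \in h -> 2 < deg E z ->
  exists g, [/\ g \in E, z \in g & g != h].
Proof.
move=> hE zh d3; case e: [exists g in E, (z \in g) && (g != h)].
  by case/existsP: e => g /and3P[*]; exists g.
have := @deg_one_edge z h hE zh; rewrite leqNgt d3 => H.
suff : false by []; apply: H => g gE zg; apply/eqP; apply: contraFT e => gh.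
by apply/existsP; exists g; rewrite gE zg gh.
Qed.

Variables (L : nat) (u : nat -> T) (c : nat -> {set T}).
Hypotheses (C : bcycle E L u c) (L1 : 1 < L).

Let W := V :\: cvtx L u.

Lemma edge_other g z : g \in E -> z \in g -> exists2 t, t \in g & t != z.
Proof.
move=> gE zg; have := uniform_ge2 uni gE; rewrite (cardsD1 z) zg add1n ltnS card_gt0.
by case/set0Pn=> t; rewrite !inE => /andP[tz tg]; exists t.
Qed.

(** Otherwise connectivity yields [s] at distance two from the cycle, behind a vertex [t]. As [s]
    has degree at least 3, it lies on a second hyperedge, and a further vertex [s'] on it makes a
    tail of three vertices, too long for [l <= L + 1]. *)
Lemma attached w : l <= L.+1 -> w \in W -> exists i g, [/\ g \in E, w \in g & u i \in g].
Proof.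
move=> lL wW; pose S := [set x in V | (x \in cvtx L u) || [exists i : 'I_L, adj E x (u i)]].
have adjC x i : adj E x (u i) -> x \in S.
  move=> a; rewrite inE (adj_V cr a); apply/orP; right; apply/existsP.
  have li : i %% L < L by rewrite ltn_mod (bc_pos C).
  by exists (Ordinal li); rewrite /= (cyc_umod C).
have [SV|SV] := eqVneq S V.
  move: (wW); rewrite inE => /andP[wC]; rewrite -SV inE (negbTE wC) /= => /andP[_ /existsP[i]].
  by case/adjP=> _ [g [*]]; exists i, g.
have sub : S \subset V by apply/subsetP => x; rewrite inE => /andP[].
have S0 : S != set0.
  by apply/set0Pn; exists (u 0); rewrite inE (cyc_V cr C) (cvtx_u C).
have [t [s [tS]]] := cr_conn cr sub S0 SV.
rewrite inE => /andP[sS sV] /adjP[ts [g1 [g1E tg1 sg1]]].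
have noC g j : g \in E -> s \in g -> u j \in g -> False.
  move=> gE sg ug; have [e|ne] := eqVneq s (u j).
    by move: sS; rewrite inE sV e (cvtx_u C).
  by move/negP: sS; apply; apply: (@adjC s j); apply: adj_edge gE sg ug ne.
have tC : t \notin cvtx L u.
  by apply/negP => /(cvtxP C)[j e]; apply: (noC g1 j); rewrite // -e.
have sC : s \notin cvtx L u.
  by apply: contra sS => sC; rewrite inE sV sC.
move: (tS); rewrite inE (negbTE tC) /= => /andP[_ /existsP[i /adjP[_ [g [gE tg ug]]]]].
have gg1 : g != g1 by apply/eqP => e; apply: (noC g1 i) => //; rewrite -e.
have Ll : L < l.
  apply: (tail1 cr C (y := s) (h := g1) (z := t) (g := g) (i := i) L1) => //.
  by rewrite eq_sym.
have L3 := cyc_ge3 cr C L1.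
have d3 : 2 < deg E s by have := deg_low cr sV; have := cr_lk cr; nlia.
have [g2 [g2E sg2 g21]] := other_edge g1E sg1 d3.
have [s' s'g ss'] := edge_other g2E sg2.
have s't : s' != t.
  by apply: contraNneq g21 => e; apply/eqP; apply: (linear_eq lin g2E g1E ss') => //; rewrite e.
have s'C : s' \notin cvtx L u by apply/negP => /(cvtxP C)[j e]; apply: (noC g2 j); rewrite // -e.
suff : L.+1 < l by rewrite ltnNge lL.
apply: (tail2 cr C (x := s') (h1 := g2) (y := s) (h2 := g1) (z := t) (g := g) (i := i) L1) => //.
  by rewrite /= !inE negb_or ss' s't eq_sym ts.
rewrite /= !inE negb_or g21 [g1 == g]eq_sym gg1 !andbT /=.
by apply/eqP => e; apply: (noC g2 i); rewrite // e.
Qed.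

(** If two outside vertices share a hyperedge, a second hyperedge at either would give a tail of two
    vertices. So each has degree at most 2, while adjacent degrees sum to more than [k >= 4]. *)
Lemma indep_longest : L = l -> forall w g, w \in W -> g \in E -> w \in g ->
  g :\ w \subset cvtx L u.
Proof.
move=> Ll.
have only y z h g2 : y \notin cvtx L u -> z \in W -> y != z -> h \in E -> y \in h -> z \in h ->
    g2 \in E -> z \in g2 -> g2 = h.
  move=> yC zW yz hE yh zh g2E zg2; apply/eqP; apply: contraT => g2h.
  have zC : z \notin cvtx L u by move: zW; rewrite inE => /andP[].
  suff : L < l by rewrite Ll ltnn.
  have [i [f [fE zf uf]]] := attached ltac:(by rewrite Ll) zW.
  have [e|fh] := eqVneq f h; last exact: (tail1 cr C L1 yC zC yz hE yh zh fE zf uf fh).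
  have [t tg2 tz] := edge_other g2E zg2.
  have [tC|tC] := boolP (t \in cvtx L u).
    case/(cvtxP C): tC => j e'; rewrite e' in tg2.
    exact: (tail1 cr C L1 yC zC yz hE yh zh g2E zg2 tg2 g2h).
  rewrite e in fE zf uf.
  by apply: (tail1 cr C L1 tC zC tz g2E tg2 zg2 fE zf uf); rewrite eq_sym.
move=> w g wW gE wg; apply/subsetP => x; rewrite !inE => /andP[xw xg].
apply: contraT => xC.
have xW : x \in W by rewrite inE xC (edge_V cr gE xg).
have wC : w \notin cvtx L u by move: wW; rewrite inE => /andP[].
have d1 : deg E w <= 2 by apply: (deg_one_edge gE wg) => f fE wf; apply: (only x w).
have d2 : deg E x <= 2.
  by apply: (deg_one_edge gE xg) => f fE xf; apply: (only w x); rewrite // eq_sym.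
by have := deg_edge cr (adj_edge gE wg xg ltac:(by rewrite eq_sym)); have := cr_k4 cr; nlia.
Qed.

(** Opening the cycle at [c i] leaves a path from [u i.+1] to [u i], which is prolonged at both
    ends, by [w'] and by [w]. The freed [c i] itself may serve as [g] or [g']. *)
Lemma ends_path i w w' g g' : w \notin cvtx L u -> w' \notin cvtx L u -> w != w' ->
  g \in E -> g' \in E -> g != g' -> free L c i 1 g -> free L c i 1 g' ->
  u i \in g -> w \in g -> u i.+1 \in g' -> w' \in g' -> L < l.
Proof.
move=> wC w'C ww' gE g'E gg' fg fg' ug wg ug' wg'.
have sg : seg E (inl (u i.+1)) (walk u c i.+1 L.-1) (inl (u i)).
  have := cyc_walk_seg C i.+1 L.-1; have -> : i.+1 + L.-1 = i + L by nlia.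
  by rewrite (bc_uper C).
have sg1 : seg E (inl w') ([:: inl w'; inr g'] ++ walk u c i.+1 L.-1 ++ [:: inr g; inl w]) (inl w).
  apply: (@seg_cons _ _ _ (inr g')); first by rewrite /= g'E wg'.
  apply: (@seg_cons _ _ _ (inl (u i.+1))); first by rewrite /= g'E ug'.
  apply: (seg_cat sg (a' := inr g)); first by rewrite /= gE ug.
  by apply: (@seg_cons _ _ _ (inl w)) (seg1 _ _); rewrite /= gE wg.
suff U : uniq ([:: inl w'; inr g'] ++ walk u c i.+1 L.-1 ++ [:: inr g; inl w]).
  by have := long_seg cr sg1 U; rewrite /= size_cat size_walk /=; nlia.
have pe : perm_eq ([:: inl w'; inr g'] ++ walk u c i.+1 L.-1 ++ [:: inr g; inl w])
    ([:: inl w'; inl w; inr g'; inr g] ++ walk u c i.+1 L.-1).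
  by apply/permP => a; rewrite /= !count_cat /=; nlia.
rewrite (perm_uniq pe) cat_uniq (cyc_walk_uniq C) ?andbT; last by nlia.
have nw f : free L c i 1 f -> inr f \notin walk u c i.+1 L.-1.
  move=> ff; have := free_mem u (ltnW L1) ff; rewrite addn1.
  by have -> : L - 1 = L.-1 by nlia.
apply/andP; split.
  rewrite /= !inE /= !andbT !orbF; apply/andP; split; rewrite eq_sym; [exact: ww'|exact: gg'].
apply/hasPn => x xw; rewrite !inE; apply/negP => /or4P[] /eqP e; rewrite e in xw.
- by move: xw; rewrite (negbTE (off_mem C _ _ w'C)).
- by move: xw; rewrite (negbTE (off_mem C _ _ wC)).
- by move: xw; rewrite (negbTE (nw _ fg')).
- by move: xw; rewrite (negbTE (nw _ fg)).
Qed.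

End Outside.

(** * Rotation of cycles and the exceptional cycle of length five *)

Section Pentagon.
Variables (T : finType) (E : {set {set T}}) (k l : nat) (V : {set T}).
Hypothesis cr : critical E k l V.

Let uni := cr_uni cr.
Let lin := cr_lin cr.

Lemma periodic_mul (A : Type) (f : nat -> A) L i q :
  (forall j, f (j + L) = f j) -> f (i + q * L) = f i.
Proof.
by move=> per; elim: q => [|q IH]; rewrite ?mul0n ?addn0 // mulSnr addnA per.
Qed.

(** A rotation by [q] is undone by the forward rotation [q * L.-1], again without subtraction. *)
Lemma shift_index L q i : 0 < L -> q + (i + q * L.-1) = i + q * L.
Proof. by case: L => // n _; rewrite mulnS /=; lia. Qed.

Lemma cvtx_shift L u c q : bcycle E L u c ->
  cvtx L (fun i => u (q + i)) =i cvtx L u.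
Proof.
move=> C x; have C' := cyc_shift C q.
apply/(cvtxP C')/(cvtxP C) => -[i ->]; first by exists (q + i).
by exists (i + q * L.-1); rewrite shift_index ?(bc_pos C) // (periodic_mul _ _ (bc_uper C)).
Qed.

Lemma ched_shift L u c q : bcycle E L u c ->
  ched L (fun i => c (q + i)) =i ched L c.
Proof.
move=> C x; have C' := cyc_shift C q.
apply/(chedP C')/(chedP C) => -[i ->]; first by exists (q + i).
by exists (i + q * L.-1); rewrite shift_index ?(bc_pos C) // (periodic_mul _ _ (bc_cper C)).
Qed.

Lemma uniq_nodes (s : seq (T + {set T})) :
  uniq (pmap (fun a => if a is inl x then Some x else None) s) ->
  uniq (pmap (fun a => if a is inr h then Some h else None) s) -> uniq s.
Proof.
elim: s => //= -[x|h] s IH /= => [/andP[xs us] uh|us /andP[hs uh]]; rewrite IH // andbT.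
  by apply: contra xs => xs; rewrite mem_pmap; apply/mapP; exists (inl x).
by apply: contra hs => hs; rewrite mem_pmap; apply/mapP; exists (inr h).
Qed.

(* The one configuration in which the count of [no_longest_cycle] is off by one. *)
Lemma pentagon_path (u : nat -> T) (c : nat -> {set T}) w w' :
  bcycle E 5 u c -> w \notin cvtx 5 u -> w' \notin cvtx 5 u -> w != w' ->
  ~~ adj E w w' ->
  offn E 5 u c set0 w 0 -> offn E 5 u c set0 w' 0 ->
  w \in c 1 -> w' \in c 2 -> w \in c 3 -> adj E (u 1) (u 4) -> 5 < l.
Proof.
move=> C wC w'C ww' nww /offnP[g [gE _ gC wg ug]] /offnP[g' [g'E _ g'C wg' ug']] w1 w2 w3.
case/adjP=> u14 [f [fE f1 f4]].
have une i j : i != j -> i < 5 -> j < 5 -> u i != u j.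
  by move=> ij i5 j5; apply: contraNneq ij => /(bc_uinj C)->.
have cne i j : i != j -> i < 5 -> j < 5 -> c i != c j.
  by move=> ij i5 j5; apply: contraNneq ij => /(bc_cinj C)->.
have gc i : g != c i by apply: contraNneq gC => ->; apply: (ched_c C).
have gc' i : g' != c i by apply: contraNneq g'C => ->; apply: (ched_c C).
have wu i : w != u i by apply: (off_ne C).
have wu' i : w' != u i by apply: (off_ne C).
have uw i : u i != w by rewrite eq_sym.
have uw' i : u i != w' by rewrite eq_sym.
have cg i : c i != g by rewrite eq_sym.
have cg' i : c i != g' by rewrite eq_sym.
have no4 h a b x y : h \in E -> uniq [:: a; b; x; y] -> a \in h -> b \in h -> x \in h -> y \in h -> False.
  exact: uniform_no4.
have cE := bc_edge C; have cL := bc_memL C; have cR := bc_memR C.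
have gg' : g' != g.
  apply: contraNneq nww => e; apply: (adj_edge gE wg _ ww'); by rewrite -e.
have u4 a b x y : a != b -> a != x -> a != y -> b != x -> b != y -> x != y ->
    uniq [:: a; b; x; y].
  by move=> *; rewrite /= !inE !negb_or; apply/and4P; split=> //; apply/and3P || apply/andP; split.
(* The chord [f] may still be [c 0] or [c 4]; the path below avoids both of these. *)
have fn1 : f != c 1.
  apply/eqP => e; rewrite e in f1 f4; apply: (no4 (c 1) w (u 1) (u 2) (u 4)) => //.
  by apply: u4; rewrite ?wu ?une.
have fn2 : f != c 2.
  apply/eqP => e; rewrite e in f1 f4; apply: (no4 (c 2) (u 1) (u 2) (u 3) (u 4)) => //.
  by apply: u4; rewrite ?wu ?une.
have fn3 : f != c 3.
  apply/eqP => e; rewrite e in f1 f4; apply: (no4 (c 3) w (u 1) (u 3) (u 4)) => //.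
  by apply: u4; rewrite ?wu ?une.
have fng : f != g.
  apply/eqP => e; rewrite e in f1 f4; apply: (no4 g w (u 0) (u 1) (u 4)) => //.
  by apply: u4; rewrite ?wu ?une.
have fng' : f != g'.
  apply/eqP => e; rewrite e in f1 f4; apply: (no4 g' w' (u 0) (u 1) (u 4)) => //.
  by apply: u4; rewrite ?wu' ?une.
(* A path through all five cycle vertices and both outside vertices, of length 6. *)
pose s : seq (T + {set T}) := [:: inl (u 2); inr (c 2); inl w'; inr g'; inl (u 0); inr g;
  inl w; inr (c 1); inl (u 1); inr f; inl (u 4); inr (c 3); inl (u 3)].
have sg : seg E (inl (u 2)) s (inl (u 3)).
  have u43 : u 4 \in c 3 := cR 3.
  by rewrite /= !eqxx !cE g'E gE fE !cL w2 wg' ug' ug wg w1 f1 f4 u43.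
have us : uniq s.
  apply: uniq_nodes; rewrite /= !inE !negb_or.
    by rewrite [w' == w]eq_sym ww' !wu !wu' !uw !uw' !une.
  by rewrite fn3 gg' [c 2 == f]eq_sym fn2 [c 1 == f]eq_sym fn1 [g == f]eq_sym fng
    [g' == f]eq_sym fng' !gc !gc' !cg !cg' !cne.
by have := long_seg cr sg us; rewrite /=; nlia.
Qed.

End Pentagon.

(** * Cycles as long as the longest path *)

Section LongestCycle.
Variables (T : finType) (E : {set {set T}}) (k l : nat) (V : {set T}).
Hypothesis cr : critical E k l V.

Let uni := cr_uni cr.
Let lin := cr_lin cr.

Variables (L : nat) (u : nat -> T) (c : nat -> {set T}).
Hypotheses (C : bcycle E L u c) (L1 : 1 < L) (Ll : L = l).

Let prv i := i + L.-1.
Let W := V :\: cvtx L u.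
Let own i := \sum_(w in W) (w \in c i).
Let inner := \sum_(i < L) \sum_(j < L) adj E (u i) (u j).
Let O i := [exists w in W, offn E L u c set0 w i].

Let noS : ~ has_bcycle E L.+1.
Proof. by case=> u' [c' C']; have := cyc_le cr C'; rewrite Ll ltnn. Qed.

Let att := indep_longest cr C L1 Ll.

Let noLl : (L < l) = false.
Proof. by rewrite Ll ltnn. Qed.

Lemma nonadjW w w' : w \in W -> w' \in W -> ~~ adj E w w'.
Proof.
move=> wW w'W; apply/negP => /adjP[ww' [g [gE wg w'g]]].
have /subsetP/(_ w') := att wW gE wg.
by rewrite !inE eq_sym ww' w'g /= => /(_ isT) w'C; move: w'W; rewrite inE w'C.
Qed.

Lemma off_edge_ne w w' (g g' : {set T}) : w \in W -> w' \in W -> w != w' ->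
  g \in E -> w \in g -> w' \in g' -> g != g'.
Proof.
move=> wW w'W ww' gE wg w'g; apply: contraNneq (nonadjW wW w'W) => e.
by apply: (adj_edge gE) ww'; rewrite // e.
Qed.

(** Two of these contacts by one vertex are excluded by insertion or by linearity; two contacts by
    different vertices prolong the opened cycle at both ends. Since [L = l], all outside vertices
    can thus be treated together. *)
Lemma off_own_le1 i : O i + O i.+1 + own i <= 1.
Proof.
have oW w : w \in W -> w \notin cvtx L u by apply: outW.
have H1 : O i -> O i.+1 -> False.
  case/existsP=> w /andP[wW ow] /existsP[w' /andP[w'W ow']].
  have [e|ww'] := eqVneq w w'.
    by rewrite -e in ow'; apply: (off_offS cr C L1 noS (oW _ wW) ow ow').
  case/offnP: ow => g [gE _ gC wg ug]; case/offnP: ow' => g' [g'E _ g'C wg' ug'].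
  suff : L < l by rewrite noLl.
  apply: (ends_path cr C L1 (oW _ wW) (oW _ w'W) ww' gE g'E _ _ _ ug wg ug' wg').
  - exact: off_edge_ne wg wg'.
  - exact: (free_off C).
  - exact: (free_off C).
have H2 : O i -> 0 < own i -> False.
  case/existsP=> w /andP[wW ow] /ownP[w' w'W wc].
  have [e|ww'] := eqVneq w w'.
    by move: (off_onL cr C (oW _ wW) ow); rewrite e wc.
  case/offnP: ow => g [gE _ gC wg ug].
  suff : L < l by rewrite noLl.
  apply: (ends_path cr C L1 (oW _ wW) (oW _ w'W) ww' gE (bc_edge C i) _ _ _ ug wg (bc_memR C i) wc).
  - exact: off_edge_ne wg wc.
  - exact: (free_off C).
  - by rewrite -{2}[i]addn0; apply: (free_on C).
have H3 : O i.+1 -> 0 < own i -> False.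
  case/existsP=> w /andP[wW ow] /ownP[w' w'W wc].
  have [e|ww'] := eqVneq w w'.
    by move: (off_onR cr C (oW _ wW) ow); rewrite e wc.
  case/offnP: ow => g [gE _ gC wg ug].
  suff : L < l by rewrite noLl.
  apply: (ends_path cr C L1 (oW _ w'W) (oW _ wW) _ (bc_edge C i) gE _ _ _ (bc_memL C i) wc ug wg).
  - by rewrite eq_sym.
  - by apply: off_edge_ne wc wg => //; [rewrite eq_sym|apply: bc_edge C i].
  - by rewrite -{2}[i]addn0; apply: (free_on C).
  - exact: (free_off C).
have o1 := own_le1 cr C L1 i; rewrite -/own in o1.
case: (O i) H1 H2 => H1 H2; first case: (O i.+1) H1 H3 => H1 H3.
- by case: (H1 isT isT).
- by case: (posnP (own i)) => [->//|p]; case: (H2 isT p).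
case: (O i.+1) H3 => H3; last by rewrite !add0n.
by case: (posnP (own i)) => [->//|p]; case: (H3 isT p).
Qed.

Let o := \sum_(i < L) O i.
Let s := \sum_(i < L) own i.

Lemma off_own_sum : 2 * o + s <= L.
Proof.
have per : \sum_(i < L) O i.+1 = o.
  apply: (@sum_shift L (fun i => O i : nat)); congr nat_of_bool.
  by apply: eq_existsb => w; rewrite -[L in offn _ _ _ _ _ _ L]add0n (offn_per C).
rewrite mul2n -addnn -{2}per -!big_split /= -[X in _ <= X](card_ord L) -sum1_card.
by apply: leq_sum => i _; apply: off_own_le1.
Qed.

Lemma off_le_o w : w \in W -> \sum_(i < L) offn E L u c set0 w i <= o.
Proof.
move=> wW; apply: leq_sum => i _; case o': (offn _ _ _ _ _ _ i) => //.
by have -> : O i by apply/existsP; exists w; rewrite wW.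
Qed.

Lemma total_le : \sum_(x in V) deg E x <= inner + 2 * (#|W| * o) + 4 * s.
Proof.
rewrite (total_deg cr C L1 att) -/inner big_split -big_distrr /= (sum_own V L u c) -/s -/own.
have H : \sum_(w in W) \sum_(i < L) offn E L u c set0 w i <= #|W| * o.
  by rewrite -sum_nat_const; apply: leq_sum => w wW; apply: off_le_o.
by rewrite -/W mulnDr mulnA -addnA leq_add2l leq_add2r leq_mul2l H orbT.
Qed.

Lemma inner_le : inner <= L * L.-1.
Proof.
apply: (leq_trans (leq_addr (\sum_(i < L) \sum_(j < L) (fun _ _ : nat => false) i j) _)).
apply: leq_trans (@inner_bound _ E L u c (fun _ _ => false) (fun=> 0) _ _ _ _) _ => //.
  by move=> i _; rewrite big1.
by rewrite big1 ?muln0 ?addn0.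
Qed.

(** As [L = l], [diff_owner] applies too, so [X] contains all pairs of distinct owned indices:
    [s * s - s] ordered pairs. Each owned index is charged at most one exception, which costs
    [2 * s]: if the preceding hyperedge is owned, the exception is the preceding vertex, and
    otherwise it is the third vertex of that hyperedge. *)
Lemma inner_sq : inner + s * s <= L * L.-1 + 3 * s.
Proof.
pose X i j := [&& i %% L != j %% L, 0 < own i & 0 < own j].
have o1 i : own i <= 1 by apply: (own_le1 cr C L1).
have noff i j : i < L -> j < L -> X i j -> forall f, f \in E -> f \notin ched L c ->
    u i \in f -> u j \in f -> False.
  move=> iL jL /and3P[ne /ownP[w wW wi] /ownP[w' w'W wj]] f fE fC fi fj.
  have : i != j by apply: contraNneq ne => ->.
  have [e|ww'] := eqVneq w w'.
    rewrite -e in wj; case: (ltngtP i j) => // ij _.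
      by apply: (same_owner C L1 noS _ (outW wW) wi wj fE fC fi fj); nlia.
    by apply: (same_owner C L1 noS _ (outW wW) wj wi fE fC fj fi); nlia.
  case: (ltngtP i j) => // ij _; suff : L < l by rewrite noLl.
    by apply: (diff_owner cr C L1 _ (outW wW) (outW w'W) ww' wi wj fE fC fi fj); nlia.
  by apply: (diff_owner cr C L1 _ (outW w'W) (outW wW) _ wj wi fE fC fj fi); rewrite 1?eq_sym //; nlia.
have ib : inner + \sum_(i < L) \sum_(j < L) X i j <= L * L.-1 + 2 * \sum_(i < L) own i.
  apply: inner_bound.
  - by move=> i j; rewrite /X eq_sym andbCA andbC -andbA andbCA; congr andb; rewrite andbC.
  - by move=> i j /andP[x _]; apply: contraNneq x => ->.
  - move=> i j iL jL x a; have /and3P[_ /ownP[w wW wi] /ownP[w' w'W wj]] := x.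
    by apply: (chord_prev cr C L1 wW w'W wi wj a); apply: noff.
  move=> i iL; rewrite -/prv.
  have [o0|op] := posnP (own i).
    by rewrite o0 big1 // => j _; rewrite /X o0 andbF.
  have -> : own i = 1 by have := o1 i; nlia.
  apply: (@sum_bool_le1 _ _ (fun j : 'I_L => X i j && (u j \in c (prv i)))).
  move=> j j' _ _ /andP[xj cj] /andP[xj' cj']; apply: val_inj.
  have pe := bc_edge C (prv i).
  have nS j1 : X i j1 -> u j1 != u (prv i).+1.
    rewrite (prvS C L1) => /and3P[ne _ _].
    by apply/eqP => /(cyc_ueq C) e; rewrite e eqxx in ne.
  apply: (bc_uinj C); rewrite ?inE ?ltn_ord //.
  have [op'|/ownP[w wW wp]] := posnP (own (prv i)).
    have np j1 : X i j1 -> u j1 != u (prv i).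
      case/and3P=> _ _ p1; apply/eqP => /(c_of_u C) e.
      by move: p1 op'; rewrite /own e => p1 op'; rewrite op' in p1.
    have := @uniform_mem3 _ _ uni (c (prv i)) (u (prv i)) (u (prv i).+1) (u j) (u j') pe.
    rewrite /= !inE negb_or (u_neS C L1) !(eq_sym _ (u j)) np // nS // => /(_ isT).
    rewrite (bc_memL C) (bc_memR C) cj cj' => /(_ isT isT isT isT).
    by rewrite (negbTE (np _ xj')) (negbTE (nS _ xj')) /= => /eqP.
  have isP j1 : X i j1 -> u j1 \in c (prv i) -> u j1 = u (prv i).
    move=> xj1 cj1.
    have := @uniform_mem3 _ _ uni (c (prv i)) (u (prv i)) (u (prv i).+1) w (u j1) pe.
    rewrite /= !inE negb_or (u_neS C L1) !(eq_sym _ w) !(off_ne C _ (outW wW)) => /(_ isT).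
    rewrite (bc_memL C) (bc_memR C) wp cj1 (negbTE (nS _ xj1)) => /(_ isT isT isT isT) /=.
    by rewrite (negbTE (off_ne C _ (outW wW))) orbF => /eqP.
  by rewrite (isP j) // (isP j').
suff <- : \sum_(i < L) \sum_(j < L) X i j + s = s * s by rewrite -/s in ib; nlia.
have -> : s * s = \sum_(i < L) \sum_(j < L) own i * own j.
  by rewrite /s big_distrl /=; apply: eq_bigr => i _; rewrite big_distrr.
have -> : s = \sum_(i < L) \sum_(j < L) (i == j) * own i.
  apply: eq_bigr => i _; rewrite (bigD1 i) //= eqxx mul1n big1 ?addn0 // => j.
  by rewrite eq_sym => /negbTE->.
rewrite -big_split /=; apply: eq_bigr => i _; rewrite -big_split /=; apply: eq_bigr => j _.
rewrite /X !modn_small //; have := o1 i; have := o1 j.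
have [->|ne] := eqVneq i j; first by rewrite !eqxx /=; case: (own j) => [|[|]].
have -> : (i : nat) != j by [].
by rewrite /=; case: (own i) => [|[|]] //; case: (own j) => [|[|]].
Qed.

Lemma own_le_half w : w \in W -> 2 * \sum_(i < L) (w \in c i) <= L.
Proof.
move=> wW; have per : \sum_(i < L) (w \in c i.+1) = \sum_(i < L) (w \in c i).
  by apply: (@sum_shift L (fun i => (w \in c i) : nat)); rewrite -[L in c L]add0n (bc_cper C).
rewrite mul2n -addnn -{2}per -!big_split /= -[X in _ <= X](card_ord L) -sum1_card.
apply: leq_sum => i _; case e: (w \in c i); last by case: (w \in _).
by rewrite (negbTE (on_onS cr C L1 (outW wW) e)).
Qed.

(** 35 is [L * #|V|] for this cycle with two outside vertices. *)
Lemma pentagon_bound : L = 5 -> #|W| = 2 -> s = 3 -> o = 1 ->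
  \sum_(x in V) deg E x <= 35.
Proof.
move=> L5 W2 s3 o1; rewrite leqNgt; apply/negP => big.
have tot := total_deg cr C L1 att; rewrite -/inner big_split -big_distrr /= (sum_own V L u c) in tot.
have L20 : L * L.-1 = 20 by rewrite L5.
have inn := inner_le; rewrite L20 in inn.
pose a w := \sum_(i < L) offn E L u c set0 w i.
have /eqP/cards2P[x [y [xy We]]] := W2.
have xW : x \in W by rewrite We !inE eqxx.
have yW : y \in W by rewrite We !inE eqxx orbT.
have sa : \sum_(w in W) a w = a x + a y by rewrite We big_setU1 ?inE //= big_set1.
have ax : a x <= 1 by rewrite -o1; apply: off_le_o.
have ay : a y <= 1 by rewrite -o1; apply: off_le_o.
have tE : \sum_(z in V) deg E z = inner + 2 * (a x + a y + 2 * 3).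
  by rewrite tot -sa -s3.
(* The available maximum is 20 + 2 * (1 + 1 + 6) = 36, so exceeding 35 forces equality in all three
   bounds. *)
have [ax1 ay1 in20] : [/\ a x = 1, a y = 1 & inner = 20].
  by rewrite tE in big; clear -big inn ax ay; split; lia.
have [q qo] : exists q : nat, forall j : 'I_L, (j : nat) != q -> O j = false.
  have /eqP/sum_nat_eq1[q [_ _ qo]] := o1; exists q => j jq.
  by have := qo j jq isT; case: (O j).
have offq w : w \in W -> a w = 1 -> offn E L u c set0 w q.
  move=> wW /eqP/sum_nat_eq1[i [_ oi _]].
  have ow : offn E L u c set0 w i by case: (offn _ _ _ _ _ _ i) oi.
  have [<-//|ne] := eqVneq (i : nat) q.
  have := qo i ne; have -> // : O i by apply/existsP; exists w; rewrite wW.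
have ox := offq x xW ax1; have oy := offq y yW ay1.
have Oq : O q by apply/existsP; exists x; rewrite xW.
have own0 : own q = 0.
  by have := off_own_le1 q; rewrite Oq; move: (own q) => n; clear; lia.
have own4 : own (q + 4) = 0.
  have := off_own_le1 (q + 4); have -> : O (q + 4).+1.
    apply/existsP; exists x; rewrite xW /=.
    have -> : (q + 4).+1 = q + L by rewrite L5; nlia.
    by rewrite (offn_per C).
  by move: (own (q + 4)) => n; clear; lia.
have o1' i : own i <= 1 by apply: (own_le1 cr C L1).
have sq : \sum_(i < 5) own (q + i) = 3.
  have e n : \sum_(i < L) own (n + i) = s.
    elim: n => [|n IH]; first by [].
    rewrite -IH -(@sum_shift L (fun i => own (n + i))); last by rewrite addn0 /own (bc_cper C).
    by apply: eq_bigr => i _; rewrite addSnnS.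
  have H n : n = L -> \sum_(i < n) own (q + i) = s by move=> ->; apply: e.
  by rewrite (H 5 (esym L5)) s3.
move: sq; rewrite !big_ord_recr big_ord0 /= addn0 own0 own4 !add0n addn0 => sq.
(* Both outside vertices touch [u q], so the two cycle hyperedges at [u q] are unowned and the other
   three are owned. Consecutive owners differ, so two outside vertices must alternate. *)
have [/ownP[w1 w1W c1] /ownP[w2 w2W c2] /ownP[w3 w3W c3]] :
    [/\ 0 < own (q + 1), 0 < own (q + 2) & 0 < own (q + 3)].
  move: (o1' (q + 1)) (o1' (q + 2)) (o1' (q + 3)) sq.
  move: (own (q + 1)) (own (q + 2)) (own (q + 3)) => n1 n2 n3; clear.
  by move=> *; split; lia.
have n12 : w1 != w2.
  apply/eqP => e; have := on_onS cr C L1 (outW w1W) c1; rewrite e -addnS c2 //.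
have n32 : w3 != w2.
  apply/eqP => e; have := on_onS cr C L1 (outW w2W) c2; rewrite -e -addnS c3 //.
have offs w : w \in W -> offn E L u c set0 w q.
  by rewrite We !inE => /orP[] /eqP->.
have e13 : w1 = w3.
  move: w1W w2W w3W n12 n32; rewrite -/W We !inE.
  by do 3![case/orP=> /eqP->]; rewrite ?eqxx.
rewrite -e13 in c3.
have adj14 : adj E (u (q + 1)) (u (q + 4)).
  apply: contraT => na.
  (* A single missing pair would already lower [inner] by 2, below its forced value 20. *)
  pose X i j := ((i == (q + 1) %% L) && (j == (q + 4) %% L)) ||
                ((i == (q + 4) %% L) && (j == (q + 1) %% L)).
  have ne : (q + 1) %% L != (q + 4) %% L.
    have : u (q + 1) != u (q + 4).
      have -> : q + 4 = q + 1 + 3 by rewrite -addnA.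
      by apply: (cyc_une C); rewrite L5.
    by apply: contraNneq => e; rewrite -(cyc_umod C (q + 1)) e (cyc_umod C).
  have Xna i j : X i j -> ~~ adj E (u i) (u j).
    by case/orP=> /andP[/eqP-> /eqP->]; rewrite !(cyc_umod C) // adj_sym.
  have : inner + \sum_(i < L) \sum_(j < L) X i j <= L * L.-1 + 2 * \sum_(i < L) 0.
    apply: (@inner_bound _ E L u c X (fun=> 0)).
    - by move=> i j; rewrite /X orbC ![(j == _) && _]andbC.
    - by move=> i j; case/orP=> /andP[/eqP-> /eqP->] //; rewrite eq_sym.
    - by move=> i j _ _ /Xna/negbTE->.
    move=> i iL; rewrite big1 // => j _; apply/eqP; rewrite eqb0; apply/andP => -[xij uj].
    move/negP: (Xna _ _ xij); apply; apply: (adj_edge (bc_edge C (i + L.-1))) uj _.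
      exact: (mem_prv C L1).
    apply/eqP => /(cyc_ueq C) e; case/orP: xij => /andP[/eqP ei /eqP ej]; move: ne.
      by rewrite -(modn_mod (q + 1)) -(modn_mod (q + 4)) -ei -ej e eqxx.
    by rewrite -(modn_mod (q + 1)) -(modn_mod (q + 4)) -ei -ej e eqxx.
  have lt n : n %% L < L by rewrite ltn_mod (bc_pos C).
  have -> : \sum_(i < L) 0 = 0 by rewrite big1.
  rewrite muln0 addn0 in20 (bigD1 (Ordinal (lt (q + 1)))) //=.
  rewrite (bigD1 (Ordinal (lt (q + 4)))) //= /X !eqxx /= L20.
  by clear; lia.
have C5 := cyc_shift C q; rewrite L5 in C5.
suff : 5 < l by rewrite -Ll L5.
have wc w : w \in W -> w \notin cvtx 5 (fun i => u (q + i)).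
  by move=> wW; have := cvtx_shift q C w; rewrite L5 => ->; have := outW wW; rewrite L5.
have off0 w : w \in W -> offn E 5 (fun i => u (q + i)) (fun i => c (q + i)) set0 w 0.
  move=> wW; have /offnP[g [gE g0 gC wg ug]] := offs w wW.
  apply/offnP; exists g; split; rewrite ?addn0 //.
  by have := ched_shift q C g; rewrite L5 => ->; rewrite -L5.
by apply: (pentagon_path cr C5 (wc _ w1W) (wc _ w2W) n12 (nonadjW w1W w2W) (off0 _ w1W) (off0 _ w2W)).
Qed.

Lemma no_longest_cycle : False.
Proof.
have d := dense_V cr.
have lk := cr_lk cr; have k4 := cr_k4 cr; have kV := cr_card cr.
have cV : #|V| = L + #|W|.
  have sub : cvtx L u \subset V by apply/subsetP => x /(cvtxP C)[i ->]; apply: (cyc_V cr C).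
  by rewrite -(cardsID (cvtx L u) V) (setIidPr sub) (card_cvtx C).
have [lt|ge] := ltnP L (k - 1).
  have := count_indep cr C L1 noS att.
  have : L.+1 * #|V| <= (k - 1) * #|V| by rewrite leq_mul2r lt orbT.
  by move=> h1 h2; have := leq_trans d (leq_trans h2 h1); rewrite ltnn.
have Lk : L = k - 1 by rewrite Ll; clear -ge lk Ll; lia.
have oS := off_own_sum; have tl := total_le; have il := inner_le; have iq := inner_sq.
have L3 : 2 < L by apply: (cyc_ge3 cr C).
have m2 : 2 <= #|W| by clear -cV Lk kV k4; lia.
rewrite cV -Lk in d.
have ol : s <= L by clear -oS; lia.
(* For three or more outside vertices, 4s <= (|W|+1)s together with 2o + s <= L and s <= L gives the
   bound L|V|. *)
have [m3|m3] := ltnP 2 #|W|.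
  move: d tl il oS L3 m3; move: inner o s #|W| (\sum_(x in V) deg E x).
  clear; move=> inner o s m D d tl il oS L3 m3.
  have h : 2 * (m * o) + m * s <= m * L by nia.
  have h3 : 3 * s <= m * s by nia.
  have e : L * L.-1 + L = L * L by case: (L) L3 => // n _; rewrite /= mulnS addnC.
  nia.
have W2 : #|W| = 2 by clear -m2 m3; lia.
(* Here [inner_sq] is the better bound; it remains to see 5s - s^2 <= L, which holds since 4 <= s <=
   L. *)
have [s4|s4] := ltnP 3 s.
  rewrite W2 in d tl.
  move: d tl iq oS L3 s4 ol; move: inner o s (\sum_(x in V) deg E x).
  clear; move=> inner o s D d tl iq oS L3 s4 ol.
  have e : L * L.-1 + L = L * L by case: (L) L3 => // n _; rewrite /= mulnS addnC.
  nia.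
(* For [s <= 3] the requirement is 4(o+s) <= 3L. Given 2o + s <= L and L >= 3, it fails only for L =
   5, s = 3, o = 1 and for L = s = 3. *)
have [/andP[/eqP L5 /andP[/eqP s3 /eqP o1]]|ns] := boolP [&& L == 5, s == 3 & o == 1].
  have := pentagon_bound L5 W2 s3 o1; rewrite leqNgt.
  by move: d; rewrite W2 {1 2}L5 /= => ->.
have s2 : L = 3 -> s <= 2.
  move=> e3; rewrite /s -(sum_own V L u c) -[X in _ <= X]muln1 -[X in _ <= X * _]W2 -sum_nat_const.
  apply: leq_sum => w wW; have := own_le_half wW; rewrite [X in _ <= X]e3.
  by move: (\sum_(i < L) _) => n; clear; lia.
rewrite W2 in d tl.
move: d tl il oS L3 s4 ns s2; move: inner o s (\sum_(x in V) deg E x).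
clear; move=> inner o s D d tl il oS L3 s4 ns s2.
have e : L * L.-1 + L = L * L by case: (L) L3 => // n _; rewrite /= mulnS addnC.
nia.
Qed.

End LongestCycle.
(** * Cycles one shorter than the longest path *)

Lemma sum_max_eq n (F : nat -> nat) m : (forall i, i < n -> F i <= m) ->
  \sum_(i < n) F i = n * m -> forall i, i < n -> F i = m.
Proof.
move=> le eq i lt; apply/eqP; rewrite eqn_leq le //= leqNgt; apply/negP => Fi.
have : \sum_(j < n) F j < \sum_(j < n) m.
  rewrite (bigD1 (Ordinal lt)) //= [X in _ < X](bigD1 (Ordinal lt)) //=.
  by apply: (leq_add Fi); apply: leq_sum => j _; apply: le.
by rewrite eq sum_nat_const card_ord ltnn.
Qed.

Lemma change_point (b : nat -> bool) a d i j : a <= i <= d -> a <= j <= d -> b i != b j ->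
  exists2 t, a <= t < d & b t != b t.+1.
Proof.
wlog ij : i j / i <= j => [W|] ai aj bij.
  case: (leqP i j) => le; first exact: (W i j).
  by apply: (W j i) => //; [lia|rewrite eq_sym].
elim: j ij aj bij => [|j IH] ij aj bij.
  have i0 : i = 0 by lia.
  by rewrite i0 eqxx in bij.
have ne : i != j.+1 by apply: contraNneq bij => ->.
have [e|nb] := eqVneq (b j) (b j.+1); last by exists j => //; lia.
by apply: IH; rewrite ?e //; lia.
Qed.

Section SecondCycle.
Variables (T : finType) (E : {set {set T}}) (k l : nat) (V : {set T}).
Hypothesis cr : critical E k l V.
Variable L : nat.
Hypotheses (L1 : 1 < L) (Ll : L.+1 = l).

Let uni := cr_uni cr.
Let lin := cr_lin cr.

Lemma no_cycle1 : ~ has_bcycle E L.+1.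
Proof. by case=> u [c C]; apply: (no_longest_cycle cr C (ltnW L1) Ll). Qed.

Lemma no_cycle2 : ~ has_bcycle E L.+2.
Proof. by case=> u [c C]; have := cyc_le cr C; rewrite -Ll ltnn. Qed.

Section OneCycle.
Variables (u : nat -> T) (c : nat -> {set T}).
Hypothesis C : bcycle E L u c.

Let L3 : 2 < L := cyc_ge3 cr C L1.
Notation out y := (y \notin cvtx L u).

Lemma deg_ge3 y : y \in V -> 2 < deg E y.
Proof. by move=> yV; have := deg_low cr yV; have := cr_lk cr; nlia. Qed.

Lemma noLl : (L.+1 < l) = false.
Proof. by rewrite Ll ltnn. Qed.

(* Tails of two hyperedges outside the cycle would give a path of length [l + 1]. *)
Lemma linked_att h y z : out y -> out z -> y != z -> h \in E -> y \in h -> z \in h ->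
  forall g, g \in E -> g != h -> y \in g -> g :\ y \subset cvtx L u.
Proof.
move=> yC zC yz hE yh zh g gE gh yg; apply/subsetP => y'; rewrite !inE => /andP[y'y y'g].
apply: contraT => y'C.
have zg f : f \in E -> y \in f -> z \in f -> f = h by move=> *; apply: (linear_eq lin _ hE yz).
have zng : z \notin g by apply: contra gh => zg'; apply/eqP; apply: zg.
have y'z : y' != z by apply: contraNneq zng => <-.
have zV := edge_V cr hE zh; have y'V := edge_V cr gE y'g.
have lL : l <= L.+1 by rewrite Ll.
have zW : z \in V :\: cvtx L u by rewrite inE zC.
have y'W : y' \in V :\: cvtx L u by rewrite inE y'C.
have [g2 [g2E zg2 g2h]] := other_edge cr hE zh (deg_ge3 zV).
have gg2 : g != g2 by apply: contraNneq zng => ->.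
have g2C i : u i \in g2 -> False.
  move=> ug; suff : L.+1 < l by rewrite noLl.
  apply: (tail2 cr C L1 y'C yC zC _ gE y'g yg hE yh zh g2E zg2 ug).
    by rewrite /= !inE negb_or y'y y'z yz.
  by rewrite /= !inE negb_or gh gg2 eq_sym g2h.
have [j [f [fE yf uf]]] := attached cr C L1 lL y'W.
have fg : f = g.
  apply/eqP; apply: contraT => fg; suff : L.+1 < l by rewrite noLl.
  apply: (tail2 cr C L1 zC yC y'C _ hE zh yh gE yg y'g fE yf uf).
    by rewrite /= !inE negb_or ![_ == y']eq_sym y'y y'z [z == y]eq_sym yz.
  rewrite /= !inE negb_or [h == g]eq_sym gh [g == f]eq_sym fg !andbT /=.
  apply: contraNneq zng => hf; rewrite -hf in yf.
  by rewrite (linear_eq lin gE hE y'y).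
have [t tg2 tz] := edge_other cr g2E zg2.
have tC : out t by apply/negP => /(cvtxP C)[i e]; apply: (g2C i); rewrite -e.
have ty : t != y.
  by apply: contraNneq g2h => e; apply/eqP; apply: zg => //; rewrite -e.
suff : L.+1 < l by rewrite noLl.
rewrite fg in fE uf.
apply: (tail2 cr C L1 tC zC yC _ g2E tg2 zg2 hE zh yh gE yg uf).
  by rewrite /= !inE negb_or tz ty eq_sym yz.
by rewrite /= !inE negb_or g2h [g2 == g]eq_sym gg2 eq_sym gh.
Qed.

(** * Two adjacent vertices outside a cycle of length l - 1 *)

Section Link.
Variable h : {set T}.
Hypothesis hE : h \in E.
Notation off := (offn E L u c h).

Definition linked y z := [/\ out y, out z, y != z, y \in h & z \in h].

Lemma linked_sym y z : linked y z -> linked z y.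
Proof. by case=> *; split; rewrite // eq_sym. Qed.

Lemma link_off y z : linked y z -> h \notin ched L c.
Proof. by case=> yC zC yz yh zh; apply: (off_edge cr C L1 yC zC yz hE yh zh). Qed.

Lemma link_insert y z g g' i n : linked y z -> 0 < n <= 2 ->
  g \in E -> g' \in E -> g != h -> g' != h -> free L c i n g -> free L c i n g' ->
  u i \in g -> y \in g -> z \in g' -> u (i + n) \in g' -> False.
Proof.
move=> lk n2 gE g'E gh g'h fg fg' ug yg zg' ug'.
have hC := link_off lk; case: lk => yC zC yz yh zh.
have gg' : g != g'.
  by apply: contraNneq gh => e; apply/eqP; apply: (linear_eq lin gE hE yz); rewrite // e.
have [||u' [c' [C' _ _]]] := cyc_insert2 C (i := i) (n := n) _ yC zC yz gE hE g'E _ fg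
  (free_off C hC) fg' ug yg yh zh zg' ug'.
- by clear -n2 L3; lia.
- by rewrite /= !inE negb_or gh gg' eq_sym g'h.
have hb : has_bcycle E (L - n + 3) by exists u', c'.
have [n1|n1] : n = 1 \/ n = 2 by clear -n2; lia.
  by apply: no_cycle2; have -> : L.+2 = L - n + 3 by clear -n1 L3; lia.
by apply: no_cycle1; have -> : L.+1 = L - n + 3 by clear -n1 L3; lia.
Qed.

Lemma c_ne_h y z i : linked y z -> c i != h.
Proof. by move/link_off; apply: contraNneq => <-; apply: (ched_c C). Qed.

Section Rules.
Variables y z : T.
Hypothesis lk : linked y z.

Let onfree i m n : m < n -> free L c i n (c (i + m)) := @free_on _ _ _ _ _ C i n m.

(** This and the following rules collect the pairs of contacts near one index that exclude each
    other. Up to [rule_on] each conflict is an instance of [link_insert]; the others come from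
    inserting a single vertex, from unique ownership and from linearity. *)
Lemma rule_off1 i : off y i -> off z i.+1 -> False.
Proof.
case/offnP=> g [gE gh gC yg ug] /offnP[g' [g'E g'h g'C zg' ug']].
by apply: (@link_insert y z g g' i 1 lk); rewrite ?addn1 //; apply: (free_off C).
Qed.

Lemma rule_off2 i : off y i -> off z i.+2 -> False.
Proof.
case/offnP=> g [gE gh gC yg ug] /offnP[g' [g'E g'h g'C zg' ug']].
by apply: (@link_insert y z g g' i 2 lk); rewrite ?addn2 //; apply: (free_off C).
Qed.

Lemma rule_off_onL i : off y i -> z \in c i -> False.
Proof.
case/offnP=> g [gE gh gC yg ug] zc.
apply: (@link_insert y z g (c i) i 1 lk) => //; rewrite ?addn1 ?(bc_edge C) ?(bc_memR C) ?(c_ne_h _ lk) //.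
  exact: (free_off C).
by have := @onfree i 0 1 isT; rewrite addn0.
Qed.

Lemma rule_off_onR i : off z i.+1 -> y \in c i -> False.
Proof.
case/offnP=> g [gE gh gC zg ug] yc.
apply: (@link_insert y z (c i) g i 1 lk) => //; rewrite ?addn1 ?(bc_edge C) ?(bc_memL C) ?(c_ne_h _ lk) //.
  by have := @onfree i 0 1 isT; rewrite addn0.
exact: (free_off C).
Qed.

Lemma rule_off_onL2 i : off y i -> z \in c i.+1 -> False.
Proof.
case/offnP=> g [gE gh gC yg ug] zc.
apply: (@link_insert y z g (c i.+1) i 2 lk) => //; rewrite ?addn2 ?(bc_edge C) ?(bc_memR C) ?(c_ne_h _ lk) //.
  exact: (free_off C).
by have := @onfree i 1 2 isT; rewrite addn1.
Qed.

Lemma rule_off_onR2 i : off z i.+2 -> y \in c i -> False.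
Proof.
case/offnP=> g [gE gh gC zg ug] yc.
apply: (@link_insert y z (c i) g i 2 lk) => //; rewrite ?addn2 ?(bc_edge C) ?(bc_memL C) ?(c_ne_h _ lk) //.
  by have := @onfree i 0 2 isT; rewrite addn0.
exact: (free_off C).
Qed.

Lemma rule_on i : y \in c i -> z \in c i.+1 -> False.
Proof.
move=> yc zc.
apply: (@link_insert y z (c i) (c i.+1) i 2 lk) => //; rewrite ?addn2 ?(bc_edge C) ?(bc_memL C) ?(bc_memR C) ?(c_ne_h _ lk) //.
  by have := @onfree i 0 2 isT; rewrite addn0.
by have := @onfree i 1 2 isT; rewrite addn1.
Qed.

Lemma rule_same i : off y i -> off y i.+1 -> False.
Proof. by case: lk => yC _ _ _ _ o o'; apply: (off_offS cr C L1 no_cycle1 yC o o'). Qed.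

Lemma rule_own i : y \in c i -> z \in c i -> False.
Proof. by case: lk => yC zC /eqP yz _ _ yc zc; apply: yz; apply: (on_own cr C L1 yC zC yc zc). Qed.

Lemma rule_linL i : off y i -> y \in c i -> False.
Proof. by case: lk => yC _ _ _ _ o; apply/negP; apply: (off_onL cr C yC o). Qed.

Lemma rule_linR i : off y i.+1 -> y \in c i -> False.
Proof. by case: lk => yC _ _ _ _ o; apply/negP; apply: (off_onR cr C yC o). Qed.

Lemma rule_lin i : y \in c i -> y \in c i.+1 -> False.
Proof. by case: lk => yC _ _ _ _ o; apply/negP; apply: (on_onS cr C L1 yC o). Qed.

End Rules.

Section Pair.
Variables y z : T.
Hypothesis lk : linked y z.

Let hC := link_off lk.
Let yC : out y. Proof. by case: lk. Qed.
Let zC : out z. Proof. by case: lk. Qed.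

Definition pairn i := nbr E h y (u i.+1) + nbr E h z (u i.+1).

Lemma pairnE i : pairn i = (off y i.+1 + (y \in c i.+1) + (y \in c i)) +
  (off z i.+1 + (z \in c i.+1) + (z \in c i)).
Proof. by rewrite /pairn !(nbr_split cr C L1). Qed.

Lemma pairn_per i : pairn (i + L) = pairn i.
Proof. by rewrite /pairn -addSn (bc_uper C). Qed.

Lemma not2 (a b : bool) : (a -> b -> False) -> ~~ (a && b).
Proof. by move=> H; apply/andP => -[]. Qed.

(** Ten contacts can contribute: [y] or [z] reaching [u i.+1] or [u i.+2] off the cycle, or lying on
    one of [c i], [c i.+1], [c i.+2]. The rules, put as forbidden conjunctions, leave no assignment
    exceeding 2, as an exhaustive check shows. *)
Lemma pairn_two i : pairn i + pairn i.+1 <= 2.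
Proof.
have lk' := linked_sym lk; rewrite !pairnE.
move: (not2 (@rule_same _ _ lk i.+1)) (not2 (@rule_same _ _ lk' i.+1)).
move: (not2 (@rule_off1 _ _ lk i.+1)) (not2 (@rule_off1 _ _ lk' i.+1)).
move: (not2 (@rule_off_onL _ _ lk i.+1)) (not2 (@rule_off_onL _ _ lk' i.+1)).
move: (not2 (@rule_off_onR _ _ lk i)) (not2 (@rule_off_onR _ _ lk' i)).
move: (not2 (@rule_off_onR _ _ lk i.+1)) (not2 (@rule_off_onR _ _ lk' i.+1)).
move: (not2 (@rule_off_onL _ _ lk i.+2)) (not2 (@rule_off_onL _ _ lk' i.+2)).
move: (not2 (@rule_off_onL2 _ _ lk i.+1)) (not2 (@rule_off_onL2 _ _ lk' i.+1)).
move: (not2 (@rule_off_onR2 _ _ lk i)) (not2 (@rule_off_onR2 _ _ lk' i)).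
move: (not2 (@rule_on _ _ lk i)) (not2 (@rule_on _ _ lk' i)).
move: (not2 (@rule_on _ _ lk i.+1)) (not2 (@rule_on _ _ lk' i.+1)).
move: (not2 (@rule_own _ _ lk i)) (not2 (@rule_own _ _ lk i.+1)) (not2 (@rule_own _ _ lk i.+2)).
move: (not2 (@rule_linL _ _ lk i.+1)) (not2 (@rule_linL _ _ lk' i.+1)).
move: (not2 (@rule_linL _ _ lk i.+2)) (not2 (@rule_linL _ _ lk' i.+2)).
move: (not2 (@rule_linR _ _ lk i)) (not2 (@rule_linR _ _ lk' i)).
move: (not2 (@rule_linR _ _ lk i.+1)) (not2 (@rule_linR _ _ lk' i.+1)).
move: (not2 (@rule_lin _ _ lk i)) (not2 (@rule_lin _ _ lk' i)).
move: (not2 (@rule_lin _ _ lk i.+1)) (not2 (@rule_lin _ _ lk' i.+1)).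
move: (off y i.+1) (off y i.+2) (off z i.+1) (off z i.+2).
move: (y \in c i) (y \in c i.+1) (y \in c i.+2) (z \in c i) (z \in c i.+1) (z \in c i.+2).
by do 4![case] => //=; do 6![case].
Qed.

Lemma pairn2 i : pairn i = 2 -> off y i.+1 /\ off z i.+1.
Proof.
have lk' := linked_sym lk; rewrite pairnE.
move: (not2 (@rule_off_onL _ _ lk i.+1)) (not2 (@rule_off_onL _ _ lk' i.+1)).
move: (not2 (@rule_off_onR _ _ lk i)) (not2 (@rule_off_onR _ _ lk' i)).
move: (not2 (@rule_on _ _ lk i)) (not2 (@rule_on _ _ lk' i)).
move: (not2 (@rule_own _ _ lk i)) (not2 (@rule_own _ _ lk i.+1)).
move: (not2 (@rule_linL _ _ lk i.+1)) (not2 (@rule_linL _ _ lk' i.+1)).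
move: (not2 (@rule_linR _ _ lk i)) (not2 (@rule_linR _ _ lk' i)).
move: (not2 (@rule_lin _ _ lk i)) (not2 (@rule_lin _ _ lk' i)).
move: (y \in c i) (y \in c i.+1) (z \in c i) (z \in c i.+1).
by do 4![case] => //=; case: (off y i.+1); case: (off z i.+1).
Qed.

Lemma sum_pairn : \sum_(i < L) pairn i =
  \sum_(i < L) nbr E h y (u i) + \sum_(i < L) nbr E h z (u i).
Proof.
rewrite big_split /=; congr addn.
  by rewrite (@sum_shift L (fun i => nbr E h y (u i))) // -[L in u L]add0n (bc_uper C).
by rewrite (@sum_shift L (fun i => nbr E h z (u i))) // -[L in u L]add0n (bc_uper C).
Qed.

Lemma sum_pairn_window a : \sum_(t < L) (pairn (a + t) + pairn (a + t).+1) =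
  2 * \sum_(i < L) pairn i.
Proof.
have e n : \sum_(t < L) pairn (n + t) = \sum_(i < L) pairn i.
  elim: n => [|n IH] //.
  rewrite -IH -(@sum_shift L (fun i => pairn (n + i))); last by rewrite addn0 pairn_per.
  by apply: eq_bigr => i _; rewrite addSnnS.
rewrite big_split /= mul2n -addnn; congr addn; first exact: e.
by rewrite -[RHS](e a.+1); apply: eq_bigr => i _.
Qed.

Lemma sum_pairn_le : \sum_(i < L) pairn i <= L.
Proof.
have : 2 * \sum_(i < L) pairn i <= 2 * L.
  rewrite -(sum_pairn_window 0) mulnC -[X in _ <= X * _](card_ord L) -sum_nat_const.
  by apply: leq_sum => i _; apply: pairn_two.
by rewrite leq_mul2l.
Qed.

(** Equality makes every two consecutive values sum to 2. The alternation 2, 0, 2 is impossible,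
    since a value 2 means off-cycle contacts of both vertices, and [rule_off2] forbids these at
    distance two. *)
Lemma sum_pairn_full : \sum_(i < L) pairn i = L -> forall i, pairn i = 1.
Proof.
move=> full.
have two i : pairn i + pairn i.+1 = 2.
  have := sum_pairn_window i; rewrite full.
  have p := bc_pos C; rewrite -(prednK p) big_ord_recl /= addn0.
  have : \sum_(t < L.-1) (pairn (i + bump 0 t) + pairn (i + bump 0 t).+1) <= L.-1 * 2.
    rewrite -[X in _ <= X * _](card_ord L.-1) -sum_nat_const.
    by apply: leq_sum => t _; apply: pairn_two.
  by have := pairn_two i; move: (\sum_(t < L.-1) _) => S; clear -p; lia.
have n2 i : pairn i != 2.
  apply/eqP => e2; have [oy _] := pairn2 e2.
  have e2' : pairn i.+2 = 2 by have := two i; have := two i.+1; rewrite e2; clear; lia.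
  have [_ oz] := pairn2 e2'; exact: (rule_off2 lk oy oz).
by move=> i; have := two i; have := n2 i; have := n2 i.+1; clear; lia.
Qed.

(** The situation when the third vertex of [h] is the cycle vertex [u p.+2]. The two windows
    containing the gap each lose one; if nothing else is lost, all other values are 1. *)
Lemma sum_pairn_gap p : pairn p.+1 = 0 -> pairn p <= 1 -> pairn p.+2 <= 1 ->
  \sum_(i < L) pairn i < L /\
  (\sum_(i < L) pairn i = L.-1 -> forall t, 2 <= t <= L -> pairn (p + t) = 1).
Proof.
move=> g0 g1 g2; have := sum_pairn_window p.
set S := \sum_(i < L) pairn i => sw.
(* The added term restores the loss of the two windows at the gap, so that every [F t] has the
   common bound 2. *)
pose F t := pairn (p + t) + pairn (p + t).+1 + (t < 2).
have F2 t : F t <= 2.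
  rewrite /F; case: t => [|[|t]]; rewrite ?addn0 ?addn1 ?g0 //=; try by clear -g1 g2; lia.
  exact: pairn_two.
have s2 : \sum_(t < L) (t < 2) = 2.
  have -> : L = (L - 2).+2 by clear -L3; lia.
  by rewrite !big_ord_recl /= big1.
have sF : \sum_(t < L) F t = 2 * S + 2 by rewrite big_split /= sw s2.
have le : \sum_(t < L) F t <= L * 2.
  by rewrite -[X in _ <= X * _](card_ord L) -sum_nat_const; apply: leq_sum => t _.
split; first by rewrite sF in le; clear -le; lia.
move=> e; have eq : \sum_(t < L) F t = L * 2 by rewrite sF e; clear -L3; lia.
have FE := sum_max_eq (fun i _ => F2 i) eq.
elim=> [|t IH] // tL; case: t IH tL => [|[|t]] // IH tL.
  have := FE 1 ltac:(clear -L3; lia); rewrite /F addn1 addn2 g0 /=; clear; lia.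
have := FE t.+2 ltac:(clear -tL; lia); rewrite /F -addnS IH /=; last by clear -tL; lia.
by clear; lia.
Qed.

Lemma nbrE i : nbr E h y (u i.+1) = [|| off y i.+1, y \in c i.+1 | y \in c i].
Proof.
have := nbr_split cr C L1 i yC hC.
by case: (nbr _ _ _ _); case: (off y i.+1); case: (y \in c i.+1); case: (y \in c i).
Qed.

(** With [u p.+1] on [h], the hyperedge [h] itself could serve to insert [y] next to [u p.+1]. *)
Lemma third_off p : u p.+1 \in h -> ~~ off y p /\ ~~ off y p.+2.
Proof.
move=> uh; split; apply/offnP => -[g [gE gh gC yg ug]]; apply: no_cycle1;
  have -> : L.+1 = (L - 1).+2 by clear -L3; lia.
- apply: (@cyc_insert1 _ _ _ _ _ C p 1 g y h) => //; rewrite ?addn1 //; try exact: (free_off C).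
    by clear -L3; lia.
  by case: lk.
- apply: (@cyc_insert1 _ _ _ _ _ C p.+1 1 h y g) => //; rewrite ?addn1 //; try exact: (free_off C).
  + by clear -L3; lia.
  + by rewrite eq_sym.
  by case: lk.
Qed.

Lemma third_nbr x : x \in h -> nbr E h y x = false.
Proof.
move=> xh; apply/nbrP => -[xy [g [gE gh yg xg]]]; move/eqP: gh; apply.
by apply: (linear_eq lin gE hE xy) => //; case: lk.
Qed.

Lemma link_deg : deg E y = \sum_(i < L) nbr E h y (u i) + #|h|.-1.
Proof.
case: (lk) => _ _ yz yh zh.
rewrite (deg_split cr C (h := h)) ?hE // ?yh ?mul1n //.
exact: (linked_att yC zC yz hE yh zh).
Qed.

End Pair.
(** The contact of [y] with [u j.+1] can only be off the cycle or through [c j], that of [z] with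
    [u j.+2] only off the cycle or through [c j.+2]. The rules exclude every combination with an
    off-cycle contact. *)
Lemma owner_change y z j : linked y z ->
  nbr E h y (u j.+1) -> ~~ nbr E h z (u j.+1) ->
  nbr E h z (u j.+2) -> ~~ nbr E h y (u j.+2) -> (y \in c j) && (z \in c j.+2).
Proof.
move=> lk; have lk' := linked_sym lk; rewrite !(nbrE lk) !(nbrE lk').
move: (not2 (@rule_off1 _ _ lk j.+1)) (not2 (@rule_off_onL2 _ _ lk j.+1)).
move: (not2 (@rule_off_onR2 _ _ lk j)).
move: (off y j.+1) (off y j.+2) (off z j.+1) (off z j.+2).
move: (y \in c j) (y \in c j.+1) (y \in c j.+2) (z \in c j) (z \in c j.+1) (z \in c j.+2).
by do 4![case] => //=; do 6![case].
Qed.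

(** Each cycle vertex sees exactly one of [y], [z]. If [x] lay on [c m], then [u m.+1] could see
    neither. If [x] reached [u i.+1] off the cycle, [u i.+1] and [u i.+2] would both need off-cycle
    contacts of [y] or [z], which the rules forbid. *)
Lemma full_third x y z : linked x y -> linked x z -> linked y z ->
  (forall i, pairn y z i = 1) -> forall i, nbr E h x (u i.+1) = false.
Proof.
move=> lxy lxz lyz full.
have lyx := linked_sym lxy; have lzx := linked_sym lxz; have lzy := linked_sym lyz.
have fE i : [|| off y i.+1, y \in c i.+1 | y \in c i] (+)
    [|| off z i.+1, z \in c i.+1 | z \in c i].
  have := full i; rewrite /pairn (nbrE lyz) (nbrE lzy).
  by case: [|| off y _, _ | _]; case: [|| off z _, _ | _].
have non m : x \notin c m.
  apply/negP => xm; move: (fE m).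
  move: (not2 (@rule_off_onR _ _ lxy m)) (not2 (@rule_off_onR _ _ lxz m)).
  move: (not2 (@rule_on _ _ lxy m)) (not2 (@rule_on _ _ lxz m)).
  move: (not2 (@rule_own _ _ lxy m)) (not2 (@rule_own _ _ lxz m)); rewrite xm /= ?andbT.
  by do 6![move=> /negbTE->].
move=> i; rewrite (nbrE lxy) (negbTE (non i)) (negbTE (non i.+1)) !orbF.
case xo: (off x i.+1) => //; exfalso; move: (fE i) (fE i.+1).
move: (not2 (@rule_off_onL _ _ lxy i.+1)) (not2 (@rule_off_onL _ _ lxz i.+1)).
move: (not2 (@rule_off_onR _ _ lyx i)) (not2 (@rule_off_onR _ _ lzx i)).
move: (not2 (@rule_off_onL2 _ _ lxy i.+1)) (not2 (@rule_off_onL2 _ _ lxz i.+1)).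
move: (not2 (@rule_same _ _ lyz i.+1)) (not2 (@rule_same _ _ lzy i.+1)).
move: (not2 (@rule_off1 _ _ lyz i.+1)) (not2 (@rule_off1 _ _ lzy i.+1)).
move: (not2 (@rule_off_onL _ _ lyz i.+1)) (not2 (@rule_off_onL _ _ lzy i.+1)).
move: (not2 (@rule_linL _ _ lyz i.+1)) (not2 (@rule_linL _ _ lzy i.+1)); rewrite xo /=.
move: (off y i.+1) (off y i.+2) (off z i.+1) (off z i.+2).
move: (y \in c i) (y \in c i.+1) (y \in c i.+2) (z \in c i) (z \in c i.+1) (z \in c i.+2).
by do 4![case] => //=; do 6![case].
Qed.

(** If two of the vertices had [L] cycle contacts in all, the third would have degree 2. So each
    pair has at most [L - 1], the doubled degree sum is at most 3(L-1) + 12, and density at the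
    triangle with k >= L + 2 demands more than 3L + 9. *)
Lemma third_out x y z : linked x y -> linked x z -> linked y z -> False.
Proof.
move=> lxy lxz lyz.
have lyx := linked_sym lxy; have lzx := linked_sym lxz; have lzy := linked_sym lyz.
have [yC zC yz yh zh] := lyz; have [xC _ xy xh _] := lxy; have [_ _ xz _ _] := lxz.
have h3 : #|h|.-1 = 2.
  have := uniform_le3 uni hE; suff : 3 <= #|h| by clear; lia.
  have u3 : uniq [:: x; y; z] by rewrite /= !inE negb_or xy xz yz.
  have <- : #|[:: x; y; z]| = 3 by apply/card_uniqP.
  by apply: subset_leq_card; apply/subsetP => t; rewrite !inE => /or3P[] /eqP->.
pose S t := \sum_(i < L) nbr E h t (u i).
have lt a b d : linked a b -> linked a d -> linked b d -> S b + S d < L.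
  move=> lab lad lbd; have := sum_pairn_le lbd; rewrite leq_eqVlt => /orP[/eqP full|]; last by rewrite sum_pairn.
  have fl := full_third lab lad lbd (sum_pairn_full lbd full).
  have Sa : S a = 0.
    rewrite /S -(@sum_shift L (fun i => nbr E h a (u i))); last by rewrite -[L in u L]add0n (bc_uper C).
    by rewrite big1 // => i _; rewrite fl.
  have [aC _ _ ah _] := lab.
  have := deg_ge3 (edge_V cr hE ah); rewrite (link_deg lab) -/(S a) Sa h3 //.
have := lt _ _ _ lxy lxz lyz; have := lt _ _ _ lyx lyz lxz; have := lt _ _ _ lzx lzy lxy.
have := deg_triangle cr (adj_edge hE xh yh xy) (adj_edge hE yh zh yz) (adj_edge hE xh zh xz).
rewrite (link_deg lxy) (link_deg lyz) (link_deg lzx) h3 -/(S x) -/(S y) -/(S z).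
have := cr_lk cr; clear -Ll; move: (S x) (S y) (S z) => a b d; lia.
Qed.

Lemma third_gap y z p : linked y z -> u p.+2 \in h ->
  [/\ pairn y z p.+1 = 0, pairn y z p <= 1 & pairn y z p.+2 <= 1].
Proof.
move=> lk uh; have lk' := linked_sym lk.
have [oy oy'] := third_off lk uh.
have le2 i : pairn y z i <= 2 by rewrite /pairn; case: nbr; case: nbr.
split.
- by rewrite /pairn (third_nbr lk uh) (third_nbr lk' uh).
- have := le2 p; rewrite leq_eqVlt => /orP[/eqP /(pairn2 lk)[o _]|//].
  by move: oy; rewrite o.
- have := le2 p.+2; rewrite leq_eqVlt => /orP[/eqP /(pairn2 lk)[o _]|//].
  by move: oy'; rewrite o.
Qed.

(** Without a third vertex [h] adds only 2 to at most [L] cycle contacts. A third vertex adds 4, but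
    it lies on the cycle and causes a gap there. *)
Lemma pair_third y z : linked y z -> L.+3 <= deg E y + deg E z ->
  exists p, [/\ u p.+2 \in h, #|h| = 3 & \sum_(i < L) pairn y z i = L.-1].
Proof.
move=> lk; have lk' := linked_sym lk; have [yC zC yz yh zh] := lk.
rewrite (link_deg lk) (link_deg lk') addnACA -sum_pairn => big.
have le := sum_pairn_le lk; have h3 := uniform_le3 uni hE.
have c3 : #|h| = 3 by clear -big le h3; lia.
have [x xh] : exists x, x \in h :\ y :\ z.
  apply/set0Pn; rewrite -card_gt0; have := cardsD1 y h; have := cardsD1 z (h :\ y).
  rewrite yh !inE zh eq_sym yz c3 /=; clear; lia.
move: xh; rewrite !inE => /and3P[xz xy xh].
have [xC|xC] := boolP (x \in cvtx L u); last first.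
  by case: (@third_out x y z) => //; split; rewrite // ?xy ?xz.
have [i i2 e] := cvtx_index C 2 xC.
have [p ip] : exists p, i = p.+2 by exists (i - 2); clear -i2; lia.
rewrite e ip in xh; exists p; split=> //.
have [g0 g1 g2] := third_gap lk xh.
have [lt _] := sum_pairn_gap lk g0 g1 g2.
by move: big lt; rewrite c3; move: (\sum_(i < L) _) => S; clear; lia.
Qed.

Lemma pair_deg_le y z : linked y z -> deg E y + deg E z <= L.+3.
Proof.
move=> lk; rewrite leqNgt; apply/negP => big.
have [p [uh c3 eS]] := pair_third lk (ltnW big); move: big.
rewrite (link_deg lk) (link_deg (linked_sym lk)) addnACA -sum_pairn eS c3.
by clear -L3; lia.
Qed.

(** In the equality case every cycle vertex except the third vertex of [h] sees exactly one of [y],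
    [z]. Both have some contact, being of degree at least 3, so along the arc avoiding that vertex
    the seen one changes somewhere. *)
Lemma pair_change y z : linked y z -> L.+3 <= deg E y + deg E z ->
  exists j, ((y \in c j) && (z \in c j.+2)) || ((z \in c j) && (y \in c j.+2)).
Proof.
move=> lk big; have lk' := linked_sym lk; have [yC zC yz yh zh] := lk.
have [p [uh c3 eS]] := pair_third lk big.
have [g0 g1 g2] := third_gap lk uh.
have [_ /(_ eS) one] := sum_pairn_gap lk g0 g1 g2.
pose b t := nbr E h y (u (p + t).+1).
have find t0 t1 : linked t0 t1 -> exists2 t, 2 <= t <= L & nbr E h t0 (u (p + t).+1).
  move=> l01; have [_ _ _ t0h _] := l01.
  have := deg_ge3 (edge_V cr hE t0h); rewrite (link_deg l01) c3 => pos.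
  have : \sum_(i < L) nbr E h t0 (u i) != 0 by clear -pos; lia.
  rewrite sum_nat_eq0 negb_forall => /existsP[i]; rewrite implyTb eqb0 negbK => n.
  have [j ij e] := cvtx_index C p.+3 (cvtx_u C i).
  have jne : j != p.+2 + L.
    apply/eqP => ej; move: n; rewrite e ej (bc_uper C).
    by rewrite (third_nbr l01 uh).
  exists (j - p.+1); first by clear -ij jne; lia.
  have -> : (p + (j - p.+1)).+1 = j by clear -ij; lia.
  by rewrite -e.
have exone t : 2 <= t <= L -> nbr E h z (u (p + t).+1) = ~~ b t.
  by move=> /one; rewrite /pairn /b; case: nbr; case: nbr.
have [ty tyL by_] := find y z lk; have [tz tzL bz_] := find z y lk'.
have bne : b ty != b tz.
  by move: bz_; rewrite exone // /b by_; case: nbr.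
have [t tL bt] := change_point tyL tzL bne.
have e1 := exone t ltac:(clear -tL; lia); have e2 := exone t.+1 ltac:(clear -tL; lia).
exists (p + t); move: e1 e2 bt; rewrite /b addnS.
case n1: (nbr E h y (u (p + t).+1)); case n2: (nbr E h y (u (p + t).+2)) => //= n3 n4 _.
  by rewrite (owner_change lk) ?n1 ?n2 ?n3 ?n4.
by rewrite (owner_change lk') ?n1 ?n2 ?n3 ?n4 ?orbT.
Qed.

End Link.
End OneCycle.

(* Exchanging [y], [z] with [u (j + 1)], [u (j + 2)] gives another cycle of the same
   length, so the degree bound for linked pairs holds for both pairs. *)
Lemma swap_link u c (C : bcycle E L u c) h y z j : h \in E -> linked u h y z ->
  y \in c j -> z \in c j.+2 -> False.
Proof.
move=> hE lk yc zc; have L3 := cyc_ge3 cr C L1.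
have dyz := pair_deg_le C hE lk; have hC := link_off C hE lk.
have [yC zC yz yh zh] := lk.
have hc i : h != c i by apply: contraNneq hC => ->; apply: (ched_c C).
have c02 : c j != c j.+2 by rewrite -addn2; apply: (cyc_cne C); clear -L3; lia.
have f0 : free L c j 3 (c j) by have := @free_on _ _ _ _ _ C j 3 0 isT; rewrite addn0.
have f2 : free L c j 3 (c j.+2) by have := @free_on _ _ _ _ _ C j 3 2 isT; rewrite addn2.
have u3 : u (j + 3) \in c j.+2 by rewrite addn3; apply: bc_memR C _.
have [||u' [c' [C' Uv _]]] := cyc_insert2 C (i := j) (n := 3) _ yC zC yz (bc_edge C j) hE
  (bc_edge C j.+2) _ f0 (free_off C hC) f2 (bc_memL C j) yc yh zh zc u3.
- by clear -L3; lia.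
- by rewrite /= !inE negb_or c02 [c j == h]eq_sym !hc.
rewrite (subnK L3) in C' Uv.
have out' m : m \in [:: 1; 2] -> u (j + m) \notin cvtx L u'.
  move=> m12; rewrite Uv !negb_or ![_ == y]eq_sym ![_ == z]eq_sym !(off_ne C) // !andbT.
  apply/walk_vtx => -[n nj /(cyc_uwin C (a := j.+1))]; rewrite !inE.
  have m2 : 0 < m <= 2 by move: m12; rewrite !inE => /orP[] /eqP->.
  by move/(_ ltac:(clear -m2 L3; lia) ltac:(clear -nj L3; lia)); clear -m2 nj; lia.
have u12 : u (j + 1) != u (j + 2).
  have -> : j + 2 = j + 1 + 1 by clear; lia.
  by apply: (cyc_une C); clear -L3; lia.
have lk' : linked u' (c j.+1) (u (j + 1)) (u (j + 2)).
  split; rewrite ?out' // ?addn1 ?addn2; [exact: bc_memL C _|exact: bc_memR C _].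
have dt := pair_deg_le C' (bc_edge C j.+1) lk'.
have [_ _ _ t1 t2] := lk'.
have t1c : u (j + 1) \in c j by rewrite addn1; apply: bc_memR C _.
have t2c : u (j + 2) \in c j.+2 by rewrite addn2; apply: bc_memL C _.
have yu i : y != u i by apply: (off_ne C).
have zu i : u i != z by rewrite eq_sym; apply: (off_ne C).
(* Both linked pairs have degree sum at most L + 3, so twice the total is at most 4L + 12; density
   of the 4-cycle with k >= L + 2 demands more. *)
have := @deg_square _ _ _ _ _ cr y (u (j + 1)) (u (j + 2)) z.
rewrite /= !inE !negb_or !yu yz !zu u12 => /(_ isT).
rewrite (adj_edge (bc_edge C j) yc t1c (yu _)) (adj_edge (bc_edge C j.+1) t1 t2 u12).
rewrite (adj_edge (bc_edge C j.+2) t2c zc (zu _)) (adj_edge hE zh yh) 1?eq_sym //.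
move=> /(_ isT isT isT isT); have := cr_lk cr.
move: (deg E y) (deg E z) (deg E (u (j + 1))) (deg E (u (j + 2))) dyz dt => a b d e.
by clear -Ll; lia.
Qed.

Lemma no_link u c (C : bcycle E L u c) h y z : h \in E -> linked u h y z -> False.
Proof.
move=> hE lk; have lk' := linked_sym lk; have [_ _ yz yh zh] := lk.
have big : L.+3 <= deg E y + deg E z.
  by have := deg_edge cr (adj_edge hE yh zh yz); have := cr_lk cr; clear -Ll; lia.
have [j /orP[/andP[yc zc]|/andP[zc yc]]] := pair_change C hE lk big.
  exact: (swap_link C hE lk yc zc).
exact: (swap_link C hE lk' zc yc).
Qed.

Lemma no_second_cycle u c : bcycle E L u c -> False.
Proof.
move=> C.
have att w g : w \in V :\: cvtx L u -> g \in E -> w \in g -> g :\ w \subset cvtx L u.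
  rewrite inE => /andP[wC _] gE wg; apply/subsetP => x; rewrite !inE => /andP[xw xg].
  apply: contraT => xC; case: (@no_link u c C g w x gE).
  by split; rewrite // eq_sym.
have := count_indep cr C L1 no_cycle1 att; have := dense_V cr.
have : L.+1 * #|V| <= (k - 1) * #|V|.
  by rewrite leq_mul2r; apply/orP; right; have := cr_lk cr; clear -Ll; lia.
by move=> h1 h2 h3; have := leq_trans h2 (leq_trans h3 h1); rewrite ltnn.
Qed.

End SecondCycle.
(** * Crossing chords of a longest path *)

Section Crossing.
Variables (T : finType) (E : {set {set T}}) (k l : nat) (V : {set T}).
Hypothesis cr : critical E k l V.

Let uni := cr_uni cr.
Let lin := cr_lin cr.

Lemma no_long_cycle N : 1 < N -> l <= N.+1 -> has_bcycle E N -> False.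
Proof.
move=> N1 lN [u [c C]]; have le := cyc_le cr C.
have [e|e] : N = l \/ N.+1 = l by clear -le lN; lia.
  exact: (no_longest_cycle cr C N1 e).
exact: (no_second_cycle cr N1 e C).
Qed.

(** Adjacent degrees sum to at least 5, so some vertex has degree at least 3 and lies on two
    hyperedges. *)
Lemma l_ge2 : 1 < l.
Proof.
have kV := cr_card cr; have k4 := cr_k4 cr.
have [y yV] : exists y, y \in V by apply/set0Pn; rewrite -card_gt0; clear -kV; lia.
have dy := deg_low cr yV.
have [x a] : exists x, adj E y x.
  have : deg E y != 0 by clear -dy k4; lia.
  rewrite /deg sum_nat_eq0 negb_forall => /existsP[x]; rewrite implyTb eqb0 negbK.
  by exists x.
have [z [h [hE zh dz]]] : exists z h, [/\ h \in E, z \in h & 2 < deg E z].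
  have dd := deg_edge cr a; case/adjP: a => _ [h [hE yh xh]].
  have [d|d] := ltnP 2 (deg E y); first by exists y, h.
  by exists x, h; split=> //; clear -d dd k4; lia.
have [g [gE zg gh]] := other_edge cr hE zh dz.
have [s sh sz] := edge_other cr hE zh; have [t tg tz] := edge_other cr gE zg.
have st : s != t.
  apply: contraNneq gh => e; apply/eqP; apply: (linear_eq lin gE hE tz) => //.
  by rewrite -e.
have sg : seg E (inl s) [:: inl s; inr h; inl z; inr g; inl t] (inl t).
  by rewrite /= hE sh zh gE zg tg !eqxx.
have := long_seg cr sg; suff -> : uniq [:: inl s; inr h; inl z; inr g; inl t].
  by move=> /(_ isT) /=; clear; lia.
apply: uniq_nodes; rewrite /= !inE ?negb_or ?sz ?st ?[z == t]eq_sym ?tz //.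
by rewrite eq_sym gh.
Qed.

Let path_l v h := berge_path E l v h.

Lemma path_uinj v h i j : path_l v h -> i <= l -> j <= l -> v i = v j -> i = j.
Proof. by case=> vi _ il jl; apply: (vi i j il jl). Qed.

Lemma path_hinj v h i j : path_l v h -> i < l -> j < l -> h i = h j -> i = j.
Proof. by case=> _ [hi _] il jl; apply: (hi i j il jl). Qed.

Lemma path_inc v h i : path_l v h -> i < l -> [/\ h i \in E, v i \in h i & v i.+1 \in h i].
Proof. by case=> _ [_ H]; apply: H. Qed.

Lemma path_vne v h i j : path_l v h -> i <= l -> j <= l -> i != j -> v i != v j.
Proof. by move=> P il jl; apply: contraNneq => /(path_uinj P il jl)->. Qed.

Lemma path_walk_seg v h a b : path_l v h -> a <= b <= l ->
  seg E (inl (v a)) (walk v h a (b - a)) (inl (v b)).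
Proof.
move=> P ab; have := @walk_seg _ E v h a (b - a); have -> : a + (b - a) = b by clear -ab; lia.
by apply=> j jb; apply: (path_inc P); clear -ab jb; lia.
Qed.

Lemma path_walk_uniq v h a b : path_l v h -> a <= b <= l -> uniq (walk v h a (b - a)).
Proof.
move=> P ab; apply: walk_uniq => i j; rewrite !inE => ai aj.
  by apply: (path_uinj P); clear -ab ai aj; lia.
by apply: (path_hinj P); clear -ab ai aj; lia.
Qed.

Lemma close_cycle v h a b e : path_l v h -> a <= b <= l -> e \in E -> v a \in e -> v b \in e ->
  (forall j, a <= j < b -> h j != e) -> has_bcycle E (b - a).+1.
Proof.
move=> P ab eE ae be eh.
have sg : seg E (inl (v a)) (walk v h a (b - a) ++ [:: inr e]) (inr e).
  by apply: (seg_cat (path_walk_seg P ab) _ (seg1 _ _)); rewrite /= eE be.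
apply: (seg_has_bcycle sg) => //; first by rewrite /= eE ae.
- rewrite cat_uniq (path_walk_uniq P ab) /= orbF andbT; apply/walk_hed => -[j jb e'].
  by have := eh j ltac:(clear -jb ab; lia); rewrite e' eqxx.
- by rewrite size_cat size_walk /=; clear; lia.
Qed.

(** The cycle runs from [v a] to [v q], crosses by [f] to [v b], returns backwards to [v p] and
    closes by [e]. *)
Lemma cross_cycle v h a q p b e f : path_l v h -> a <= q -> q < p -> p <= b -> b <= l ->
  e \in E -> f \in E -> e != f -> v a \in e -> v p \in e -> v b \in f -> v q \in f ->
  (forall j, (a <= j < q) || (p <= j < b) -> (h j != e) && (h j != f)) ->
  has_bcycle E ((q - a) + (b - p)).+2.
Proof.
move=> P aq qp pb bl eE fE ef ae pe bf qf av.
have q1 : a <= q <= l by clear -aq qp pb bl; lia.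
have q2 : p <= b <= l by clear -aq qp pb bl; lia.
pose W1 := walk v h a (q - a); pose W2 := walk v h p (b - p).
have s1 : seg E (inl (v a)) W1 (inl (v q)) := path_walk_seg P q1.
have s2 : seg E (inl (v p)) W2 (inl (v b)) := path_walk_seg P q2.
pose s := W1 ++ inr f :: rev W2 ++ [:: inr e].
have sg : seg E (inl (v a)) s (inr e).
  apply: (seg_cat s1 (a' := inr f)); first by rewrite /= fE qf.
  apply: (@seg_cons _ _ _ (inl (v b))); first by rewrite /= fE bf.
  by apply: (seg_cat (seg_rev s2) _ (seg1 _ _)); rewrite /= eE pe.
apply: (seg_has_bcycle sg) => //; first by rewrite /= eE ae.
- have pe' : perm_eq s (inr e :: inr f :: W1 ++ W2).
    by apply/permP => x; rewrite /s /= !count_cat /= !count_cat count_rev /=; clear; lia.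
  rewrite (perm_uniq pe') /= cat_uniq (path_walk_uniq P q1) (path_walk_uniq P q2) andbT.
  have nin g : (forall j, (a <= j < q) || (p <= j < b) -> h j != g) -> inr g \notin W1 ++ W2.
    move=> H; rewrite mem_cat negb_or; apply/andP; split; apply/walk_hed => -[j jb e'].
      by have := H j ltac:(clear -jb aq; lia); rewrite e' eqxx.
    by have := H j ltac:(clear -jb pb; lia); rewrite e' eqxx.
  rewrite inE negb_or !nin ?andbT /=; last by move=> j /av/andP[].
    apply/andP; split; first by apply: contra ef => /eqP[->].
    apply/hasPn => -[x|g] /=.
      move/walk_vtx => [j jb ->]; apply/walk_vtx => -[i ib /(path_uinj P)].
      by move/(_ ltac:(clear -jb q2; lia) ltac:(clear -ib q1; lia)); clear -jb ib qp aq; lia.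
    move/walk_hed => [j jb ->]; apply/walk_hed => -[i ib /(path_hinj P)].
    by move/(_ ltac:(clear -jb q2; lia) ltac:(clear -ib q1 qp q2; lia)); clear -jb ib qp aq; lia.
  by move=> j /av/andP[].
- by rewrite /s size_cat /= size_cat size_rev !size_walk /=; clear; lia.
Qed.

Lemma path_rev v h : path_l v h -> path_l (fun i => v (l - i)) (fun i => h (l - i.+1)).
Proof.
move=> P; split; [|split].
- by move=> i j; rewrite !inE => il jl /(path_uinj P); clear -il jl; lia.
- by move=> i j; rewrite !inE => il jl /(path_hinj P); clear -il jl; lia.
move=> i il; have [hE v1 v2] := path_inc P (i := l - i.+1) ltac:(clear -il; lia).
split=> //; have -> // : l - i = (l - i.+1).+1 by clear -il; lia.
Qed.

(** By uniformity the chord can coincide only with the path hyperedges [h 0], [h i] or [h i.+1]. In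
    the first case [v 0] is given up, in the last [v i.+1], while [h i] is dropped from the cycle
    anyway: each chord costs at most one vertex. *)
Lemma end_edge v h i e : path_l v h -> i < l -> e \in E -> v 0 \in e -> v i.+1 \in e ->
  exists a p, [/\ v a \in e, v p \in e,
    (a = 0) \/ [/\ a = 1, 0 < i & e = h 0],
    (p = i.+1) \/ [/\ p = i.+2, i.+1 < l & e = h i.+1] /\ a = 0 &
    forall j, j < l -> (a <= j < i) || (p <= j) -> h j != e].
Proof.
move=> P il eE v0 vi.
have inj j j' : j < l -> j' < l -> j != j' -> h j != h j'.
  by move=> jl jl'; apply: contraNneq => /(path_hinj P jl jl')->.
case ex: [exists j : 'I_l, h j == e]; last first.
  exists 0, i.+1; split=> //; try by left.
  move=> j jl _; apply: contraFneq ex => e'; apply/existsP; exists (Ordinal jl).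
  by rewrite /= e'.
case/existsP: ex => -[j jl] /= /eqP ej.
have [hE vj vj1] := path_inc P jl.
have [ji|ji] := eqVneq j i.
  exists 0, i.+1; split=> //; try by left.
  by move=> j' jl' jj; rewrite -ej; apply: inj => //; rewrite ji; clear -jj; lia.
have [ji1|ji1] := eqVneq j i.+1.
  exists 0, i.+2; split=> //.
  - by rewrite -ej -{1}ji1.
  - by left.
  - by right; split; [split; rewrite -?ji1|].
  by move=> j' jl' jj; rewrite -ej; apply: inj => //; rewrite ji1; clear -jj; lia.
have [j0|j0] := eqVneq j 0.
  exists 1, i.+1; split=> //.
  - by rewrite -ej -{1}j0.
  - by right; split=> //; [clear -ji j0; lia|rewrite -j0].
  - by left.
  by move=> j' jl' jj; rewrite -ej; apply: inj => //; rewrite j0; clear -jj; lia.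
case: (@uniform_no4 _ _ uni e (v 0) (v i.+1) (v j) (v j.+1)) => //; rewrite -?ej //.
have ne := path_vne P.
rewrite /= !inE !negb_or !ne //; clear -ji ji1 j0 jl il; lia.
Qed.

Lemma no_cross v h i : path_l v h -> i < l ->
  adj E (v 0) (v i.+1) -> adj E (v l) (v i) -> False.
Proof.
move=> P il /adjP[_ [e [eE v0e vie]]] /adjP[_ [f [fE vlf vif]]].
have l2 := l_ge2; have ne := path_vne P.
(* A common chord contains [v 0], [v i], [v i.+1] and [v l], so [i] is [0] or [l - 1]; it is then
   the first or last path hyperedge, and closing the rest of the path gives length [l]. *)
have [ef|ef] := eqVneq e f.
  have [i0|i0] := posnP i.
    rewrite i0 in vie vif; have [h0E v00 v10] := path_inc P (ltnW l2).
    have n01 : v 0 != v 1 by apply: ne; clear -l2; lia.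
    have eh : e = h 0 := linear_eq lin eE h0E n01 v0e vie v00 v10.
    have := @close_cycle v h 1 l e P _ eE vie; rewrite {1}ef => H.
    apply: (@no_long_cycle (l - 1).+1); [clear -l2; lia|clear; lia|apply: H => //; first by clear -l2; lia].
    move=> j jl; rewrite eh; apply/eqP => /(path_hinj P).
    by case/andP: jl => j0 jl /(_ jl (ltnW l2)) e0; rewrite e0 in j0.
  have [il1|il1] := eqVneq i.+1 l.
    have [hE vi vi1] := path_inc P il.
    have nii : v i != v i.+1 by apply: ne; clear -il; lia.
    have eh : e = h i by apply: (linear_eq lin eE hE nii) => //; rewrite ef.
    apply: (@no_long_cycle (i - 0).+1); [clear -l2 il1; lia|clear -il1; lia|].
    apply: (@close_cycle v h 0 i e P _ eE v0e); [clear -il; lia|by rewrite ef|].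
    move=> j jl; rewrite eh; apply/eqP => /(path_hinj P).
    by move/(_ (ltn_trans jl il) il) => e0; rewrite e0 ltnn in jl.
  case: (@uniform_no4 _ _ uni e (v 0) (v i) (v i.+1) (v l)) => //; rewrite ?ef // -?ef //.
  rewrite /= !inE !negb_or !ne //; clear -il i0 il1; lia.
have [a [p [ae pe aC pC avE]]] := end_edge P il eE v0e vie.
have P' := path_rev P.
have i'l : l - i.+1 < l by clear -il; lia.
have [||a' [p' [ae' pe' aC' pC' avF]]] := @end_edge _ _ (l - i.+1) f P' i'l fE.
- by rewrite subn0.
- by have -> : l - (l - i.+1).+1 = i by clear -il; lia.
have aF : a' = 1 -> f = h l.-1 /\ i.+1 < l.
  case: aC' => [->//|[_ ii ->] _]; split; last by clear -ii; lia.
  by congr h; clear; lia.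
have pF : p' != (l - i.+1).+1 -> [/\ f = h i.-1, p' = (l - i.+1).+2 & 0 < i].
  case: pC' => [->|[[-> ii ->] _] _]; first by rewrite eqxx.
  by split; [congr h; clear -il ii; lia|by []|clear -ii il; lia].
have aE : a = 1 -> e = h 0 /\ 0 < i by case: aC => [->//|[_ ii ->]].
have pE : p != i.+1 -> [/\ e = h i.+1, p = i.+2 & i.+1 < l].
  by case: pC => [->|[[-> ii ->] _]]; rewrite ?eqxx.
have a01 : a <= 1 by case: aC => [->|[->]].
have a01' : a' <= 1 by case: aC' => [->|[->]].
have pr : i.+1 <= p <= i.+2 by case: pC => [->|[[->]]]; clear; lia.
have pr' : (l - i.+1).+1 <= p' <= (l - i.+1).+2 by case: pC' => [->|[[->]]]; clear; lia.
have ai : a <= i by case: aC => [->|[->]].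
have ai' : a' <= l - i.+1 by case: aC' => [->|[->]].
have pl : p <= l by have [->//|/pE[_ -> ]] := eqVneq p i.+1.
have pl' : p' <= l.
  have [->|/pF[_ -> ii]] := eqVneq p' (l - i.+1).+1; first by clear -il; lia.
  by clear -ii il; lia.
(* The initial piece could vanish only if both chords coincided with [h 0], contrary to their being
   distinct. The next bound is the same at the other end. *)
have aq : a <= l - p'.
  have [e1|e1] := eqVneq a 1; last by clear -e1 a01; lia.
  have [eh i0] := aE e1; have [->|np] := eqVneq p' (l - i.+1).+1; first by clear -e1 ai il; lia.
  have [fh ep _] := pF np; rewrite e1 ep.
  have : i != 1 by apply: contraNneq ef => i1; rewrite eh fh i1.
  by clear -i0 il; lia.
have pb : p <= l - a'.
  have [e1|e1] := eqVneq a' 1; last by clear -e1 a01' pl; lia.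
  have [fh i0] := aF e1; have [->|np] := eqVneq p i.+1; first by clear -e1 i0; lia.
  have [eh ep lt] := pE np; rewrite e1 ep.
  have : i.+1 != l.-1 by apply: contraNneq ef => i1; rewrite eh fh i1.
  by clear -i0 il lt; lia.
have hb := @cross_cycle v h a (l - p') p (l - a') e f P aq _ pb _ eE fE ef ae pe ae' pe'.
have c1 : a + (p - i.+1) <= 1.
  case: pC => [->|[[-> _ _] ->]]; last by clear; lia.
  by clear -a01; lia.
have c2 : a' + (p' - (l - i.+1).+1) <= 1.
  case: pC' => [->|[[-> _ _] ->]]; last by clear; lia.
  by clear -a01'; lia.
apply: (no_long_cycle _ _ (hb _ _ _)).
- by [].
- by clear -c1 c2 pr pr' il aq pb; lia.
- by clear -pr pr' il; lia.
- by clear; lia.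
move=> j jr; rewrite avE; [|clear -jr pr pr' il; lia|clear -jr pr pr' il; lia].
have := avF (l - j.+1); have -> : l - (l - j.+1).+1 = j by clear -jr pr pr' il; lia.
by apply; clear -jr pr pr' il pl' ai'; lia.
Qed.

End Crossing.

(** * Neighbours of the ends of a longest path *)

Section Ends.
Variables (T : finType) (E : {set {set T}}) (k l : nat) (V : {set T}).
Hypothesis cr : critical E k l V.

Let uni := cr_uni cr.
Let lin := cr_lin cr.
Let l2 : 1 < l := l_ge2 cr.
Notation path_l v h := (berge_path E l v h).

Definition onpath (v : nat -> T) : {set T} := [set v (val i) | i : 'I_l.+1].

Lemma onpathP v x : reflect (exists2 i, i <= l & x = v i) (x \in onpath v).
Proof.
apply: (iffP imsetP) => [[i _ ->]|[i il ->]]; first by exists i; rewrite // -ltnS.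
have lt : i < l.+1 by [].
by exists (Ordinal lt).
Qed.

Lemma sum_onpath v h (F : T -> nat) : path_l v h ->
  \sum_(x in onpath v) F x = \sum_(i < l.+1) F (v i).
Proof.
move=> P; rewrite big_imset //= => i j _ _ e; apply: val_inj.
by apply: (path_uinj P) e; rewrite -ltnS.
Qed.

(** A hyperedge not on the path would prolong it to [x], and a path hyperedge other than [h 0] would
    have four vertices. *)
Lemma end_out v h x : path_l v h -> x \notin onpath v -> adj E (v 0) x -> x \in h 0.
Proof.
move=> P xP /adjP[_ [g [gE v0g xg]]].
have xv i : i <= l -> x != v i.
  by move=> il; apply: contraNneq xP => e; apply/onpathP; exists i.
case ex: [exists j : 'I_l, h j == g].
  case/existsP: ex => -[j jl] /= /eqP ej; have [hE vj vj1] := path_inc P jl.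
  have [j0|j0] := posnP j; first by rewrite -j0 ej.
  case: (@uniform_no4 _ _ uni g x (v 0) (v j) (v j.+1)) => //; rewrite -?ej //.
  have ne := path_vne P.
  by rewrite /= !inE !negb_or !xv ?ne //; clear -j0 jl; lia.
have sg0 := path_walk_seg P (a := 0) (b := l) (leqnn l); rewrite subn0 in sg0.
have sg : seg E (inl x) (inl x :: inr g :: walk v h 0 l) (inl (v l)).
  apply: (@seg_cons _ _ _ (inr g)); first by rewrite /= gE xg.
  by apply: seg_cons sg0; rewrite /= gE v0g.
have := long_seg cr sg _; rewrite /= size_walk => H.
suff : l.*2.+3 <= l.*2.+2 by rewrite ltnn.
apply: H; have := path_walk_uniq P (a := 0) (b := l) (leqnn l); rewrite subn0 => ->.
rewrite inE /= andbT; apply/andP; split.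
  by apply/walk_vtx => -[j jl e]; have := xv j jl; rewrite e eqxx.
apply/walk_hed => -[j jl e]; move: ex => /existsP[]; exists (Ordinal (jl : j < l)).
by rewrite /= e.
Qed.

Lemma twin_card v h : path_l v h -> #|h 0 :\: onpath v| <= 1.
Proof.
move=> P; have [hE v0 v1] := path_inc P (ltnW l2).
have on i : i <= l -> v i \in onpath v by move=> il; apply/onpathP; exists i.
have n01 : v 0 != v 1 := path_vne P (leq0n l) (ltnW l2) isT.
apply/card_le1_eqP => x y; rewrite !inE => /andP[xP xh] /andP[yP yh].
have xv i : i <= l -> v i != x by move=> il; apply: contraNneq xP => <-; apply: on.
have yv i : i <= l -> y != v i by move=> il; apply: contraNneq yP => ->; apply: on.
have := @uniform_mem3 _ _ uni (h 0) (v 0) (v 1) x y hE.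
rewrite /= !inE negb_or n01 !xv ?(ltnW l2) // => /(_ isT v0 v1 xh yh).
by rewrite (negbTE (yv 0 _)) // (negbTE (yv 1 _)) ?(ltnW l2) //= => /eqP.
Qed.

Lemma deg_end v h : path_l v h ->
  deg E (v 0) <= \sum_(i < l) adj E (v 0) (v i.+1) + #|h 0 :\: onpath v|.
Proof.
move=> P; have -> : \sum_(i < l) adj E (v 0) (v i.+1) = \sum_(x in onpath v) adj E (v 0) x.
  by rewrite (sum_onpath (fun x => adj E (v 0) x : nat) P) big_ord_recl /= adj_irr.
rewrite -sum1_card [X in X + _]big_mkcond [X in _ + X]big_mkcond -big_split /=.
apply: leq_sum => x _.
rewrite !inE; case: ifP => xP; first by rewrite leq_addr.
case a: (adj E (v 0) x) => //=.
by rewrite (end_out P _ a) // xP.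
Qed.

Definition upd0 (v : nat -> T) (y : T) (i : nat) : T := if i is 0 then y else v i.
Definition updl (v : nat -> T) (y : T) (i : nat) : T := if i == l then y else v i.

Lemma upd0E v y i : 0 < i -> upd0 v y i = v i.
Proof. by case: i. Qed.

Lemma updlE v y i : i < l -> updl v y i = v i.
Proof. by move=> il; rewrite /updl (ltn_eqF il). Qed.

Lemma updl_last v y : updl v y l = y.
Proof. by rewrite /updl eqxx. Qed.

(* The vertices that can replace the first, respectively the last, vertex of the
   path without changing its hyperedges. *)
Definition var0 (v : nat -> T) (h : nat -> {set T}) y :=
  y \in h 0 /\ forall i, 0 < i <= l -> y != v i.
Definition varl (v : nat -> T) (h : nat -> {set T}) y :=
  y \in h l.-1 /\ forall i, i < l -> y != v i.

Lemma path_upd0 v h y : path_l v h -> var0 v h y -> path_l (upd0 v y) h.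
Proof.
move=> P [yh yv]; split; [|split]; last first.
- by case=> [|i] il; have [hE v1 v2] := path_inc P il.
- by case: P => _ [].
case=> [|i] [|j]; rewrite !inE //= => il jl e.
- by have := yv j.+1 jl; rewrite e eqxx.
- by have := yv i.+1 il; rewrite e eqxx.
- exact: (path_uinj P il jl).
Qed.

Lemma path_updl v h y : path_l v h -> varl v h y -> path_l (updl v y) h.
Proof.
move=> P [yh yv]; split; [|split]; last first.
- move=> i il; have [hE v1 v2] := path_inc P il; rewrite /updl (ltn_eqF il).
  split=> //; case: eqP => // e; by rewrite (_ : i = l.-1) // -e.
- by case: P => _ [].
move=> i j; rewrite !inE /updl => il jl.
case: eqP => [->|/eqP il']; case: eqP => [->|/eqP jl'] // e.
- by have := yv j; rewrite e eqxx ltn_neqAle jl jl' => /(_ isT).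
- by have := yv i; rewrite e eqxx ltn_neqAle il il' => /(_ isT).
- exact: (path_uinj P il jl).
Qed.

(** A vertex that can serve at both ends closes a cycle of length [l] through the last hyperedge. *)
Lemma var_ne v h y z : path_l v h -> var0 v h y -> varl v h z -> y != z.
Proof.
move=> P vy [zh zv]; apply/eqP => e; have P' := path_upd0 P vy.
have ll : l.-1 < l by clear -l2; lia.
have [hE v1 v2] := path_inc P ll.
apply: (@no_long_cycle _ _ _ _ _ cr (l.-1 - 0).+1); [clear -l2; lia|clear -l2; lia|].
apply: (@close_cycle _ _ _ (upd0 v y) h 0 l.-1 (h l.-1) P') => //; first by clear -l2; lia.
- by rewrite /= e.
- by rewrite upd0E // -ltnS (ltn_predK l2).
by move=> j jl; apply/eqP => /(path_hinj P (ltn_trans jl ll) ll) ej; rewrite ej ltnn in jl.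
Qed.

Lemma no_cross_var v h y z i : path_l v h -> var0 v h y -> varl v h z -> i < l ->
  adj E y (v i.+1) -> adj E z (v i) -> False.
Proof.
move=> P vy vz il ay az.
(* For [i = 0] and [i.+1 = l] a chord ends at a vertex that the other replacement would remove. Then
   only one end is replaced, and a path hyperedge supplies the second chord. *)
have [i0|i0] := posnP i.
  have [hE v0 v1] := path_inc P (ltnW l2).
  apply: (no_cross cr (path_updl P vz) (ltnW l2)).
    rewrite !updlE ?(ltnW l2) //; apply: (adj_edge hE v0 v1).
    exact: (path_vne P (leq0n l) (ltnW l2)).
  by rewrite updl_last updlE ?(ltnW l2) // -i0.
have [il1|il1] := eqVneq i.+1 l.
  have [hE vi vi1] := path_inc P il.
  apply: (no_cross cr (path_upd0 P vy) il) => //.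
  rewrite !upd0E ?(ltnW l2) // -[l in v l]il1; apply: (adj_edge hE vi1 vi).
  by apply: (path_vne P) => //; [exact: ltnW|rewrite gtn_eqF].
have yz := var_ne P vy vz; have Pl := path_updl P vz.
have vy' : var0 (updl v z) h y.
  case: vy => yh yv; split=> // j jl; rewrite /updl; case: (j =P l) => // _; exact: yv.
have ii : i.+1 < l by rewrite ltn_neqAle il1.
apply: (no_cross cr (path_upd0 Pl vy') il).
  by rewrite /= updlE.
by rewrite !upd0E ?(ltnW l2) // updl_last updlE.
Qed.

(** The chord closes the path without [v 0], so it may even be [h 0]. If it is [h 1] or the last
    hyperedge, one more vertex is lost, still leaving length [l - 1]. *)
Lemma no_last1 v h z : 2 < l -> path_l v h -> varl v h z -> adj E z (v 1) -> False.
Proof.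
move=> l3 P0 vz; set w := updl v z; have P : path_l w h := path_updl P0 vz.
have wl : w l = z by rewrite /w updl_last.
have w1 : w 1 = v 1 by rewrite /w updlE.
rewrite -wl -w1; case/adjP=> _ [f [fE wlf w1f]].
have inj j j' : j < l -> j' < l -> j != j' -> h j != h j'.
  by move=> jl jl'; apply: contraNneq => /(path_hinj P jl jl')->.
case ex: [exists j : 'I_l, (0 < j) && (h j == f)]; last first.
  apply: (@no_long_cycle _ _ _ _ _ cr (l - 1).+1); [clear -l3; lia|clear; lia|].
  apply: (@close_cycle _ _ _ w h 1 l f P) => //; first by clear -l3; lia.
  move=> j /andP[j0 jl]; apply: contraFneq ex => e; apply/existsP; exists (Ordinal jl).
  by rewrite /= j0 e eqxx.
case/existsP: ex => -[j jl] /= /andP[j0 /eqP ej]; have [hE vj vj1] := path_inc P jl.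
have [j1|j1] := eqVneq j 1.
  apply: (@no_long_cycle _ _ _ _ _ cr (l - 2).+1); [clear -l3; lia|clear; lia|].
  apply: (@close_cycle _ _ _ w h 2 l f P) => //; first by clear -l3; lia.
    by rewrite -ej -[2]/(1.+1) -{1}j1.
  by move=> i il; rewrite -ej; apply: inj => //; rewrite ?j1; clear -il; lia.
have [jl1|jl1] := eqVneq j.+1 l.
  apply: (@no_long_cycle _ _ _ _ _ cr (j - 1).+1); [clear -l3 jl1; lia|clear -jl1; lia|].
  apply: (@close_cycle _ _ _ w h 1 j f P) => //; first by clear -j0 jl; lia.
    by rewrite -ej.
  by move=> i il; rewrite -ej; apply: inj => //; clear -il jl; lia.
case: (@uniform_no4 _ _ uni f (w 1) (w j) (w j.+1) (w l)) => //; rewrite -?ej //.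
have ne := path_vne P.
by rewrite /= !inE !negb_or !ne //; clear -j0 jl j1 jl1 l3; lia.
Qed.

Lemma sum_bool_eq n (a b : nat -> bool) : (forall i, a i -> b i) ->
  \sum_(i < n) b i <= \sum_(i < n) a i -> forall i, i < n -> b i -> a i.
Proof.
move=> ab le i lt bi; apply: contraT => na; move: le; rewrite leqNgt => /negP[].
rewrite (bigD1 (Ordinal lt)) //= [X in _ < X](bigD1 (Ordinal lt)) //= bi (negbTE na) add0n ltnS.
by apply: leq_sum => j _; have := ab j; case: (a j) => // ->.
Qed.

(** [m] marks the indices seen by [v 0] or by its twin, the off-path vertex of [h 0]. Without a
    twin, [v 0] alone sees at least k/2. With one, the two degrees sum to more than [k] and each
    start misses at most one neighbour. Equality thus requires a twin with the same path
    neighbours. *)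
Lemma end_cover v h : path_l v h -> exists m : nat -> bool, [/\
  forall i, i < l -> m i -> exists2 y, var0 v h y & adj E y (v i.+1),
  k - 1 <= 2 * \sum_(i < l) m i &
  2 * \sum_(i < l) m i = k - 1 -> exists x, [/\ x \in h 0 :\: onpath v,
    2 * deg E (v 0) <= k.+1, 2 * deg E x <= k.+1 &
    forall i, i < l -> m i -> adj E (v 0) (v i.+1) && adj E x (v i.+1)]].
Proof.
move=> P; have [hE v0h v1h] := path_inc P (ltnW l2).
have vv0 : var0 v h (v 0).
  by split=> // i /andP[i0 il]; apply: (path_vne P) => //; rewrite ltn_eqF.
have d0 := deg_end P; have k4 := cr_k4 cr.
have [e0|[x xh]] := set_0Vmem (h 0 :\: onpath v).
  rewrite e0 cards0 addn0 in d0; have dl := deg_low cr (edge_V cr hE v0h).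
  exists (fun i => adj E (v 0) (v i.+1)); split.
  - by move=> i il a; exists (v 0).
  - by move: d0 dl; move: (\sum_(i < l) _) => S; clear; lia.
  by move: d0 dl; move: (\sum_(i < l) _) => S; clear -k4; lia.
have xh' := xh; move: xh'; rewrite inE => /andP[xP xh0].
have xv i : i <= l -> x != v i.
  by move=> il; apply: contraNneq xP => e; apply/onpathP; exists i.
have vx : var0 v h x by split=> // i /andP[_ il]; apply: xv.
have Px := path_upd0 P vx; have dx := deg_end Px.
have c0 := twin_card P; have cx := twin_card Px.
have dd := deg_edge cr (adj_edge hE xh0 v0h (xv 0 (leq0n l))).
pose a i := adj E (v 0) (v i.+1); pose b i := adj E x (v i.+1).
have {}dx : deg E x <= \sum_(i < l) b i + 1.
  by apply: leq_trans dx _; rewrite leq_add2l.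
have {}d0 : deg E (v 0) <= \sum_(i < l) a i + 1.
  by apply: leq_trans d0 _; rewrite leq_add2l.
pose m i := a i || b i.
have am : \sum_(i < l) a i <= \sum_(i < l) m i.
  by apply: leq_sum => i _; rewrite /m; case: (a i).
have bm : \sum_(i < l) b i <= \sum_(i < l) m i.
  by apply: leq_sum => i _; rewrite /m; case: (a i); case: (b i).
exists m; split.
- by move=> i il /orP[] ai; [exists (v 0)|exists x].
- move: dd dx d0 am bm; move: (\sum_(i < l) a i) (\sum_(i < l) b i) (\sum_(i < l) m i) => A B M.
  by clear; lia.
move=> e; exists x.
have [Aeq Beq] : \sum_(i < l) m i <= \sum_(i < l) a i /\ \sum_(i < l) m i <= \sum_(i < l) b i.
  move: dd dx d0 am bm e; move: (\sum_(i < l) a i) (\sum_(i < l) b i) (\sum_(i < l) m i) => A B M.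
  by clear -k4; lia.
split=> //.
- move: d0 am e; move: (\sum_(i < l) a i) (\sum_(i < l) m i) => A M; clear -k4; lia.
- move: dx bm e; move: (\sum_(i < l) b i) (\sum_(i < l) m i) => A M; clear -k4; lia.
have ma i : a i -> m i by rewrite /m => ->.
have mb i : b i -> m i by rewrite /m orbC => ->.
by move=> i il mi; rewrite -/(a i) -/(b i) (sum_bool_eq ma Aeq il mi) (sum_bool_eq mb Beq il mi).
Qed.

(** The marks from the two ends number at least [k - 1 >= l] and, chords never crossing, at most
    [l]. Hence equality holds everywhere and each index is marked from exactly one end; at index 1
    it is not the far one, by [no_last1]. *)
Lemma ends_eq v h : path_l v h -> exists x, [/\ x \in h 0 :\: onpath v,
  2 < l, 2 * deg E (v 0) <= k.+1, 2 * deg E x <= k.+1 &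
  adj E (v 0) (v 2) && adj E x (v 2)].
Proof.
move=> P; have Pr := path_rev P.
have [m [mP mk me]] := end_cover P; have [m' [mP' mk' _]] := end_cover Pr.
have lk := cr_lk cr; have k4 := cr_k4 cr.
have varE z : var0 (fun i => v (l - i)) (fun i => h (l - i.+1)) z -> varl v h z.
  case=> zh zv; split; first by rewrite subn1 in zh.
  move=> i il; have := zv (l - i); have -> : l - (l - i) = i by clear -il; lia.
  by apply; clear -il; lia.
have mP2 i : i < l -> m' (l - i.+1) -> exists2 z, varl v h z & adj E z (v i).
  move=> il mi; have [|z vz az] := mP' _ _ mi; first by clear -il; lia.
  exists z; first exact: varE.
  by move: az; have -> : l - (l - i.+1).+1 = i by clear -il; lia.
have sumr : \sum_(i < l) m' (l - i.+1) = \sum_(i < l) m' i.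
  by rewrite [RHS](reindex_inj rev_ord_inj).
have one i : i < l -> m i + m' (l - i.+1) <= 1.
  move=> il; case mi: (m i); case mi': (m' (l - i.+1)) => //.
  have [y vy ay] := mP i il mi; have [z vz az] := mP2 i il mi'.
  by case: (no_cross_var P vy vz il ay az).
have tot : \sum_(i < l) m i + \sum_(i < l) m' i <= l.
  rewrite -sumr -big_split /= -[X in _ <= X](card_ord l) -sum1_card.
  by apply: leq_sum => i _; apply: one.
have [em lk1 eq] : [/\ 2 * \sum_(i < l) m i = k - 1, l = k - 1 &
    \sum_(i < l) m i + \sum_(i < l) m' i = l].
  move: mk mk' tot; move: (\sum_(i < l) m i) (\sum_(i < l) m' i) => A B.
  by clear -lk k4; move=> *; split; lia.
have l3 : 2 < l by clear -lk1 k4; lia.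
have [x [xh dv dx mx]] := me em; exists x; split=> //.
apply: (mx 1 l2).
have all1 : forall i, i < l -> m i + m' (l - i.+1) = 1.
  apply: (@sum_max_eq l (fun i => m i + m' (l - i.+1)) 1) => //.
  by rewrite big_split /= sumr eq muln1.
have := all1 1 l2; case: (m 1) => //; case m1: (m' _) => // _.
have [z vz az] := mP2 1 l2 m1; by case: (no_last1 l3 P vz az).
Qed.

(** The path now begins [v 1], [h 0], [y], [e], [v 2]: the hyperedge [h 1] is released and [v 1]
    becomes the start. *)
Lemma swap_start v h x y e : path_l v h -> 2 < l ->
  y \in [:: v 0; x] -> x \in h 0 :\: onpath v -> e \in E -> y \in e -> v 2 \in e ->
  (forall j, j < l -> h j != e) ->
  path_l (fun i => if i is j.+1 then (if j is 0 then y else v i) else v 1)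
         (fun i => if i == 1 then e else h i).
Proof.
move=> P l3 yv xh eE ye v2e eh.
have [hE v0h v1h] := path_inc P (ltnW l2).
move: xh; rewrite inE => /andP[xP xh].
have xne i : i <= l -> x != v i.
  by move=> il; apply: contraNneq xP => e'; apply/onpathP; exists i.
have yh : y \in h 0 by move: yv; rewrite !inE => /orP[] /eqP->.
have yne i : 0 < i <= l -> y != v i.
  move=> /andP[i0 il]; move: yv; rewrite !inE => /orP[] /eqP->; last exact: xne.
  by apply: (path_vne P) => //; rewrite ltn_eqF.
split; [|split].
- case=> [|[|i]] [|[|j]]; rewrite !inE // => il jl e'.
  + by have := yne 1 ltac:(clear -l3; lia); rewrite e' eqxx.
  + by have := path_uinj P (ltnW l2) jl e'.
  + by have := yne 1 ltac:(clear -l3; lia); rewrite e' eqxx.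
  + by have := yne j.+2 jl; rewrite e' eqxx.
  + by have := path_uinj P il (ltnW l2) e'.
  + by have := yne i.+2 il; rewrite e' eqxx.
  + exact: (path_uinj P il jl e').
- move=> i j; rewrite !inE => il jl.
  case: eqP => [->|/eqP i1]; case: eqP => [->|/eqP j1] // e'.
  + by have := eh j jl; rewrite e' eqxx.
  + by have := eh i il; rewrite e' eqxx.
  + exact: (path_hinj P il jl e').
case=> [|[|i]] il //=.
by have [? ? ?] := path_inc P il.
Qed.

Lemma no_longest_path v h : path_l v h -> False.
Proof.
move=> P; have [x [xh l3 dv dx /andP[a0 ax]]] := ends_eq P.
have [hE v0h v1h] := path_inc P (ltnW l2).
have [h1E v1h1 v2h1] := path_inc P l2.
have [h2E v2h2 v3h2] := path_inc P l3.
have xh' := xh; move: xh'; rewrite inE => /andP[xP xh0].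
have xne i : i <= l -> x != v i.
  by move=> il; apply: contraNneq xP => e'; apply/onpathP; exists i.
have ne := path_vne P.
have n01 : v 0 != v 1 by apply: ne => //; apply: ltnW.
have n02 : v 0 != v 2 by apply: ne.
have n12 : v 1 != v 2 by apply: ne => //; apply: ltnW.
(* Only [h 2] can be an obstacle to the rerouting, and not for both starts, since it would then have
   four vertices. *)
have key y e : y \in [:: v 0; x] -> e \in E -> y \in e -> v 2 \in e ->
    (forall j, j < l -> h j != e) \/ e = h 2.
  move=> yv eE ye v2e.
  have yne i : 0 < i <= l -> y != v i.
    move=> /andP[i0 il]; move: yv; rewrite !inE => /orP[] /eqP->; last exact: xne.
    by apply: ne => //; rewrite ltn_eqF.
  have yh0 : y \in h 0 by move: yv; rewrite !inE => /orP[] /eqP->.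
  have [->|e2] := eqVneq e (h 2); first by right.
  left=> j jl; apply/eqP => ej; have [hjE vj vj1] := path_inc P jl.
  case: j jl ej hjE vj vj1 => [|[|[|j]]] jl ej hjE vj vj1.
  - case: (@uniform_no4 _ _ uni (h 0) x (v 0) (v 1) (v 2)) => //; last by rewrite ej.
    by rewrite /= !inE !negb_or !xne ?(ltnW l2) // n01 n02 n12.
  - have y1 : y != v 1 by apply: yne; clear -l3; lia.
    have := @linear_eq _ _ lin (h 0) (h 1) y (v 1) hE h1E y1 yh0 v1h.
    by rewrite {1}ej => /(_ ye v1h1) /(path_hinj P (ltnW l2) l2).
  - by move: e2; rewrite ej eqxx.
  rewrite ej in vj vj1; case: (@uniform_no4 _ _ uni e y (v 2) (v j.+3) (v j.+4)) => //.
  by rewrite /= !inE !negb_or !yne ?ne //; clear -jl l3; lia.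
have [y [e [yv eE ye v2e eh]]] : exists y e, [/\ y \in [:: v 0; x], e \in E, y \in e,
    v 2 \in e & forall j, j < l -> h j != e].
  case/adjP: a0 => _ [e [eE v0e v2e]]; case/adjP: ax => _ [f [fE xf v2f]].
  have [eh|e2] := key (v 0) e (mem_head _ _) eE v0e v2e; first by exists (v 0), e; rewrite mem_head.
  have xin : x \in [:: v 0; x] by rewrite !inE eqxx orbT.
  have [fh|f2] := key x f xin fE xf v2f; first by exists x, f.
  rewrite e2 in v0e; rewrite f2 in xf.
  case: (@uniform_no4 _ _ uni (h 2) x (v 0) (v 2) (v 3)) => //.
  by rewrite /= !inE !negb_or !xne // !ne //; clear -l3; lia.
have P' := swap_start P l3 yv xh eE ye v2e eh.
(* Now [x], [v 0] and [v 1] all have degree at most (k+1)/2, while density of their triangle needs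
   twice the degree sum to exceed 3k + 3. *)
have [x' [_ _ d1 _ _]] := ends_eq P'; rewrite /= in d1.
have x1 : x != v 1 by apply: xne; apply: ltnW.
have x0 : x != v 0 by apply: xne.
have := deg_triangle cr (adj_edge hE xh0 v0h x0) (adj_edge hE v0h v1h n01) (adj_edge hE xh0 v1h x1).
have k4 := cr_k4 cr.
by move: (deg E x) (deg E (v 0)) (deg E (v 1)) dv dx d1 => A B D; clear -k4; lia.
Qed.

End Ends.
(** * Reduction to a minimal counterexample *)

Section Shadow.
Variables (T : finType) (E : {set {set T}}).

Lemma arcs_deg : arcs E setT = \sum_x deg E x.
Proof.
rewrite /arcs (eq_bigl xpredT) => [|x]; last by rewrite inE.
by apply: eq_bigr => x _; apply: eq_bigl => y; rewrite inE.
Qed.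

Lemma shadow_deg x : #|[set e in shadow2 E | x \in e]| = deg E x.
Proof.
have -> : [set e in shadow2 E | x \in e] = [set [set x; y] | y in [set y | adj E x y]].
  apply/setP => e; rewrite !inE; apply/idP/imsetP.
    case/andP=> /andP[/cards2P[a [b [ab ->]]] /existsP[h /andP[hE sub]]].
    have ah : a \in h by apply: (subsetP sub); rewrite !inE eqxx.
    have bh : b \in h by apply: (subsetP sub); rewrite !inE eqxx orbT.
    rewrite !inE => /orP[] /eqP->; [exists b|exists a; last by rewrite setUC];
      by rewrite // inE; apply: (adj_edge hE); rewrite // eq_sym.
  case=> y; rewrite inE => /adjP[xy [h [hE xh yh]]] ->.
  rewrite cards2 xy !inE eqxx andbT /=; apply/existsP; exists h; rewrite hE.
  by apply/subsetP => z; rewrite !inE => /orP[] /eqP->.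
rewrite card_in_imset.
  rewrite /deg -sum1_card big_mkcond; apply: eq_bigr => y _.
  by rewrite inE; case: (adj E x y).
move=> y z; rewrite !inE => /adjP[xy _] /adjP[xz _] /setP/(_ y).
by rewrite !inE eqxx orbT [y == x]eq_sym (negbTE xy) /= => /esym/eqP.
Qed.

Lemma arcs_shadow : arcs E setT = 2 * #|shadow2 E|.
Proof.
rewrite arcs_deg; under eq_bigr do rewrite -shadow_deg.
have -> : 2 * #|shadow2 E| = \sum_(e in shadow2 E) #|e|.
  rewrite mulnC -sum_nat_const; apply: eq_bigr => e.
  by rewrite inE => /andP[/eqP->].
under [RHS]eq_bigr do rewrite -sum1_card.
rewrite (exchange_big_dep xpredT) //=; apply: eq_bigr => x _.
by rewrite -sum1_card; apply: eq_bigl => e; rewrite !inE.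
Qed.

Definition cutn (A B : {set T}) := \sum_(x in A) \sum_(y in B) adj E x y.

Lemma arcs_cutn S : arcs E S = cutn S S.
Proof. by []. Qed.

Lemma cutn_sym A B : cutn A B = cutn B A.
Proof.
rewrite /cutn exchange_big; apply: eq_bigr => x _; apply: eq_bigr => y _.
by rewrite adj_sym.
Qed.

Lemma cutnD (V S B : {set T}) : S \subset V ->
  cutn V B = cutn S B + cutn (V :\: S) B.
Proof. by move=> SV; rewrite /cutn (big_setID S) /= (setIidPr SV). Qed.

(** Rearranged, twice the cut minus the arcs inside [S] is what deleting [S] removes from
    [arcs E V]. *)
Lemma cutn_split (V S : {set T}) : S \subset V ->
  arcs E V + arcs E S = arcs E (V :\: S) + 2 * cutn S V.
Proof.
move=> SV; rewrite !arcs_cutn.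
rewrite (cutnD V SV) (cutn_sym S V) (cutnD S SV) (cutn_sym (V :\: S) V) (cutnD (V :\: S) SV).
rewrite (cutn_sym S (V :\: S)).
by move: (cutn S S) (cutn (V :\: S) S) (cutn (V :\: S) (V :\: S)) => a b c; lia.
Qed.

End Shadow.

(** * Traces of a hypergraph on a vertex subset *)

Section Restrict.
Variables (T : finType) (E : {set {set T}}) (V : {set T}).

(** Traces, rather than the hyperedges contained in [V], make the shadow of the restriction the
    subgraph of the shadow induced on [V]. *)
Definition restr : {set {set T}} := [set h :&: V | h in E & 1 < #|h :&: V|].

Lemma restrP h : reflect (exists g, [/\ g \in E, 1 < #|g :&: V| & h = g :&: V]) (h \in restr).
Proof.
apply: (iffP imsetP) => -[g]; first by rewrite inE => /andP[gE g1] ->; exists g.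
by case=> gE g1 ->; exists g; rewrite // inE gE.
Qed.

Lemma adj_restr x y : adj restr x y = [&& x \in V, y \in V & adj E x y].
Proof.
apply/adjP/and3P => [[xy [h [/restrP[g [gE g1 ->]]]]]|[xV yV /adjP[xy [g [gE xg yg]]]]].
  rewrite !inE => /andP[xg xV] /andP[yg yV]; split=> //.
  exact: (adj_edge gE xg yg xy).
split=> //; exists (g :&: V); rewrite !inE xg yg xV yV; split=> //.
apply/restrP; exists g; split=> //; apply/card_gt1P; exists x, y.
by rewrite !inE xg yg xV yV.
Qed.

Lemma deg_restr x : x \in V -> deg restr x = \sum_(y in V) adj E x y.
Proof.
move=> xV; rewrite /deg [RHS]big_mkcond; apply: eq_bigr => y _.
by rewrite adj_restr xV; case: (y \in V).
Qed.

Lemma arcs_restr (S : {set T}) : S \subset V -> arcs restr S = arcs E S.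
Proof.
move=> /subsetP SV; apply: eq_bigr => x xS; apply: eq_bigr => y yS.
by rewrite adj_restr !SV.
Qed.

Lemma restr_uniform : uniform23 E -> uniform23 restr.
Proof.
move=> uni h /restrP[g [gE g1 ->]].
have := uniform_le3 uni gE; have := subset_leq_card (subsetIl g V); lia.
Qed.

Lemma restr_linear : linear_hg E -> linear_hg restr.
Proof.
move=> lin h1 h2 /restrP[g1 [g1E _ ->]] /restrP[g2 [g2E _ ->]] ne.
have g12 : g1 != g2 by apply: contraNneq ne => ->.
apply: leq_trans (lin _ _ g1E g2E g12); apply: subset_leq_card.
by apply/subsetP => x; rewrite !inE => /andP[/andP[-> _] /andP[-> _]].
Qed.

Lemma restr_berge m : has_berge_path restr m -> has_berge_path E m.
Proof.
case=> v [h [vi [hi H]]].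
(* One hyperedge is chosen above each trace; distinct traces have distinct choices. The default
   [set0] does not arise for [i < m]. *)
pose g i := odflt set0 [pick g in E | g :&: V == h i].
have gP i : i < m -> g i \in E /\ g i :&: V = h i.
  move=> im; have [/restrP[f [fE _ e]] _ _] := H i im.
  rewrite /g; case: pickP => [f' /andP[f'E /eqP e']|/(_ f)] //=.
  by rewrite fE e eqxx.
exists v, g; split=> //; split.
  move=> i j im jm e; apply: hi => //.
  by have [_ <-] := gP i im; have [_ <-] := gP j jm; rewrite e.
move=> i im; have [_ vi1 vi2] := H i im; have [gE e] := gP i im.
by split=> //; [move: vi1|move: vi2]; rewrite -e inE => /andP[].
Qed.

End Restrict.

(** [critical] forbids paths of length [l + 1], and [no_longest_path] then forbids length [l]. The
    forbidden length descends from [k] to 0, where a single vertex is a path. *)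
Lemma no_critical (T : finType) (E : {set {set T}}) (k : nat) (V : {set T}) :
  V != set0 -> ~ has_berge_path E k ->
  (forall l, l < k -> ~ has_berge_path E l.+1 -> critical E k l V) -> False.
Proof.
move=> /set0Pn[x _] nk crit.
have down m : m <= k -> ~ has_berge_path E (k - m).
  elim: m => [|m IH] mk; first by rewrite subn0.
  have lt : k - m.+1 < k by lia.
  have e : (k - m.+1).+1 = k - m by lia.
  have nl : ~ has_berge_path E (k - m.+1).+1 by rewrite e; apply: IH; lia.
  by case=> v [h P]; apply: (no_longest_path (crit _ lt nl) P).
apply: (down k (leqnn k)); rewrite subnn; exists (fun=> x), (fun=> set0).
by split; [move=> i j; rewrite !inE; lia|split].
Qed.

Theorem theorem3 (k : nat) (T : finType) (E : {set {set T}}) :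
  4 <= k -> uniform23 E -> linear_hg E -> ~ has_berge_path E k ->
  2 * #|shadow2 E| <= (k - 1) * #|T|.
Proof.
move=> k4 uni lin nk; rewrite -arcs_shadow leqNgt; apply/negP => big.
pose bad (V : {set T}) := (k - 1) * #|V| < arcs E V.
have badT : bad setT by rewrite /bad cardsT.
case: (arg_minnP (fun V : {set T} => #|V|) badT) => V badV minV.
have small (S : {set T}) : S \proper V -> arcs E S <= (k - 1) * #|S|.
  by move=> /proper_card lt; rewrite leqNgt; apply/negP => /minV; rewrite leqNgt lt.
have properD (S : {set T}) : S \subset V -> S != set0 -> V :\: S \proper V.
  move=> SV /set0Pn[x xS]; apply/properP; split; first exact: subsetDl.
  by exists x; [apply: (subsetP SV)|rewrite inE xS].
have cardD (S : {set T}) : S \subset V -> #|V| = #|S| + #|V :\: S|.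
  by move=> SV; rewrite -(cardsID S V) (setIidPr SV).
have V0 : V != set0.
  by apply: contraTneq badV => ->; rewrite /bad /arcs big_set0 cards0 muln0.
apply: (@no_critical T (restr E V) k V V0); first by move=> /restr_berge.
move=> l lk nl; split=> //.
- exact: restr_uniform.
- exact: restr_linear.
- by move=> h /restrP[g [_ _ ->]]; apply: subsetIr.
(* A set violating the bound has more than [k] vertices, since even a complete graph on [k] vertices
   satisfies it. *)
- have le : arcs E V <= #|V| * #|V|.-1.
    rewrite -sum_nat_const; apply: leq_sum => x xV.
    rewrite (cardsD1 x V) xV /= -sum1_card.
    rewrite (bigD1 x xV) /= adj_irr add0n; apply: (@leq_trans (\sum_(y in V | y != x) 1)).
      by apply: leq_sum => y _; case: (adj E x y).
    by apply: eq_leq; apply: eq_bigl => y; rewrite !inE andbC.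
  have := leq_trans badV le; rewrite mulnC ltn_mul2l => /andP[_]; clear -k4; lia.
- move=> S SV S0; rewrite arcs_restr //.
  have -> : \sum_(x in S) deg (restr E V) x = cutn E S V.
    by apply: eq_bigr => x xS; rewrite deg_restr // (subsetP SV).
  have := cutn_split E SV; have := small _ (properD S SV S0); move: badV.
  rewrite /bad (cardD S SV) mulnDr.
  by move: ((k - 1) * #|S|) ((k - 1) * #|V :\: S|) (arcs E V) => a b c; lia.
move=> S SV S0 SneV.
case ex: [exists x in S, exists y in V :\: S, adj (restr E V) x y].
  by case/existsP: ex => x /andP[xS /existsP[y /andP[yV a]]]; exists x, y.
(* If no edge leaves [S], the edges split between [S] and its complement, and both parts obey the
   bound by minimality of [V]. *)
have cut0 : cutn E S (V :\: S) = 0.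
  apply: big1 => x xS; apply: big1 => y yS; case a: (adj E x y) => //.
  move: ex => /existsP[]; exists x; rewrite xS; apply/existsP; exists y.
  rewrite yS adj_restr a (subsetP SV) // andbT /=.
  by move: yS; rewrite inE => /andP[].
have sS : arcs E S <= (k - 1) * #|S| by apply: small; rewrite properEneq SneV.
have := cutn_split E SV; have := small _ (properD S SV S0); move: badV.
rewrite /bad (cardD S SV) mulnDr (cutn_sym E S V) (cutnD E S SV) (cutn_sym E _ S) cut0 -arcs_cutn.
move: sS.
by move: ((k - 1) * #|S|) ((k - 1) * #|V :\: S|) (arcs E V) => a b c; lia.
Qed.
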